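(* Let $d,n\ge 1$, let $\omega\in\mathbb{R}^d$ be Diophantine, i.e. $\omega\in\mathcal{DC}(\kappa,\tau)$ for some $\kappa>0$ and $\tau>d-1$, and let $A:\mathbb{T}^d\to gl(n,\mathbb{R})$ be $\mathcal{C}^\infty$ (so the cocycle $X_{\omega,A}$ is real). If $X_{\omega,A}$ is almost reducible, then $X_{\frac{\omega}{2},A_2}$ is real almost reducible, where $A_2(\theta)=A(2\theta)$ for all $\theta\in\mathbb{T}^d$. Explicitly: there exist $\mathcal{C}^\infty$ maps $Z_j:\mathbb{T}^d\to Gl(n,\mathbb{R})$, $F_j:\mathbb{T}^d\to gl(n,\mathbb{R})$ and matrices $B_j\in gl(n,\mathbb{R})$ such that $\partial_{\frac{\omega}{2}}Z_j(\theta)=A(2\theta)Z_j(\theta)-Z_j(\theta)(B_j+F_j(\theta))$ for all $\theta$, and $\lim_{j\to\infty}\|Z_j^{\pm1}\|_{\mathcal{C}^r}^m\|F_j\|_{\mathcal{C}^r}=0$ for all $r,m\in\mathbb{N}$.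
   Context: $\mathbb{T}^d=\mathbb{R}^d/\mathbb{Z}^d$. For $k\in\mathbb{Z}^d$, $|k|=\sum_i|k_i|$. $\omega\in\mathcal{DC}(\kappa,\tau)$ means $|\langle k,\omega\rangle|\ge \kappa|k|^{-\tau}$ for all $k\in\mathbb{Z}^d\setminus\{0\}$. For a map $Z$ on $\mathbb{T}^d$ and $v\in\mathbb{R}^d$, $\partial_v Z(\theta)=\frac{d}{dt}Z(\theta+tv)|_{t=0}$. Matrix norm: operator norm $\|\cdot\|$; $\|A\|_{\mathcal{C}^0}=\sup_\theta\|A(\theta)\|$, $\|A\|_{\mathcal{C}^r}=\max\{\|\partial^\alpha A\|_{\mathcal{C}^0}:|\alpha|\le r\}$. The cocycle $X_{\omega,A}:\mathbb{R}\times\mathbb{T}^d\to Gl(n,\mathbb{C})$ is the solution of $\frac{d}{dt}X^t(\theta)=A(\theta+t\omega)X^t(\theta)$, $X^0=I$. $X_{\omega,A}$ is almost reducible if there exist $\mathcal{C}^\infty$ maps $Z_j:\mathbb{T}^d\to Gl(n,\mathbb{C})$, $F_j:\mathbb{T}^d\to gl(n,\mathbb{C})$ and constant matrices $B_j\in gl(n,\mathbb{C})$ with $\partial_\omega Z_j=AZ_j-Z_j(B_j+F_j)$ on $\mathbb{T}^d$ and $\lim_j\|Z_j^{\pm1}\|_{\mathcal{C}^r}^m\|F_j\|_{\mathcal{C}^r}=0$ for all $r,m\in\mathbb{N}$ (meaning both for $Z_j$ and $Z_j^{-1}$). It is real almost reducible if $A$ is real and this holds with $Z_j$ real-valued and $B_j$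 real. *)

(* Defs.v *)
From HB Require Import structures.
From mathcomp Require Import all_boot all_order all_algebra.
From mathcomp Require Import all_classical all_reals all_analysis.
From mathcomp Require Import complex.
Set Implicit Arguments.
Unset Strict Implicit.
Unset Printing Implicit Defensive.
Import Order.TTheory GRing.Theory Num.Theory.
Import numFieldNormedType.Exports.
Local Open Scope classical_set_scope.
Local Open Scope ring_scope.

(* Points of R^d are row vectors 'rV[R]_d; a map on T^d = R^d/Z^d is a map on
   R^d which is 1-periodic in each coordinate direction. *)

Definition ev (R : realType) (d : nat) (k : 'I_d) : 'rV[R]_d := delta_mx 0 k.

Definition Zperiodic (R : realType) (d : nat) (T : Type) (f : 'rV[R]_d -> T) :=
  forall (x : 'rV[R]_d) (k : 'I_d), f (x + ev R k) = f x.

Fixpoint iter_partial (R : realType) (d : nat) (s : seq 'I_d)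
    (g : 'rV[R]_d -> R) : 'rV[R]_d -> R :=
  match s with
  | [::] => g
  | k :: s' => fun x => 'D_(ev R k) (iter_partial s' g) x
  end.

Definition smooth_fun (R : realType) (d : nat) (g : 'rV[R]_d -> R) :=
  forall s : seq 'I_d,
    continuous (iter_partial s g) /\
    forall (k : 'I_d) (x : 'rV[R]_d), derivable (iter_partial s g) x (ev R k).

Definition smooth_mx (R : realType) (d n : nat) (Z : 'rV[R]_d -> 'M[R[i]]_n) :=
  forall i j : 'I_n, smooth_fun (fun x => complex.Re (Z x i j)) /\ smooth_fun (fun x => complex.Im (Z x i j)).

Definition smooth_rmx (R : realType) (d n : nat) (Z : 'rV[R]_d -> 'M[R]_n) :=
  forall i j : 'I_n, smooth_fun (fun x => Z x i j).

Definition mx_lift (R : realType) (d n : nat)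
    (D : ('rV[R]_d -> R) -> ('rV[R]_d -> R)) (Z : 'rV[R]_d -> 'M[R[i]]_n) :
    'rV[R]_d -> 'M[R[i]]_n :=
  fun x => \matrix_(i, j) (Complex (D (fun y => complex.Re (Z y i j)) x)
                                   (D (fun y => complex.Im (Z y i j)) x)).

Definition mx_partial (R : realType) (d n : nat) (s : seq 'I_d)
    (Z : 'rV[R]_d -> 'M[R[i]]_n) := mx_lift (iter_partial s) Z.

Definition mx_dir (R : realType) (d n : nat) (v : 'rV[R]_d)
    (Z : 'rV[R]_d -> 'M[R[i]]_n) := mx_lift (fun g x => 'D_v g x) Z.

Definition vnorm (R : realType) (n : nat) (v : 'cV[R[i]]_n) : R :=
  Num.sqrt (\sum_i (complex.Re (v i 0) ^+ 2 + complex.Im (v i 0) ^+ 2)).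

Definition opnorm (R : realType) (n : nat) (M : 'M[R[i]]_n) : R :=
  sup [set y : R | exists v : 'cV[R[i]]_n, vnorm v <= 1 /\ y = vnorm (M *m v)].

Definition Cr_norm (R : realType) (d n : nat) (r : nat)
    (Z : 'rV[R]_d -> 'M[R[i]]_n) : R :=
  sup [set y : R | exists (s : seq 'I_d) (x : 'rV[R]_d),
                      (size s <= r)%N /\ y = opnorm (mx_partial s Z x)].

Definition cxm (R : realType) (n : nat) (M : 'M[R]_n) : 'M[R[i]]_n :=
  map_mx (fun a => Complex a 0) M.
Definition cxf (R : realType) (d n : nat) (Z : 'rV[R]_d -> 'M[R]_n) :
    'rV[R]_d -> 'M[R[i]]_n := fun x => cxm (Z x).

Definition knorm (d : nat) (k : 'rV[int]_d) : int := \sum_i `|k 0 i|.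

Definition DC (R : realType) (d : nat) (w : 'rV[R]_d) (kappa tau : R) :=
  forall k : 'rV[int]_d, k != 0 ->
    kappa * ((knorm k)%:~R `^ (- tau)) <= `| \sum_i (k 0 i)%:~R * w 0 i |.

Definition AR_data (R : realType) (d n : nat) (w : 'rV[R]_d)
    (A : 'rV[R]_d -> 'M[R[i]]_n)
    (Z F : nat -> 'rV[R]_d -> 'M[R[i]]_n) (B : nat -> 'M[R[i]]_n) :=
  (forall j,
      Zperiodic (Z j) /\ smooth_mx (Z j) /\ (forall x, Z j x \in unitmx) /\
      Zperiodic (F j) /\ smooth_mx (F j) /\
      forall x, mx_dir w (Z j) x = A x *m Z j x - Z j x *m (B j + F j x))
  /\ forall r m : nat,
      (fun j => Cr_norm r (Z j) ^+ m * Cr_norm r (F j)) @ \oo --> (0 : R)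
   /\ (fun j => Cr_norm r (fun x => invmx (Z j x)) ^+ m * Cr_norm r (F j))
        @ \oo --> (0 : R).

Definition almost_reducible (R : realType) (d n : nat) (w : 'rV[R]_d)
    (A : 'rV[R]_d -> 'M[R[i]]_n) :=
  exists (Z F : nat -> 'rV[R]_d -> 'M[R[i]]_n) (B : nat -> 'M[R[i]]_n),
    AR_data w A Z F B.

Definition real_almost_reducible (R : realType) (d n : nat) (w : 'rV[R]_d)
    (A : 'rV[R]_d -> 'M[R]_n) :=
  exists (Z F : nat -> 'rV[R]_d -> 'M[R]_n) (B : nat -> 'M[R]_n),
    AR_data w (cxf A) (fun j => cxf (Z j)) (fun j => cxf (F j))
      (fun j => cxm (B j)).

(* Main.v *)
(* The defect of reality of an almost conjugation [Z] is [W = conj(Z)^-1 Z]. It solves a linear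
   equation with coefficients [conj B] and [B] up to a tiny error, so after block-diagonalizing
   [B] its Fourier modes are negligible except at resonances: a label [k_i] in Z^d is attached to
   every index so that the entry (i, j) of [W] only carries the frequency [k] with
   [2 k = k_i + k_j] (the Diophantine condition makes it unique). On the doubled torus the
   characters [exp(-2 pi i <k_i, x>)] turn [x |-> W (2 x)] into a nearly constant matrix [W_0].
   There is a [z] on the unit circle for which [H = z + conj(z) conj(W_0)] is invertible with a
   controlled inverse (average the characteristic polynomial over roots of unity), and
   [Z (2 x)], corrected by the characters and by [H], is nearly real; twice its real part is the
   new conjugation. All bounds are polynomial in the size [X] of [Z] while the error is any
   negative power of [X]; interpolation between C^0 and C^(r+1) controls the new error in C^r. *)
Require Import Defs.
From HB Require Import structures.
From mathcomp Require Import all_boot all_order all_algebra.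
From mathcomp Require Import all_classical all_reals all_analysis.
From mathcomp Require Import perm mxpoly spectral complex.
From mathcomp Require Import ring lra zify.
Set Implicit Arguments.
Unset Strict Implicit.
Unset Printing Implicit Defensive.
Import Order.TTheory GRing.Theory Num.Theory.
Import numFieldNormedType.Exports.
Local Open Scope classical_set_scope.
Local Open Scope ring_scope.

Local Notation Re := complex.Re.
Local Notation Im := complex.Im.

Import ComplexField.Normc.

(** * Periodic functions with bounded partial derivatives *)

Section RealFunctions.
Variables (R : realType) (d : nat).
Implicit Types (g f : 'rV[R]_d -> R) (x e v : 'rV[R]_d).

(** The torus is doubled because a resonant frequency is half of [k_i + k_j], while half of a single
    label need not be integral; at [2 x] its character is that of [k_i + k_j], which splits into a
    row factor and a column factor. The matrix [H] comes from the exactly constant case: if the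
    gauged map [Z1] satisfies [conj(Z1)^-1 Z1 = W_0], then [Z1 H = z Z1 + conj(z Z1)], twice the
    real part of [z Z1]; the rotation [z] is there because the real part of an invertible matrix can
    be singular. The Fourier analysis is discrete: averages over a grid replace integrals and
    series, with errors of order [1 / N]. The frequency cutoff and the grid size are built from the
    scale [X], which is therefore a natural number. Each loss is a power of [X] whose exponent is
    fixed before the precision [mu], since [mu] must beat them all; only the number of derivatives,
    the smallness of [F] and the threshold for [X] depend on [mu]. The transform yields smallness in
    C^0 only, hence the final interpolation. *)

Lemma is_derive_line g x e (h : R) : derivable g (h *: e + x) e ->
  is_derive h 1 (fun t : R => g (t *: e + x)) ('D_e g (h *: e + x)).
Proof.
move=> dg; have E : (fun t : R => t^-1 *: (g ((t *: 1 + h) *: e + x) - g (h *: e + x)))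
   = (fun t : R => t^-1 *: (g (t *: e + (h *: e + x)) - g (h *: e + x))).
  by apply/funext => t; rewrite [t *: 1]mulr1 scalerDl addrA.
by apply: DeriveDef; rewrite /derivable /derive E.
Qed.

Lemma MVT_line g e : (forall x, derivable g x e) -> forall x (h : R),
  exists2 t : R, `|t| <= `|h| & g (h *: e + x) - g x = h * 'D_e g (t *: e + x).
Proof.
move=> dg x h.
pose phi (t : R) := g (t *: e + x).
have dphi (t : R) : is_derive t 1 phi ('D_e g (t *: e + x)).
  exact: is_derive_line.
have cphi a b : {within `[a, b], continuous phi}.
  apply: derivable_within_continuous => t _; exact: ex_derive.
have -> : g x = phi 0 by rewrite /phi scale0r add0r.
rewrite -/(phi h).
have [h0|h0] := lerP 0 h.
  have [c] := MVT_segment h0 (fun t _ => dphi t) (cphi 0 h).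
  rewrite in_itv /= => /andP[c0 ch] ->; exists c; last by rewrite subr0 mulrC.
  by rewrite !ger0_norm.
have [c] := MVT_segment (ltW h0) (fun t _ => dphi t) (cphi h 0).
rewrite in_itv /= => /andP[c0 ch] E; exists c.
  by rewrite !ler0_norm ?lerN2 // ltW.
by rewrite -opprB E sub0r mulrN opprK mulrC.
Qed.

(** The increment along [t (v + c e)] is split into one along [t v] and one along [t c e]. The mean
    value theorem turns the latter into [t c] times ['D_e g] at a point tending to [x], where
    continuity of that one derivative suffices. *)
Lemma derive_addv g x v e (c : R) :
  (forall y, derivable g y e) -> {for x, continuous (fun y => 'D_e g y)} ->
  derivable g x v ->
  derivable g x (v + c *: e) /\ 'D_(v + c *: e) g x = 'D_v g x + c * 'D_e g x.
Proof.
move=> dg cg dv.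
suff H : (fun t : R => t^-1 *: (g (t *: (v + c *: e) + x) - g x)) @ 0^' -->
   'D_v g x + c * 'D_e g x.
  split; first by apply/cvg_ex; exists ('D_v g x + c * 'D_e g x).
  exact: cvg_lim H.
have -> : (fun t : R => t^-1 *: (g (t *: (v + c *: e) + x) - g x)) =
  (fun t : R => t^-1 *: (g (t *: v + x) - g x)) \+
  (fun t : R => t^-1 *: (g (t *: (v + c *: e) + x) - g (t *: v + x))).
  apply/funext => t /=; rewrite -[RHS]scalerDr; congr (_ *: _); ring.
apply: cvgD; first exact: dv.
have P (t : R) := MVT_line dg (t *: v + x) (t * c).
pose th t := projT1 (cid2 (P t)).
have th1 t : `|th t| <= `|t * c| by rewrite /th; case: (cid2 (P t)).
have th2 t : g (t *: (v + c *: e) + x) - g (t *: v + x) = t * c * 'D_e g (th t *: e + (t *: v + x)).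
  rewrite /th; case: (cid2 (P t)) => u _ /= <-.
  by rewrite scalerDr scalerA addrAC addrC addrA.
have id0 : (fun t : R => t) @ 0^' --> (0 : R) by apply: cvg_within.
have tc0 : (fun t : R => t * c) @ 0^' --> (0 : R).
  by rewrite -[X in _ --> X](mul0r c); apply: cvgM; [exact: id0 | exact: cvg_cst].
have th0 : th @ 0^' --> (0 : R).
  apply/cvgr0Pnorm_le => eps eps0; near=> t; apply: (le_trans (th1 t)).
  by near: t; exact: (cvgr0_norm_le _ tc0).
have Hx : (fun t : R => th t *: e + (t *: v + x)) @ 0^' --> x.
  rewrite -[X in _ --> X](_ : 0 *: e + (0 *: v + x) = x); last by rewrite !scale0r !add0r.
  apply: cvgD; first exact: cvgZr_tmp.
  apply: cvgD; last exact: cvg_cst.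
  by apply: cvgZr_tmp; exact: id0.
have : (fun t => c * 'D_e g (th t *: e + (t *: v + x))) @ 0^' --> c * 'D_e g x.
  apply: cvgM; first exact: cvg_cst.
  exact: (cvg_comp _ _ Hx cg).
apply: cvg_trans; apply: near_eq_cvg.
near=> t. rewrite th2.
have t0 : t != 0 by near: t; exact: nbhs_dnbhs_neq.
by rewrite -[RHS]/(_ * _) -mulrA mulKf.
Unshelve. all: end_near.
Qed.

(** Building the direction one coordinate at a time, from the zero vector, replaces any appeal to
    total differentiability. *)
Lemma derive_sum_coord g x : (forall l y, derivable g y (ev R l)) ->
  (forall l, continuous (fun y => 'D_(ev R l) g y)) ->
  forall v, derivable g x v /\ 'D_v g x = \sum_l v 0 l * 'D_(ev R l) g x.
Proof.
move=> dg cg v.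
suff H (s : seq 'I_d) : derivable g x (\sum_(l <- s) v 0 l *: ev R l) /\
   'D_(\sum_(l <- s) v 0 l *: ev R l) g x = \sum_(l <- s) v 0 l * 'D_(ev R l) g x.
  have {1 2}-> : v = \sum_l v 0 l *: ev R l by exact: row_sum_delta.
  exact: H.
elim: s => [|l s [IH1 IH2]].
  by rewrite !big_nil; split; [exact: derivable0 | exact: derive0].
rewrite !big_cons addrC [X in _ = X]addrC -IH2.
have cgl : {for x, continuous (fun y => 'D_(ev R l) g y)} by exact: cg.
have := derive_addv (v 0 l) (dg l) cgl IH1.
exact.
Qed.

(** Derivability is demanded even at order 0, so derivatives of order [m.+1] exist, without a stated
    bound; this is what makes bounds at all orders yield [smooth_fun]. One constant serves all
    orders, so the size of a map is a single number. *)
Fixpoint Cb (m : nat) (a : R) (g : 'rV[R]_d -> R) : Prop :=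
  [/\ continuous g, forall x, `|g x| <= a,
     forall l x, derivable g x (ev R l) &
     if m is m'.+1 then forall l, Cb m' a (fun x => 'D_(ev R l) g x) else True].

Lemma Cb_cont m a g : Cb m a g -> continuous g.
Proof. by case: m => [|m] []. Qed.
Lemma Cb_bound m a g : Cb m a g -> forall x, `|g x| <= a.
Proof. by case: m => [|m] []. Qed.
Lemma Cb_derivable m a g : Cb m a g -> forall l x, derivable g x (ev R l).
Proof. by case: m => [|m] []. Qed.
Lemma Cb_ge0 m a g : Cb m a g -> 0 <= a.
Proof. by move/Cb_bound => /(_ 0); exact: le_trans. Qed.

Lemma Cb_le m a b g : a <= b -> Cb m a g -> Cb m b g.
Proof.
move=> ab; elim: m g => [|m IH] g [c1 c2 c3 c4]; split => //.
- by move=> x; exact: (le_trans (c2 x)).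
- by move=> x; exact: (le_trans (c2 x)).
- by move=> l; exact: IH (c4 l).
Qed.

Lemma CbW m m' a g : (m' <= m)%N -> Cb m a g -> Cb m' a g.
Proof.
elim: m m' g => [|m IH] [|m'] g //; rewrite ?ltnS => mm' [c1 c2 c3 c4]; split => //.
by move=> l; apply: IH (c4 l).
Qed.

Lemma Cb_partial m a g l : Cb m.+1 a g -> Cb m a (fun x => 'D_(ev R l) g x).
Proof. by case=> _ _ _; apply. Qed.

Lemma Cb_iter m a g (s : seq 'I_d) : Cb m a g -> (size s <= m)%N ->
  Cb (m - size s) a (iter_partial s g).
Proof.
move=> H; elim: s => [|l s IH] /= sm; first by rewrite subn0.
have := IH (ltnW sm); rewrite -(subnSK sm); exact: Cb_partial.
Qed.

Lemma Cb_intro m a g :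
  (forall s, (size s <= m)%N -> [/\ continuous (iter_partial s g),
     forall x, `|iter_partial s g x| <= a &
     forall l x, derivable (iter_partial s g) x (ev R l)]) -> Cb m a g.
Proof.
elim: m g => [|m IH] g H; have [h1 h2 h3] := H [::] isT; split => // l.
apply: IH => s sm.
have -> : iter_partial s (fun x => 'D_(ev R l) g x) = iter_partial (rcons s l) g.
  by elim: s {sm} => //= l' s ->.
by apply: H; rewrite size_rcons.
Qed.

Lemma Cb_smooth g : (forall m, exists a, Cb m a g) -> smooth_fun g.
Proof.
move=> H s; have [a Ha] := H (size s).
have := Cb_iter Ha (leqnn _); rewrite subnn => -[c1 _ c2 _]; split => //.
Qed.

Lemma Cb_dir m a g : Cb m.+1 a g ->
  forall x v, derivable g x v /\ 'D_v g x = \sum_l v 0 l * 'D_(ev R l) g x.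
Proof.
move=> [c1 c2 c3 c4] x v; apply: derive_sum_coord => // l; exact: Cb_cont (c4 l).
Qed.

Lemma CbD m a b f g : Cb m a f -> Cb m b g -> Cb m (a + b) (fun x => f x + g x).
Proof.
elim: m f g => [|m IH] f g [c1 c2 c3 c4] [e1 e2 e3 e4].
all: split => [x|x|l x|]; try exact: (cvgD (c1 x) (e1 x)).
all: try by apply: (le_trans (ler_normD _ _)); exact: lerD.
all: try exact: derivableD.
all: try done.
move=> l; have -> : (fun x => 'D_(ev R l) (fun x => f x + g x) x) =
   (fun x => 'D_(ev R l) f x + 'D_(ev R l) g x).
  by apply/funext => x; rewrite -deriveD.
exact: IH (c4 l) (e4 l).
Qed.

(** Each use of the Leibniz rule doubles the number of terms, whence [2 ^+ m]. *)
Lemma CbM m a b f g : Cb m a f -> Cb m b g ->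
  Cb m (2 ^+ m * (a * b)) (fun x => f x * g x).
Proof.
elim: m a b f g => [|m IH] a b f g Hf Hg; have [c1 c2 c3 c4] := Hf; have [e1 e2 e3 e4] := Hg.
all: have a0 := Cb_ge0 Hf; have b0 := Cb_ge0 Hg.
all: have ab0 : 0 <= a * b by exact: mulr_ge0.
all: have B x : `|f x * g x| <= a * b by rewrite normrM; exact: ler_pM.
all: split => [x|x|l x|]; try exact: (cvgM (c1 x) (e1 x)).
all: try exact: derivableM.
- by rewrite expr0 mul1r.
- done.
- apply: (le_trans (B x)); rewrite ler_peMl //; apply: exprn_ege1; lra.
move=> l; have -> : (fun x => 'D_(ev R l) (fun x => f x * g x) x) =
   (fun x => f x * 'D_(ev R l) g x + g x * 'D_(ev R l) f x).
  by apply/funext => x; rewrite (deriveM (c3 l x) (e3 l x)).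
have -> : 2 ^+ m.+1 * (a * b) = 2 ^+ m * (a * b) + 2 ^+ m * (b * a) by rewrite exprS; ring.
exact: CbD (IH _ _ _ _ (CbW (leqnSn m) Hf) (e4 l)) (IH _ _ _ _ (CbW (leqnSn m) Hg) (c4 l)).
Qed.

Lemma Cb_cst m (c : R) : Cb m `|c| (fun=> c).
Proof.
have D0 l : (fun x => 'D_(ev R l) (fun=> c) x) = (fun=> 0 : R).
  by apply/funext => x; rewrite derive_cst.
have H0 : forall m (a : R), 0 <= a -> Cb m a (fun=> 0 : R).
  elim=> [|k IH] a a0; split => [x|x|l x|].
  all: try by rewrite normr0.
  all: try exact: cst_continuous.
  all: try exact: derivable_cst.
  all: try done.
  move=> l; have -> : (fun x => 'D_(ev R l) (fun=> 0) x) = (fun=> 0 : R).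
    by apply/funext => x; rewrite derive_cst.
  exact: IH.
case: m => [|m]; split => //.
all: try exact: cst_continuous.
all: try by move=> l x; exact: derivable_cst.
by move=> l; rewrite D0; exact: H0.
Qed.

Lemma CbN m a f : Cb m a f -> Cb m a (fun x => - f x).
Proof.
elim: m f => [|m IH] f [c1 c2 c3 c4].
all: split => [x|x|l x|]; try exact: (cvgN (c1 x)).
all: try by rewrite normrN.
all: try exact: derivableN.
all: try done.
move=> l; have -> : (fun x => 'D_(ev R l) (fun x => - f x) x) =
   (fun x => - 'D_(ev R l) f x).
  by apply/funext => x; rewrite -deriveN.
exact: IH (c4 l).
Qed.

(** Induction through [(1/f)' = - (1/f) (1/f) f']. The exponent is chosen before [X] and [f]: one
    number [X] bounds [f], its derivatives and [1/f], and [2 <= X] lets powers of [X] absorb the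
    Leibniz factors. Later estimates follow this pattern. *)
Lemma CbV m : exists p, forall (X : R) f, 2 <= X -> (forall x, X^-1 <= `|f x|) ->
  Cb m X f -> Cb m (X ^+ p) (fun x => (f x)^-1).
Proof.
elim: m => [|m [p IH]].
  exists 1 => X f X2 fX [c1 c2 c3 _].
  have f0 x : f x != 0.
    by rewrite -normr_gt0; apply: lt_le_trans (fX x); rewrite invr_gt0; lra.
  split => [x|x|l x|//]; first exact: (cvgV (f0 x) (c1 x)).
    rewrite normfV expr1 invf_ple ?posrE //; first by rewrite normr_gt0.
    lra.
  exact: derivableV.
exists (2 * m + 2 * p + 2)%N => X f X2 fX Hf; have [c1 c2 c3 c4] := Hf.
have f0 x : f x != 0.
  by rewrite -normr_gt0; apply: lt_le_trans (fX x); rewrite invr_gt0; lra.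
have X1 : 1 <= X by lra.
have X0 : 0 <= X by lra.
split => [x|x|l x|l]; first exact: (cvgV (f0 x) (c1 x)).
- rewrite normfV; apply: (@le_trans _ _ X).
    rewrite invf_ple ?posrE //; first by rewrite normr_gt0.
    lra.
  by rewrite -[X in X <= _]expr1; apply: ler_weXn2l; rewrite // addn2.
- exact: derivableV.
have -> : (fun x => 'D_(ev R l) (fun x => (f x)^-1) x) =
   (fun x => - (((f x)^-1 * (f x)^-1) * 'D_(ev R l) f x)).
  by apply/funext => x; rewrite (deriveV (f0 x) (c3 l x)) scaleNr -exprVn expr2.
apply: CbN; have Hi := IH X f X2 fX (CbW (leqnSn m) Hf).
apply: Cb_le (CbM (CbM Hi Hi) (c4 l)).
set P := X ^+ p; set Q := X ^+ (2 * m).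
have -> : X ^+ (2 * m + 2 * p + 2) = Q * (P * P) * X ^+ 2.
  by rewrite -!exprD; congr (_ ^+ _); lia.
have P0 : 0 <= P by apply: exprn_ge0.
have T0 : (0:R) <= 2 ^+ m by apply: exprn_ge0.
have TX : (2 ^+ m * 2 ^+ m : R) <= Q.
  rewrite -exprD addnn -mul2n; apply: lerXn2r => //; rewrite nnegrE; lra.
have -> : 2 ^+ m * (2 ^+ m * (P * P) * X) = (2 ^+ m * 2 ^+ m) * (P * P) * X by ring.
rewrite expr2; apply: ler_pM => //; rewrite ?mulr_ge0 //; last by rewrite ler_peMl.
by apply: ler_pM => //; exact: mulr_ge0.
Qed.

(* Interpolation: a Taylor step of length [h] trades smallness of [g] for its second derivatives. *)
Lemma Cb_interp m a eta g : 0 < eta -> 1 <= a -> Cb m.+1 a g ->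
  (forall x, `|g x| <= eta ^+ (2 ^ m)) -> Cb m ((3 * a) ^+ m.+1 * eta) g.
Proof.
elim: m eta g => [|m IH] eta g e0 a1 Hg Hs; have [c1 c2 c3 c4] := Hg.
  rewrite expr1; have a3 : 1 <= 3 * a by lra.
  split => // x; apply: (le_trans (Hs x)); rewrite expn0 expr1.
  by rewrite ler_peMl // ltW.
have a3 : 1 <= 3 * a by lra.
(* For [eta >= 1] the target exceeds [a] and nothing is to be gained; otherwise powers of [eta]
   decrease. *)
have [e1|e1] := lerP 1 eta.
  apply: (@Cb_le _ a); last exact: CbW (leqnSn _) Hg.
  rewrite -[X in X <= _]mulr1; apply: ler_pM => //; first lra.
  apply: (@le_trans _ _ (3 * a)); first lra.
  exact: ler_eXnr.
have ae : 0 < 3 * a * eta by apply: mulr_gt0 => //; lra.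
split => // [x|l].
  apply: (le_trans (Hs x)); apply: (@le_trans _ _ (1 * eta)).
    rewrite mul1r -[X in _ <= X]expr1; apply: ler_wiXn2l; rewrite ?expn_gt0 //; exact: ltW.
  apply: ler_wpM2r; first exact: ltW.
  exact: exprn_ege1.
have -> : (3 * a) ^+ m.+2 * eta = (3 * a) ^+ m.+1 * (3 * a * eta) by rewrite exprSr; ring.
have c4' l' : Cb m.+1 a (fun x => 'D_(ev R l') g x) by exact: (Cb_partial l' Hg).
apply: (IH (3 * a * eta) _ ae a1 (c4' l)).
(* With this step [h * h] is the assumed bound on [g]: the difference quotient is at most [2 h], the
   second derivative adds [h a], and both are of order [h]. Each derivative thus costs a square
   root, which explains the exponent [2 ^ m] in the hypothesis. *)
move=> x; pose h := eta ^+ (2 ^ m).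
have h0 : 0 < h by exact: exprn_gt0.
have hh : h * h = eta ^+ (2 ^ m.+1) by rewrite -exprD addnn -mul2n expnS.
apply: (@le_trans _ _ (3 * a * h)); last first.
  rewrite [X in _ <= X]exprMn; apply: ler_wpM2r; first exact: ltW.
  by apply: ler_eXnr => //; rewrite expn_gt0.
have [t th E] := MVT_line (c3 l) x h.
have D2 y : derivable (fun x => 'D_(ev R l) g x) y (ev R l) by exact: (Cb_derivable (c4' l)).
have [u ut E2] := MVT_line D2 x t.
have B1 : `|g (h *: ev R l + x) - g x| <= 2 * (h * h).
  apply: (le_trans (ler_normB _ _)); have := Hs x; have := Hs (h *: ev R l + x).
  rewrite -hh; lra.
move: B1; rewrite E normrM (gtr0_norm h0) => B1.
have {}B1 : `|'D_(ev R l) g (t *: ev R l + x)| <= 2 * h.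
  by rewrite -(ler_pM2l h0); apply: (le_trans B1); rewrite mulrCA.
have -> : 'D_(ev R l) g x = 'D_(ev R l) g (t *: ev R l + x) -
   ('D_(ev R l) g (t *: ev R l + x) - 'D_(ev R l) g x) by ring.
apply: (le_trans (ler_normB _ _)).
apply: (@le_trans _ _ (2 * h + h * a)).
  apply: lerD => //; rewrite E2 normrM; apply: ler_pM => //.
    by rewrite (gtr0_norm h0) in th.
  exact: (Cb_bound (Cb_partial l (c4' l))).
have : h <= h * a by rewrite ler_peMr // ltW.
by rewrite -mulrA (mulrC a); lra.
Qed.

End RealFunctions.

Section RealFunctions2.
Variables (R : realType) (d : nat).
Implicit Types (g f : 'rV[R]_d -> R) (x e v : 'rV[R]_d).

Lemma CbZ m a c f : Cb m a f -> Cb m (`|c| * a) (fun x => c * f x).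
Proof.
elim: m f => [|m IH] f [c1 c2 c3 c4].
all: split => [x|x|l x|]; try exact: (cvgM (@cvg_cst _ _ _ _ _) (c1 x)).
all: try by rewrite normrM; apply: ler_wpM2l.
all: try exact: derivableM.
all: try done.
move=> l; have -> : (fun x => 'D_(ev R l) (fun x => c * f x) x) =
   (fun x => c * 'D_(ev R l) f x).
  by apply/funext => x; rewrite -[LHS]/('D_(ev R l) (c \*: f) x) deriveZ.
exact: IH (c4 l).
Qed.

Lemma scale_shift (c h : R) v x : c *: (h *: v + x) = h *: (c *: v) + c *: x.
Proof. by rewrite scalerDr !scalerA mulrC. Qed.

Lemma derive_scale g x v (c : R) : 'D_v (fun y => g (c *: y)) x = 'D_(c *: v) g (c *: x).
Proof.
rewrite /derive; set F := (fun h => h^-1 *: _); set G := (fun h => h^-1 *: _).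
suff -> : F = G by [].
by apply/funext => h; rewrite /F /G /= (scale_shift c h v x).
Qed.

Lemma derivable_scale g x v (c : R) : derivable g (c *: x) (c *: v) ->
  derivable (fun y => g (c *: y)) x v.
Proof.
rewrite /derivable; set F := (fun h => h^-1 *: _); set G := (fun h => h^-1 *: _).
suff -> : F = G by [].
by apply/funext => h; rewrite /F /G /= (scale_shift c h v x).
Qed.

(** The restriction of [g] to a line is a function of one variable, whose differential is linear;
    this covers [c = 0] and needs nothing about [g] off the line. *)
Lemma derive_scaledir g x v (c : R) : derivable g x v ->
  derivable g x (c *: v) /\ 'D_(c *: v) g x = c * 'D_v g x.
Proof.
move=> dg; have /derivable1_diffP dphi := (derivable1P g x v).1 dg.
have D1 : derivable (fun h : R => g (h *: v + x)) 0 c by exact: diff_derivable.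
have E : (fun h : R => h^-1 *: (g (h *: (c *: v) + x) - g x)) =
   (fun h : R => h^-1 *: (g ((h *: c + 0) *: v + x) - g (0 *: v + x))).
  by apply/funext => h; rewrite addr0 scale0r add0r scalerA.
split; first by rewrite /derivable E.
have -> : 'D_(c *: v) g x = 'D_c (fun h : R => g (h *: v + x)) 0 by rewrite /derive E.
rewrite deriveE // diff1E // -[LHS]/(c * _); congr (_ * _).
have E1 : 'D_v g x = 'D_(1:R) (fun h : R => g (h *: v + x)) 0.
  rewrite /derive; set F := (fun h => h^-1 *: _); set G := (fun h => h^-1 *: _).
  suff -> : F = G by [].
  by apply/funext => h; rewrite /F /G /= addr0 scale0r add0r [h *: 1]mulr1.
by rewrite E1 derive1E.
Qed.

Lemma Cb_scale2 m a g : Cb m a g -> Cb m (2 ^+ m * a) (fun y : 'rV[R]_d => g (2 *: y)).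
Proof.
elim: m g => [|m IH] g Hg; have [c1 c2 c3 c4] := Hg; have a0 := Cb_ge0 Hg.
all: have cs : continuous (fun y : 'rV[R]_d => g (2 *: y)) by
  (move=> x; have := @scaler_continuous R 'rV[R]_d 2 x => sc; exact: (continuous_comp sc (c1 (2 *: x)))).
all: have ds l x : derivable (fun y : 'rV[R]_d => g (2 *: y)) x (ev R l) by
  (apply: derivable_scale; exact: (derive_scaledir _ (c3 l _)).1).
  by split => // x; rewrite mul1r.
split => // [x|l].
  by apply: (le_trans (c2 _)); rewrite ler_peMl //; apply: exprn_ege1; lra.
have -> : (fun x : 'rV[R]_d => 'D_(ev R l) (fun y : 'rV[R]_d => g (2 *: y)) x) =
    (fun x => 2 * 'D_(ev R l) g (2 *: x)).
  by apply/funext => x; rewrite derive_scale (derive_scaledir _ (c3 l _)).2.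
have := CbZ 2 (IH _ (c4 l)); rewrite ger0_norm; last by lra.
by rewrite exprS -mulrA.
Qed.

Lemma derive_lin (F F' : R -> R) (l : 'rV[R]_d -> R) x v :
  (forall y : R, is_derive y (1 : R) F (F' y)) -> (forall t x v, l (t *: v + x) = t * l v + l x) ->
  derivable (fun x => F (l x)) x v /\ 'D_v (fun x => F (l x)) x = l v * F' (l x).
Proof.
move=> dF lE.
have dF' : differentiable F (l x) by apply/derivable1_diffP; exact: (@ex_derive _ _ _ _ _ _ _ (dF _)).
have E : (fun h : R => h^-1 *: (F (l (h *: v + x)) - F (l x))) =
         (fun h : R => h^-1 *: (F (h *: l v + l x) - F (l x))).
  by apply/funext => h; rewrite lE.
have D1 : derivable F (l x) (l v) by exact: diff_derivable.
split; first by rewrite /derivable E.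
rewrite [LHS](_ : _ = 'D_(l v) F (l x)); last by rewrite /derive E.
by rewrite deriveE // diff1E // derive1E [X in _ *: X](@derive_val _ _ _ _ _ _ _ (dF _)).
Qed.

Definition phase (k : 'rV[R]_d) (x : 'rV[R]_d) : R := 2 * pi * \sum_l k 0 l * x 0 l.

Lemma phase_lin k t x v : phase k (t *: v + x) = t * phase k v + phase k x.
Proof.
rewrite /phase mulrCA -mulrDr; congr (_ * _).
rewrite mulr_sumr -big_split /=; apply: eq_bigr => l _; rewrite !mxE; ring.
Qed.

Lemma phase_ev k l : phase k (ev R l) = 2 * pi * k 0 l.
Proof.
rewrite /phase (bigD1 l) //= big1 ?addr0 => [|j jl]; last first.
  by rewrite !mxE /= (negbTE jl) mulr0.
by rewrite !mxE !eqxx mulr1.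
Qed.

Lemma derive_cosphase (k : 'rV[R]_d) x v : derivable (fun x => cos (phase k x)) x v /\
  'D_v (fun x => cos (phase k x)) x = phase k v * - sin (phase k x).
Proof.
apply: (derive_lin (F' := fun y => - sin y)) => t y u; exact: phase_lin.
Qed.

Lemma derive_sinphase (k : 'rV[R]_d) x v : derivable (fun x => sin (phase k x)) x v /\
  'D_v (fun x => sin (phase k x)) x = phase k v * cos (phase k x).
Proof.
apply: (derive_lin (F' := fun y => cos y)) => t y u; exact: phase_lin.
Qed.

Lemma phase_continuous k : continuous (phase k).
Proof.
have H (r : seq 'I_d) : continuous (fun x : 'rV[R]_d => \sum_(l <- r) k 0 l * x 0 l).
  elim: r => [|l r IH].
    under [X in continuous X]funext => x do rewrite big_nil.
    exact: cst_continuous.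
  under [X in continuous X]funext => x do rewrite big_cons.
  move=> x; have c1 := @coord_continuous R 1 d 0 l x.
  exact: (cvgD (cvgM (cvg_cst (k 0 l)) c1) (IH x)).
move=> x; exact: (cvgM (cvg_cst (2 * pi)) (H _ x)).
Qed.

Lemma Cb_phase m (k : 'rV[R]_d) (X : R) : 1 <= X -> (forall l, `|2 * pi * k 0 l| <= X) ->
  Cb m (X ^+ m) (fun x => cos (phase k x)) /\ Cb m (X ^+ m) (fun x => sin (phase k x)).
Proof.
move=> X1 Xk.
have cc : continuous (fun x => cos (phase k x)).
  by move=> x; exact: (continuous_comp (phase_continuous (k:=k) (x:=x)) (@continuous_cos _ _)).
have cs : continuous (fun x => sin (phase k x)).
  by move=> x; exact: (continuous_comp (phase_continuous (k:=k) (x:=x)) (@continuous_sin _ _)).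
elim: m => [|m [IH1 IH2]].
  rewrite expr0; split; split => // [x|l x].
  - exact: cos_max.
  - exact: (derive_cosphase _ _ _).1.
  - exact: sin_max.
  - exact: (derive_sinphase _ _ _).1.
have X1m : 1 <= X ^+ m.+1 by exact: exprn_ege1.
have Xm0 : 0 <= X ^+ m by apply: exprn_ge0; lra.
split; split => // [x|l x|l].
- exact: le_trans (cos_max _) _.
- exact: (derive_cosphase _ _ _).1.
- have -> : (fun x => 'D_(ev R l) (fun x => cos (phase k x)) x) =
    (fun x => (- (2 * pi * k 0 l)) * sin (phase k x)).
    by apply/funext => x; rewrite (derive_cosphase _ _ _).2 phase_ev mulrN mulNr.
  by apply: Cb_le (CbZ _ IH2); rewrite normrN exprS; apply: ler_wpM2r.
- exact: le_trans (sin_max _) _.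
- exact: (derive_sinphase _ _ _).1.
have -> : (fun x => 'D_(ev R l) (fun x => sin (phase k x)) x) =
    (fun x => (2 * pi * k 0 l) * cos (phase k x)).
    by apply/funext => x; rewrite (derive_sinphase _ _ _).2 phase_ev.
by apply: Cb_le (CbZ _ IH1); rewrite exprS; apply: ler_wpM2r.
Qed.

Lemma Zperiodic_partial (s : seq 'I_d) g : Zperiodic g -> Zperiodic (iter_partial s g).
Proof.
elim: s => //= l s IH /IH per x k.
rewrite /derive; set F := (fun h => h^-1 *: _); set G := (fun h => h^-1 *: _).
suff -> : F = G by [].
by apply/funext => h; rewrite /F /G /= addrA !per.
Qed.

Lemma Zperiodic_int T (g : 'rV[R]_d -> T) : Zperiodic g ->
  forall (k : 'I_d -> int) x, g (x + \row_l (k l)%:~R) = g x.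
Proof.
move=> per k x.
have perZ (c : int) l y : g (y + c%:~R *: ev R l) = g y.
  have perN (p : nat) z : g (z + p%:R *: ev R l) = g z.
    elim: p z => [|p IH] z; first by rewrite scale0r addr0.
    by rewrite -natr1 scalerDl addrA scale1r per IH.
  case: c => p; first exact: perN.
  by rewrite -[LHS](perN p.+1) NegzE mulrNz scaleNr addrNK.
have -> : \row_l (k l)%:~R = \sum_(l <- enum 'I_d) (k l)%:~R *: ev R l.
  rewrite big_enum /= [LHS]row_sum_delta; apply: eq_bigr => l _; by rewrite mxE.
elim: (enum 'I_d) x => [|l s IH] x; first by rewrite big_nil addr0.
by rewrite big_cons addrA IH perZ.
Qed.

Definition fracv x : 'rV[R]_d := x + \row_l (- Num.floor (x 0 l))%:~R.

Lemma fracv_bound x l : 0 <= fracv x 0 l <= 1.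
Proof.
rewrite !mxE mulrNz subr_ge0 floor_le_tmp /=.
by have := floorD1_gt (x 0 l); rewrite intrD => H; lra.
Qed.

(** [fracv] moves every point into the compact unit cube without changing the value of [g]. *)
Lemma Zperiodic_bounded g : continuous g -> Zperiodic g -> exists a : R, forall x, `|g x| <= a.
Proof.
move=> cg per.
pose A : set 'rV[R]_d := [set v | forall l, (fun=> `[0, 1]%classic) l (v ord0 l)].
have cA : compact A by apply: rV_compact => l; exact: segment_compact.
have A0 : A !=set0 by exists 0 => l /=; rewrite !mxE in_itv /= lexx ler01.
have cng : continuous (fun x => `|g x|).
  by move=> x; exact: (continuous_comp (cg x) (@norm_continuous R R (g x))).
have [c _ H] := EVT_max_rV A0 cA (continuous_subspaceT cng).
exists `|g c| => x.
rewrite -(Zperiodic_int per (fun l => - Num.floor (x 0 l))); apply: H.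
by rewrite inE /A /= => l; rewrite in_itv /=; exact: fracv_bound.
Qed.

Lemma smooth_Cb g : smooth_fun g -> Zperiodic g -> forall m, exists a, Cb m a g.
Proof.
move=> sm per m.
have B (s : seq 'I_d) : exists a : R, forall x, `|iter_partial s g x| <= a.
  apply: Zperiodic_bounded; [exact: (sm s).1 | exact: Zperiodic_partial].
elim: m g sm per B => [|m IH] g sm per B; have [a Ha] := B [::].
  exists a; split => //; [exact: (sm [::]).1 | exact: (sm [::]).2].
have rc (s : seq 'I_d) l : iter_partial s (fun x => 'D_(ev R l) g x) = iter_partial (rcons s l) g.
  by elim: s => //= l' s ->.
have P l : exists b, Cb m b (fun x => 'D_(ev R l) g x).
  apply: IH => [s| |s].
  - rewrite rc; exact: sm.
  - exact: (Zperiodic_partial [:: l]).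
  - rewrite rc; exact: B.
pose b l := projT1 (cid (P l)).
have Hb l : Cb m (b l) (fun x => 'D_(ev R l) g x) by exact: (projT2 (cid (P l))).
exists (`|a| + \sum_l `|b l|); split.
- exact: (sm [::]).1.
- by move=> x; apply: (le_trans (Ha x)); rewrite (le_trans (ler_norm a)) // lerDl sumr_ge0.
- exact: (sm [::]).2.
move=> l; apply: Cb_le (Hb l); apply: (le_trans (ler_norm _)).
by rewrite (bigD1 l) //= addrCA lerDl addr_ge0 // sumr_ge0.
Qed.

End RealFunctions2.

(** * Complex-valued functions *)

Section Modulus.
Variable R : realType.
Implicit Types z w : R[i].
Local Notation nc := (@normc R).

Lemma ncE z : nc z = Num.sqrt (Re z ^+ 2 + Im z ^+ 2). Proof. by case: z. Qed.
Lemma nc_ge0 z : 0 <= nc z. Proof. by rewrite ncE sqrtr_ge0. Qed.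
Lemma nc0 : nc 0 = 0. Proof. exact: normc0. Qed.
Lemma nc1 : nc 1 = 1. Proof. exact: normc1. Qed.
Lemma ncM z w : nc (z * w) = nc z * nc w. Proof. exact: normcM. Qed.
Lemma ncD z w : nc (z + w) <= nc z + nc w. Proof. exact: (@le_normcD R z w). Qed.
Lemma ncN z : nc (- z) = nc z. Proof. exact: (@normcN R z). Qed.
Lemma ncB z w : nc (z - w) <= nc z + nc w. Proof. by rewrite -(ncN w); exact: ncD. Qed.
Lemma ncBC z w : nc (z - w) = nc (w - z). Proof. by rewrite -ncN opprB. Qed.
Lemma ncV z : nc z^-1 = (nc z)^-1. Proof. exact: normcV. Qed.
Lemma nc_eq0 z : (nc z == 0) = (z == 0).
Proof. by apply/eqP/eqP => [/eq0_normc //|->]; rewrite nc0. Qed.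
Lemma nc_gt0 z : (0 < nc z) = (z != 0).
Proof. by rewrite lt_def nc_ge0 andbT nc_eq0. Qed.
Lemma nc_conj z : nc (conjc z) = nc z.
Proof. by case: z => a b; rewrite /= sqrrN. Qed.
Lemma nc_Re z : `|Re z| <= nc z.
Proof. by rewrite ncE -sqrtr_sqr ler_wsqrtr // lerDl sqr_ge0. Qed.
Lemma nc_Im z : `|Im z| <= nc z.
Proof. by rewrite ncE -[X in X <= _]sqrtr_sqr ler_wsqrtr // lerDr sqr_ge0. Qed.
Lemma nc_le z : nc z <= `|Re z| + `|Im z|.
Proof.
have H : 0 <= `|Re z| + `|Im z| by rewrite addr_ge0.
rewrite ncE -[X in _ <= X](ger0_norm H) -sqrtr_sqr ler_wsqrtr //.
rewrite sqrrD -!normrX !(ger0_norm (sqr_ge0 _)) -addrA [X in _ <= _ + X]addrC addrA lerDl.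
by rewrite mulrn_wge0 // mulr_ge0.
Qed.
Lemma nc_real (a : R) : nc (Complex a 0) = `|a|.
Proof. by rewrite /= expr0n addr0 sqrtr_sqr. Qed.
Lemma nc_sum I (r : seq I) (P : pred I) (F : I -> R[i]) :
  nc (\sum_(i <- r | P i) F i) <= \sum_(i <- r | P i) nc (F i).
Proof.
elim/big_ind2 : _ => //; first by rewrite nc0.
move=> x a y b xa yb; exact: le_trans (ncD _ _) (lerD xa yb).
Qed.
Lemma nc_sum_le (I : finType) (P : pred I) (F : I -> R[i]) (a : R) : 0 <= a ->
  (forall i, P i -> nc (F i) <= a) -> nc (\sum_(i | P i) F i) <= #|I|%:R * a.
Proof.
move=> a0 H; apply: (le_trans (nc_sum _ _ _)).
apply: (@le_trans _ _ (\sum_(i : I) a)).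
  rewrite big_mkcond; apply: ler_sum => i _; case: ifP => // Pi; exact: H.
by rewrite sumr_const mulr_natl.
Qed.
Lemma nc_nat (k : nat) : nc k%:R = k%:R.
Proof.
have -> : (k%:R : R[i]) = Complex k%:R 0 by rewrite -(rmorph_nat (real_complex R)).
by rewrite nc_real ger0_norm.
Qed.
Lemma ncX z k : nc (z ^+ k) = nc z ^+ k.
Proof. by elim: k => [|k IH]; rewrite ?expr0 ?nc1 // !exprS ncM IH. Qed.
End Modulus.

(** * Absorbing numerical constants into powers of [X >= 2] *)

Section PowerBounds.
Variable R : realType.
Implicit Type X : R.
Lemma ge1_2 X : 2 <= X -> 1 <= X. Proof. by move=> h; lra. Qed.
Lemma leXX X a b : 1 <= X -> (a <= b)%N -> X ^+ a <= X ^+ b.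
Proof. by move=> X1; exact: ler_weXn2l. Qed.
Lemma le2X X k : 2 <= X -> 2 ^+ k <= X ^+ k.
Proof. by move=> X2; apply: lerXn2r => //; rewrite nnegrE; lra. Qed.
Lemma lenX X k : 2 <= X -> k%:R <= X ^+ k.
Proof.
move=> X2; apply: le_trans (le2X k X2); rewrite -natrX ler_nat; exact/ltnW/ltn_expl.
Qed.
Lemma X_ge0 X k : 2 <= X -> 0 <= X ^+ k.
Proof. by move=> X2; apply: exprn_ge0; lra. Qed.
Lemma X_ge1 X k : 2 <= X -> 1 <= X ^+ k.
Proof. by move=> X2; apply: exprn_ege1; lra. Qed.
End PowerBounds.

Section ComplexFunctions.
Variables (R : realType) (d : nat).
Local Notation C := R[i].
Implicit Types (f g : 'rV[R]_d -> C) (x v : 'rV[R]_d).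
Local Notation nc := (@normc R).

Definition Cc m a f := Cb m a (fun x => Re (f x)) /\ Cb m a (fun x => Im (f x)).

Lemma Cc_le m a b f : a <= b -> Cc m a f -> Cc m b f.
Proof. by move=> ab [h1 h2]; split; apply: Cb_le ab _. Qed.
Lemma CcW m m' a f : (m' <= m)%N -> Cc m a f -> Cc m' a f.
Proof. by move=> ab [h1 h2]; split; apply: CbW ab _. Qed.
Lemma Cc_ge0 m a f : Cc m a f -> 0 <= a.
Proof. by case => /Cb_ge0. Qed.
Lemma Cc_bound m a f : Cc m a f -> forall x, nc (f x) <= 2 * a.
Proof.
move=> [h1 h2] x; apply: (le_trans (nc_le _)).
by have := Cb_bound h1 x; have := Cb_bound h2 x; lra.
Qed.
Lemma CcD m a b f g : Cc m a f -> Cc m b g -> Cc m (a + b) (fun x => f x + g x).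
Proof.
move=> [f1 f2] [g1 g2]; split.
  by have := CbD f1 g1; congr Cb; apply/funext => x; case: (f x); case: (g x).
by have := CbD f2 g2; congr Cb; apply/funext => x; case: (f x); case: (g x).
Qed.
Lemma CcN m a f : Cc m a f -> Cc m a (fun x => - f x).
Proof.
move=> [f1 f2]; split.
  by have := CbN f1; congr Cb; apply/funext => x; case: (f x).
by have := CbN f2; congr Cb; apply/funext => x; case: (f x).
Qed.
Lemma Cc_conj m a f : Cc m a f -> Cc m a (fun x => conjc (f x)).
Proof.
move=> [f1 f2]; split.
  by have := f1; congr Cb; apply/funext => x; case: (f x).
by have := CbN f2; congr Cb; apply/funext => x; case: (f x).
Qed.
Lemma CcM m a b f g : Cc m a f -> Cc m b g -> Cc m (2 ^+ m.+1 * (a * b)) (fun x => f x * g x).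
Proof.
move=> [f1 f2] [g1 g2]; have E : 2 ^+ m.+1 * (a * b) = 2 ^+ m * (a * b) + 2 ^+ m * (a * b).
  by rewrite exprS; ring.
rewrite E; split.
  have := CbD (CbM f1 g1) (CbN (CbM f2 g2)); congr Cb; apply/funext => x.
  by case: (f x) => ? ?; case: (g x).
have := CbD (CbM f1 g2) (CbM f2 g1); congr Cb; apply/funext => x.
by case: (f x) => ? ?; case: (g x).
Qed.
Lemma Cc_cst m (c : C) : Cc m (nc c) (fun=> c).
Proof.
split.
  by apply: Cb_le (Cb_cst _ _ _); exact: nc_Re.
by apply: Cb_le (Cb_cst _ _ _); exact: nc_Im.
Qed.
Lemma Cc_sum m a I (r : seq I) (F : I -> 'rV[R]_d -> C) : (forall i, Cc m a (F i)) ->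
  Cc m ((size r)%:R * a) (fun x => \sum_(i <- r) F i x).
Proof.
move=> H; elim: r => [|i r IH].
  under [X in Cc _ _ X]funext => x do rewrite big_nil.
  by rewrite mul0r -nc0; exact: Cc_cst.
under [X in Cc _ _ X]funext => x do rewrite big_cons.
by rewrite /= -add1n natrD mulrDl mul1r; exact: CcD.
Qed.
Lemma Cc_prod m a I (r : seq I) (F : I -> 'rV[R]_d -> C) : (forall i, Cc m a (F i)) ->
  Cc m ((2 ^+ m.+1 * a) ^+ size r) (fun x => \prod_(i <- r) F i x).
Proof.
move=> H; elim: r => [|i r IH].
  under [X in Cc _ _ X]funext => x do rewrite big_nil.
  by rewrite expr0 -(nc1 R); exact: Cc_cst.
under [X in Cc _ _ X]funext => x do rewrite big_cons.
by rewrite /= exprS -mulrA; exact: CcM.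
Qed.

(** Writing [1/f] as [conj(f) / N] with [N = |f|^2] reduces to the real case, applied with
    [X ^+ (m + 3 + 2)] in place of [X]: this power bounds both [N] with its derivatives and
    [1/N]. *)
Lemma CcV m : exists p, forall (X : R) f, 2 <= X -> (forall x, X^-1 <= nc (f x)) ->
  Cc m X f -> Cc m (X ^+ p) (fun x => (f x)^-1).
Proof.
have [p Hp] := CbV R d m.
exists ((m + 3 + 2) * p + m + 2)%N => X f X2 fX Hf.
pose N x := Re (f x) * Re (f x) + Im (f x) * Im (f x).
have X0 : 0 < X by lra.
have HN : Cb m (X ^+ (m + 3 + 2)) N.
  apply: Cb_le (CbD (CbM Hf.1 Hf.1) (CbM Hf.2 Hf.2)).
  have -> : 2 ^+ m * (X * X) + 2 ^+ m * (X * X) = 2 ^+ m.+1 * X ^+ 2 by rewrite exprS; ring.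
  rewrite exprD; apply: ler_pM; rewrite ?exprn_ge0 //; first lra.
  by apply: le_trans (le2X _ X2) _; apply: leXX; [lra | lia].
have Nnc x : N x = nc (f x) ^+ 2.
  by rewrite ncE sqr_sqrtr /N ?expr2 // addr_ge0 ?sqr_ge0.
have NX x : (X ^+ (m + 3 + 2))^-1 <= `|N x|.
  rewrite Nnc ger0_norm ?sqr_ge0 //; apply: (@le_trans _ _ (X^-1 ^+ 2)).
    rewrite exprVn lef_pV2 ?posrE ?exprn_gt0 //; apply: leXX; [lra | lia].
  by apply: lerXn2r => //; rewrite nnegrE ?nc_ge0 // invr_ge0 ltW.
have X2' : 2 <= X ^+ (m + 3 + 2).
  by apply: (le_trans X2); rewrite -[X in X <= _]expr1; apply: leXX; [lra|lia].
have HV := Hp _ _ X2' NX HN.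
have N0 x : N x != 0 by rewrite -normr_gt0; apply: lt_le_trans (NX x); rewrite invr_gt0 exprn_gt0.
have F : 2 ^+ m * (X * (X ^+ (m + 3 + 2)) ^+ p) <= X ^+ ((m + 3 + 2) * p + m + 2).
  rewrite -exprM -exprS; set q := ((m + 3 + 2) * p)%N.
  have -> : (q + m + 2 = m + q.+2)%N by lia.
  rewrite exprD; apply: ler_pM; rewrite ?exprn_ge0 //; [lra|exact: le2X|].
  apply: leXX; [lra | lia].
split; apply: (Cb_le F).
  have := CbM Hf.1 HV; congr Cb; apply/funext => x; rewrite /N; case: (f x) => a b /=.
  by rewrite -!expr2.
have := CbN (CbM Hf.2 HV); congr Cb; apply/funext => x; rewrite /N; case: (f x) => a b /=.
by rewrite -!expr2.
Qed.

Definition Cdir v f x : C := Complex ('D_v (fun y => Re (f y)) x) ('D_v (fun y => Im (f y)) x).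

Definition Cder v f x := derivable (fun y => Re (f y)) x v /\ derivable (fun y => Im (f y)) x v.

Lemma Cc_der m a f x v : Cc m.+1 a f -> Cder v f x.
Proof. by move=> [h1 h2]; split; [exact: (Cb_dir h1 x v).1 | exact: (Cb_dir h2 x v).1]. Qed.

Lemma Re_sum I (r : seq I) (F : I -> C) : Re (\sum_(i <- r) F i) = \sum_(i <- r) Re (F i).
Proof.
elim: r => [|i r IH]; rewrite ?big_nil // !big_cons -IH.
by case: (F i) (\sum_(i <- r) F i) => a b [].
Qed.
Lemma Im_sum I (r : seq I) (F : I -> C) : Im (\sum_(i <- r) F i) = \sum_(i <- r) Im (F i).
Proof.
elim: r => [|i r IH]; rewrite ?big_nil // !big_cons -IH.
by case: (F i) (\sum_(i <- r) F i) => a b [].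
Qed.

Lemma Cdir_sum_coord m a f x v : Cc m.+1 a f ->
  Cdir v f x = \sum_l Complex (v 0 l) 0 * Cdir (ev R l) f x.
Proof.
move=> [h1 h2]; apply/eqP; rewrite eq_complex Re_sum Im_sum /= (Cb_dir h1 x v).2 (Cb_dir h2 x v).2.
by apply/andP; split; apply/eqP; apply: eq_bigr => l _; rewrite /= ?mul0r ?subr0 ?addr0.
Qed.

Lemma Cdir_cst v c x : Cdir v (fun=> c) x = 0.
Proof. by rewrite /Cdir !derive_cst. Qed.

Lemma Cder_cst v c x : Cder v (fun=> c) x.
Proof. by split; exact: derivable_cst. Qed.

Lemma CdirD v f g x : Cder v f x -> Cder v g x ->
  Cder v (fun y => f y + g y) x /\ Cdir v (fun y => f y + g y) x = Cdir v f x + Cdir v g x.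
Proof.
move=> [f1 f2] [g1 g2]; rewrite /Cder /Cdir.
have -> : (fun y => Re (f y + g y)) = (fun y => Re (f y)) + (fun y => Re (g y)).
  by apply/funext => y /=; rewrite fctE; case: (f y); case: (g y).
have -> : (fun y => Im (f y + g y)) = (fun y => Im (f y)) + (fun y => Im (g y)).
  by apply/funext => y /=; rewrite fctE; case: (f y); case: (g y).
by split; [split; [exact: (derivableD f1 g1)|exact: (derivableD f2 g2)] | rewrite (deriveD f1 g1) (deriveD f2 g2)].
Qed.

Lemma CdirM v f g x : Cder v f x -> Cder v g x ->
  Cder v (fun y => f y * g y) x /\
  Cdir v (fun y => f y * g y) x = Cdir v f x * g x + f x * Cdir v g x.
Proof.
move=> [f1 f2] [g1 g2]; rewrite /Cder /Cdir.
have -> : (fun y => Re (f y * g y)) =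
   (fun y => Re (f y)) * (fun y => Re (g y)) - (fun y => Im (f y)) * (fun y => Im (g y)).
  by apply/funext => y /=; rewrite !fctE; case: (f y); case: (g y).
have -> : (fun y => Im (f y * g y)) =
   (fun y => Re (f y)) * (fun y => Im (g y)) + (fun y => Im (f y)) * (fun y => Re (g y)).
  by apply/funext => y /=; rewrite !fctE; case: (f y); case: (g y).
have D1 := derivableM f1 g1; have D2 := derivableM f2 g2.
have D3 := derivableM f1 g2; have D4 := derivableM f2 g1.
split; first by split; [exact: (derivableB D1 D2) | exact: (derivableD D3 D4)].
rewrite (deriveB D1 D2) (deriveD D3 D4) (deriveM f1 g1) (deriveM f2 g2) (deriveM f1 g2) (deriveM f2 g1).
move: ('D_v (fun y => Re (f y)) x) ('D_v (fun y => Im (f y)) x) => p1 p2.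
move: ('D_v (fun y => Re (g y)) x) ('D_v (fun y => Im (g y)) x) => q1 q2.
case: (f x) (g x) => a b [c e]; apply/eqP; rewrite eq_complex /=.
by apply/andP; split; apply/eqP; rewrite /GRing.scale /=; ring.
Qed.

Lemma Cdir_conj v f x : Cder v f x ->
  Cder v (fun y => conjc (f y)) x /\ Cdir v (fun y => conjc (f y)) x = conjc (Cdir v f x).
Proof.
move=> [f1 f2]; rewrite /Cder /Cdir.
have -> : (fun y => Re (conjc (f y))) = (fun y => Re (f y)).
  by apply/funext => y /=; case: (f y).
have -> : (fun y => Im (conjc (f y))) = - (fun y => Im (f y)).
  by apply/funext => y /=; rewrite fctE; case: (f y).
split; first by split; [exact: f1 | exact: (derivableN f2)].
by rewrite (deriveN f2).
Qed.

Lemma Cdir_sum v I (r : seq I) (F : I -> 'rV[R]_d -> C) x : (forall i, Cder v (F i) x) ->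
  Cder v (fun y => \sum_(i <- r) F i y) x /\
  Cdir v (fun y => \sum_(i <- r) F i y) x = \sum_(i <- r) Cdir v (F i) x.
Proof.
move=> H; elim: r => [|i r [IH1 IH2]].
  under [X in Cder _ X]funext => y do rewrite big_nil.
  under [X in Cdir _ X]funext => y do rewrite big_nil.
  by rewrite big_nil; split; [exact: Cder_cst | exact: Cdir_cst].
under [X in Cder _ X]funext => y do rewrite big_cons.
under [X in Cdir _ X]funext => y do rewrite big_cons.
by rewrite big_cons -IH2; exact: CdirD.
Qed.

Lemma Cdir_scale2 v f x :
  Cdir (2^-1 *: v) (fun y => f (2 *: y)) x = Cdir v f (2 *: x).
Proof.
have two : (2 : R) != 0 by rewrite pnatr_eq0.
by rewrite /Cdir; congr Complex; rewrite (derive_scale (fun y => _ (f y))) scalerA mulfV ?scale1r.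
Qed.

Lemma Cc_scale2 m a f : Cc m a f -> Cc m (2 ^+ m * a) (fun y : 'rV[R]_d => f (2 *: y)).
Proof. by move=> [h1 h2]; split; [exact: (Cb_scale2 h1) | exact: (Cb_scale2 h2)]. Qed.

Definition expc (k x : 'rV[R]_d) : C := Complex (cos (phase k x)) (sin (phase k x)).

Lemma nc_expc k x : nc (expc k x) = 1.
Proof. by rewrite /= cos2Dsin2 sqrtr1. Qed.

Lemma expcD k x y : expc k (x + y) = expc k x * expc k y.
Proof.
rewrite /expc; have -> : phase k (x + y) = phase k x + phase k y.
  by rewrite -[x in LHS](scale1r x) phase_lin mul1r.
rewrite cosD sinD; apply/eqP; rewrite eq_complex /= eqxx /=; apply/eqP; ring.
Qed.

Lemma expcDk k k' x : expc (k + k') x = expc k x * expc k' x.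
Proof.
have E : phase (k + k') x = phase k x + phase k' x.
  rewrite /phase -mulrDr; congr (_ * _); rewrite -big_split; apply: eq_bigr => l _.
  by rewrite mxE mulrDl.
rewrite /expc E cosD sinD; apply/eqP; rewrite eq_complex /= eqxx /=; apply/eqP; ring.
Qed.

Lemma expc0 k : expc k 0 = 1.
Proof.
rewrite /expc; have -> : phase k 0 = 0.
  by rewrite /phase big1 ?mulr0 // => l _; rewrite mxE mulr0.
by rewrite cos0 sin0.
Qed.

Lemma expc0k x : expc 0 x = 1.
Proof.
rewrite /expc; have -> : phase 0 x = 0.
  by rewrite /phase big1 ?mulr0 // => l _; rewrite mxE mul0r.
by rewrite cos0 sin0.
Qed.

Lemma expcN k x : expc (- k) x = conjc (expc k x).
Proof.
have E : phase (- k) x = - phase k x.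
  rewrite /phase -mulrN -sumrN; congr (_ * _); apply: eq_bigr => l _.
  by rewrite mxE mulNr.
by rewrite /expc E cosN sinN.
Qed.

Lemma expcNM k x : expc (- k) x * expc k x = 1.
Proof. by rewrite -expcDk addNr expc0k. Qed.

Lemma Cdir_expc v k x : Cder v (expc k) x /\
  Cdir v (expc k) x = Complex 0 (phase k v) * expc k x.
Proof.
have [c1 c2] := derive_cosphase k x v; have [s1 s2] := derive_sinphase k x v.
split => //; rewrite /Cdir [X in Complex X _]c2 [X in Complex _ X]s2 /expc.
apply/eqP; rewrite eq_complex /=; apply/andP; split; apply/eqP; ring.
Qed.

Lemma Cc_expc m (k : 'rV[R]_d) (X : R) : 1 <= X -> (forall l, `|2 * pi * k 0 l| <= X) ->
  Cc m (X ^+ m) (expc k).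
Proof. by move=> X1 Xk; exact: (Cb_phase m X1 Xk). Qed.

End ComplexFunctions.

(** * Matrices and matrix-valued functions *)

Section MatrixBounds.
Variable R : realType.
Local Notation C := R[i].
Local Notation nc := (@normc R).

Definition mb m n (a : R) (M : 'M[C]_(m, n)) := forall i j, nc (M i j) <= a.

Lemma mb_le m n a b (M : 'M[C]_(m, n)) : a <= b -> mb a M -> mb b M.
Proof. by move=> ab H i j; exact: le_trans (H i j) ab. Qed.
Lemma mbM m n p a b (M : 'M[C]_(m, n)) (N : 'M[C]_(n, p)) : 0 <= a -> 0 <= b ->
  mb a M -> mb b N -> mb (n%:R * (a * b)) (M *m N).
Proof.
move=> a0 b0 HM HN i j; rewrite mxE -[X in X%:R](card_ord n); apply: nc_sum_le => [|k _].
  exact: mulr_ge0.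
by rewrite ncM; apply: ler_pM => //; exact: nc_ge0.
Qed.
Lemma mbD m n a b (M N : 'M[C]_(m, n)) : mb a M -> mb b N -> mb (a + b) (M + N).
Proof. by move=> HM HN i j; rewrite mxE; exact: le_trans (ncD _ _) (lerD (HM i j) (HN i j)). Qed.
Lemma mbN m n a (M : 'M[C]_(m, n)) : mb a M -> mb a (- M).
Proof. by move=> HM i j; rewrite mxE ncN. Qed.
Lemma mbB m n a b (M N : 'M[C]_(m, n)) : mb a M -> mb b N -> mb (a + b) (M - N).
Proof. by move=> HM /mbN HN; exact: mbD. Qed.
Lemma mbZ m n a c (M : 'M[C]_(m, n)) : mb a M -> mb (nc c * a) (c *: M).
Proof. by move=> HM i j; rewrite mxE ncM ler_wpM2l // nc_ge0. Qed.
Lemma mb_conj m n a (M : 'M[C]_(m, n)) : mb a M -> mb a (map_mx conjc M).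
Proof. by move=> HM i j; rewrite mxE nc_conj. Qed.

Definition mxmax m n (M : 'M[C]_(m, n)) : R := \big[Num.max/0]_(p : 'I_m * 'I_n) nc (M p.1 p.2).
Lemma mb_max m n (M : 'M[C]_(m, n)) : mb (mxmax M) M.
Proof. by move=> i j; exact: (le_bigmax 0 (fun p : 'I_m * 'I_n => nc (M p.1 p.2)) (i, j)). Qed.
Lemma mxmax_ge0 m n (M : 'M[C]_(m, n)) : 0 <= mxmax M.
Proof. exact: bigmax_ge_id. Qed.
Lemma mxmax_le m n a (M : 'M[C]_(m, n)) : 0 <= a -> mb a M -> mxmax M <= a.
Proof. by move=> a0 H; apply/bigmax_leP; split => // p _; exact: H. Qed.

(** A row vector killed by [X + E] satisfies [u = - u E X^-1], so its largest entry is at most half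
    of itself. The same argument on [Y = X^-1 - X^-1 E Y] bounds the inverse; no Neumann series is
    summed. *)
Lemma inv_perturb n (X E : 'M[C]_n) (a e : R) : X \in unitmx -> 0 <= a -> 0 <= e ->
  mb a (invmx X) -> mb e E -> n%:R * (n%:R * (a * e)) <= 2^-1 ->
  X + E \in unitmx /\ mb (2 * a) (invmx (X + E)).
Proof.
move=> uX a0 e0 HX HE small.
have n0 : (0 : R) <= n%:R by [].
have ae0 : 0 <= n%:R * (a * e) by rewrite !mulr_ge0.
have uXE : X + E \in unitmx.
  rewrite -row_free_unit -kermx_eq0; apply/rowV0P => u /sub_kermxP uXE.
  have uE : u = - (u *m (E *m invmx X)).
    have : u *m (X + E) *m invmx X = 0 by rewrite uXE mul0mx.
    by rewrite mulmxDr mulmxDl mulmxK // -mulmxA => /eqP; rewrite addr_eq0 => /eqP.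
  have B : mb (2^-1 * mxmax u) u.
    rewrite {2}uE; apply/mbN; apply: mb_le (mbM (mxmax_ge0 u) _ (mb_max u) (mbM e0 a0 HE HX)).
      have -> : n%:R * (mxmax u * (n%:R * (e * a))) = n%:R * (n%:R * (a * e)) * mxmax u by ring.
      by apply: ler_wpM2r => //; exact: mxmax_ge0.
    by rewrite (mulrC e).
  have : mxmax u <= 2^-1 * mxmax u by apply: mxmax_le => //; rewrite mulr_ge0 // mxmax_ge0.
  move=> L; have M0 : mxmax u = 0 by have := mxmax_ge0 u; lra.
  apply/matrixP => i j; rewrite mxE; apply/eqP; rewrite -nc_eq0 eq_le nc_ge0 andbT -M0.
  exact: mb_max.
split => //.
set Y := invmx (X + E).
have YE : Y = invmx X - invmx X *m E *m Y.
  have : invmx X *m ((X + E) *m Y) = invmx X by rewrite mulmxV ?mulmx1.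
  by rewrite mulmxDl mulmxDr (mulKmx uX) mulmxA => H; rewrite -[X in X - _]H addrK.
have B : mb (a + 2^-1 * mxmax Y) Y.
  rewrite {2}YE; apply: mbB => //; apply: mb_le (mbM _ (mxmax_ge0 Y) (mbM a0 e0 HX HE) (mb_max Y)) => //.
  by rewrite mulrA; apply: ler_wpM2r => //; exact: mxmax_ge0.
have Y0 := mxmax_ge0 Y.
have : mxmax Y <= a + 2^-1 * mxmax Y by apply: mxmax_le => //; rewrite addr_ge0 // mulr_ge0.
by move=> L; apply: mb_le (@mb_max _ _ Y); lra.
Qed.

Lemma mb1 n : mb 1 (1%:M : 'M[C]_n).
Proof. by move=> i j; rewrite mxE; case: (i == j); rewrite ?nc1 ?nc0. Qed.

End MatrixBounds.

Section MatrixFunctions.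
Variables (R : realType) (d : nat).
Local Notation C := R[i].
Local Notation nc := (@normc R).
Implicit Types (x v : 'rV[R]_d).

Definition Cm n m (a : R) (Z : 'rV[R]_d -> 'M[C]_n) := forall i j, Cc m a (fun x => Z x i j).

Lemma size_index_enum (I : finType) : size (index_enum I) = #|I|.
Proof. by rewrite cardT enumT. Qed.

Lemma Cc_fsum m a (I : finType) (F : I -> 'rV[R]_d -> C) : (forall i, Cc m a (F i)) ->
  Cc m (#|I|%:R * a) (fun x => \sum_i F i x).
Proof. by move=> H; rewrite -size_index_enum; exact: Cc_sum. Qed.

Section Fixn.
Variable n : nat.
Implicit Types (Z W : 'rV[R]_d -> 'M[C]_n).

Lemma Cm_le m a b Z : a <= b -> Cm m a Z -> Cm m b Z.
Proof. by move=> ab H i j; apply: Cc_le ab _. Qed.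
Lemma CmW m m' a Z : (m' <= m)%N -> Cm m a Z -> Cm m' a Z.
Proof. by move=> ab H i j; apply: CcW ab _. Qed.
Lemma Cm_mb m a Z : Cm m a Z -> forall x, mb (2 * a) (Z x).
Proof. by move=> H x i j; exact: (Cc_bound (H i j)). Qed.
Lemma CmD m a b Z W : Cm m a Z -> Cm m b W -> Cm m (a + b) (fun x => Z x + W x).
Proof.
move=> HZ HW i j; under [X in Cc _ _ X]funext => x do rewrite mxE.
exact: CcD.
Qed.
Lemma CmN m a Z : Cm m a Z -> Cm m a (fun x => - Z x).
Proof.
move=> HZ i j; under [X in Cc _ _ X]funext => x do rewrite mxE.
exact: CcN.
Qed.
Lemma Cm_conj m a Z : Cm m a Z -> Cm m a (fun x => map_mx conjc (Z x)).
Proof.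
move=> HZ i j; under [X in Cc _ _ X]funext => x do rewrite mxE.
exact: Cc_conj.
Qed.
Lemma CmM m a b Z W : Cm m a Z -> Cm m b W ->
  Cm m (n%:R * (2 ^+ m.+1 * (a * b))) (fun x => Z x *m W x).
Proof.
move=> HZ HW i j; under [X in Cc _ _ X]funext => x do rewrite mxE.
rewrite -[X in X%:R]card_ord.
by apply: (@Cc_fsum m _ _ (fun k x => Z x i k * W x k j)) => k; exact: CcM.
Qed.
Lemma Cm_cst m a (P : 'M[C]_n) : mb a P -> Cm m a (fun=> P).
Proof. by move=> H i j; apply: Cc_le (H i j) _; exact: Cc_cst. Qed.
Lemma Cm_scale2 m a Z : Cm m a Z -> Cm m (2 ^+ m * a) (fun y : 'rV[R]_d => Z (2 *: y)).
Proof. by move=> H i j; exact: (Cc_scale2 (H i j)). Qed.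

Lemma mx_dirE v Z x : mx_dir v Z x = \matrix_(i, j) Cdir v (fun y => Z y i j) x.
Proof. by []. Qed.

Definition Cmder v Z x := forall i j, Cder v (fun y => Z y i j) x.

Lemma Cm_der m a Z x v : Cm m.+1 a Z -> Cmder v Z x.
Proof. by move=> H i j; exact: (Cc_der _ _ (H i j)). Qed.

Lemma mx_dir_cst v (P : 'M[C]_n) x : Cmder v (fun=> P) x /\ mx_dir v (fun=> P) x = 0.
Proof.
split; first by move=> i j; exact: Cder_cst.
by apply/matrixP => i j; rewrite mx_dirE !mxE Cdir_cst.
Qed.

Lemma mx_dirM v Z W x : Cmder v Z x -> Cmder v W x ->
  Cmder v (fun y => Z y *m W y) x /\
  mx_dir v (fun y => Z y *m W y) x = mx_dir v Z x *m W x + Z x *m mx_dir v W x.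
Proof.
move=> HZ HW.
have E i j : (fun y => (Z y *m W y) i j) = (fun y => \sum_k Z y i k * W y k j).
  by apply/funext => y; rewrite mxE.
have K i j k := CdirM (HZ i k) (HW k j).
split.
  by move=> i j; rewrite E; apply: (Cdir_sum (F := fun k y => Z y i k * W y k j) _ _).1 => k; exact: (K i j k).1.
apply/matrixP => i j; rewrite mx_dirE !mxE E.
rewrite (Cdir_sum (F := fun k y => Z y i k * W y k j) _ (fun k => (K i j k).1)).2 -big_split /=.
by apply: eq_bigr => k _; rewrite (K i j k).2 !mxE.
Qed.

Lemma mx_dirD v Z W x : Cmder v Z x -> Cmder v W x ->
  Cmder v (fun y => Z y + W y) x /\
  mx_dir v (fun y => Z y + W y) x = mx_dir v Z x + mx_dir v W x.
Proof.
move=> HZ HW.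
have E i j : (fun y => (Z y + W y) i j) = (fun y => Z y i j + W y i j).
  by apply/funext => y; rewrite mxE.
have K i j := CdirD (HZ i j) (HW i j).
split; first by move=> i j; rewrite E; exact: (K i j).1.
by apply/matrixP => i j; rewrite mx_dirE !mxE E (K i j).2.
Qed.

Lemma mx_dir_conj v Z x : Cmder v Z x ->
  Cmder v (fun y => map_mx conjc (Z y)) x /\
  mx_dir v (fun y => map_mx conjc (Z y)) x = map_mx conjc (mx_dir v Z x).
Proof.
move=> HZ.
have E i j : (fun y => (map_mx conjc (Z y)) i j) = (fun y => conjc (Z y i j)).
  by apply/funext => y; rewrite mxE.
have K i j := Cdir_conj (HZ i j).
split; first by move=> i j; rewrite E; exact: (K i j).1.
by apply/matrixP => i j; rewrite mx_dirE !mxE E (K i j).2.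
Qed.

Lemma mx_dir_scale2 v Z x : mx_dir (2^-1 *: v) (fun y => Z (2 *: y)) x = mx_dir v Z (2 *: x).
Proof. by apply/matrixP => i j; rewrite !mx_dirE !mxE; exact: (Cdir_scale2 v (fun y => Z y i j)). Qed.

Lemma Cm_dir m a Z v : Cm m.+1 a Z ->
  Cm m (d%:R * (2 ^+ m.+1 * (\big[Num.max/0]_l `|v 0 l| * a))) (mx_dir v Z).
Proof.
move=> H i j; under [X in Cc _ _ X]funext => x do rewrite mx_dirE mxE (Cdir_sum_coord _ _ (H i j)).
rewrite -[X in X%:R]card_ord.
apply: (@Cc_fsum m _ _ (fun l x => Complex (v 0 l) 0 * Cdir (ev R l) (fun y => Z y i j) x)) => l.
apply: CcM; last by have [h1 h2] := H i j; split; [exact: (Cb_partial l h1) | exact: (Cb_partial l h2)].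
apply: Cc_le (Cc_cst _ _ _); rewrite nc_real.
exact: (le_bigmax 0 (fun l => `|v 0 l|) l).
Qed.
End Fixn.

Lemma Cc_det m n : exists p, forall (X : R) (Z : 'rV[R]_d -> 'M[C]_n), 2 <= X -> Cm m X Z ->
  Cc m (X ^+ p) (fun x => \det (Z x)).
Proof.
exists (#|{perm 'I_n}| + m.+2 * n)%N => X Z X2 HZ.
pose F (s : {perm 'I_n}) x := (-1) ^+ s * \prod_i Z x i (s i).
have HF s : Cc m (X ^+ (m.+2 * n)) (F s).
  have H1 : Cc m (X ^+ (m.+2 * n)) (fun x => \prod_i Z x i (s i)).
    have := @Cc_prod _ _ m X _ (index_enum 'I_n) (fun i x => Z x i (s i)) (fun i => HZ i (s i)).
    apply: Cc_le.
    rewrite size_index_enum card_ord.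
    rewrite exprM; apply: lerXn2r; rewrite ?nnegrE ?X_ge0 //; first by rewrite mulr_ge0 ?exprn_ge0 //; lra.
    by rewrite [X in _ <= X]exprSr; apply: ler_wpM2r; [lra | exact: le2X].
  rewrite /F; case: (odd_perm s); last by under [X in Cc _ _ X]funext => x do rewrite expr0 mul1r.
  by under [X in Cc _ _ X]funext => x do rewrite expr1 mulN1r; exact: CcN.
have := Cc_fsum HF; apply: Cc_le.
by rewrite exprD; apply: ler_wpM2r; [exact: X_ge0 | exact: lenX].
Qed.

(** Cramer's rule: cofactors are polynomial in the entries, so besides the bound on [Z] only a lower
    bound on the determinant is needed to control all derivatives of the inverse. *)
Lemma Cm_inv m n : exists p, forall (X : R) (Z : 'rV[R]_d -> 'M[C]_n), 2 <= X -> Cm m X Z ->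
  (forall x, X^-1 <= nc (\det (Z x))) -> Cm m (X ^+ p) (fun x => invmx (Z x)).
Proof.
have [p1 H1] := Cc_det m n; have [p2 H2] := Cc_det m n.-1; have [p3 H3] := CcV R d m.
exists (m.+1 + (p1.+1 * p3 + p2))%N => X Z X2 HZ Hdet i j.
have u x : Z x \in unitmx.
  rewrite unitmxE unitfE -nc_gt0; apply: lt_le_trans (Hdet x); rewrite invr_gt0; lra.
have X1 : 1 <= X by lra.
have D : Cc m (X ^+ (p1.+1 * p3)) (fun x => (\det (Z x))^-1).
  rewrite exprM; apply: H3.
  - by apply: (le_trans X2); rewrite -[X in X <= _]expr1; apply: leXX.
  - move=> x; apply: le_trans (Hdet x); rewrite lef_pV2 ?posrE ?exprn_gt0 //; try lra.
    by rewrite -[X in X <= _]expr1; apply: leXX.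
  - by apply: Cc_le (H1 X Z X2 HZ); apply: leXX.
have A : Cc m (X ^+ p2) (fun x => (\adj (Z x)) i j).
  have Hc : Cc m (X ^+ p2) (fun x => \det (row' j (col' i (Z x)))).
    apply: (H2 X (fun x => row' j (col' i (Z x))) X2) => a b.
    by under [X in Cc _ _ X]funext => x do rewrite !mxE; exact: HZ.
  under [X in Cc _ _ X]funext => x do rewrite mxE /cofactor -signr_odd.
  case: (odd _); last by under [X in Cc _ _ X]funext => x do rewrite expr0 mul1r.
  by under [X in Cc _ _ X]funext => x do rewrite expr1 mulN1r; exact: CcN.
under [X in Cc _ _ X]funext => x do rewrite /invmx u mxE.
apply: Cc_le (CcM D A); rewrite -exprD [X in _ <= X]exprD.
by apply: ler_wpM2r; [exact: X_ge0 | exact: le2X].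
Qed.

End MatrixFunctions.

(** * Comparison with the operator and C^r norms *)

Section OperatorNorm.
Variable R : realType.
Local Notation C := R[i].
Local Notation nc := (@normc R).
Variable n : nat.
Implicit Types (M : 'M[C]_n) (v : 'cV[C]_n).

Let opset M := [set y : R | exists v : 'cV[C]_n, vnorm v <= 1 /\ y = vnorm (M *m v)].

Lemma nc_le_vnorm v i : nc (v i 0) <= vnorm v.
Proof.
rewrite ncE ler_wsqrtr // (bigD1 i) //= lerDl; apply: sumr_ge0 => j _.
by rewrite addr_ge0 ?sqr_ge0.
Qed.

Lemma vnorm_le v a : 0 <= a -> (forall i, nc (v i 0) <= a) -> vnorm v <= n%:R * a.
Proof.
move=> a0 H; rewrite -[X in _ <= X]ger0_norm ?mulr_ge0 // -sqrtr_sqr ler_wsqrtr //.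
apply: (@le_trans _ _ (\sum_(i < n) a ^+ 2)).
  apply: ler_sum => i _; rewrite -[X in X <= _]sqr_sqrtr ?addr_ge0 ?sqr_ge0 //.
  by apply: lerXn2r; rewrite ?nnegrE ?sqrtr_ge0 // -ncE.
rewrite sumr_const card_ord exprMn -[X in X <= _]mulr_natl; apply: ler_wpM2r; first exact: sqr_ge0.
by rewrite -natrX ler_nat -mulnn; case: (n) => // k; rewrite leq_pmulr.
Qed.

Lemma opset_ub M a : 0 <= a -> mb a M -> ubound (opset M) (n%:R * (n%:R * a)).
Proof.
move=> a0 H _ [v [v1 ->]]; apply: vnorm_le => [|i]; first by rewrite mulr_ge0.
rewrite mxE -[X in X%:R]card_ord; apply: nc_sum_le => // j _.
rewrite ncM -[X in _ <= X]mulr1; apply: ler_pM => //; try exact: nc_ge0.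
exact: le_trans (nc_le_vnorm _ _) v1.
Qed.

Lemma opset_ne M : opset M !=set0.
Proof.
exists (vnorm (M *m 0)), 0; split => //; rewrite /vnorm big1 ?sqrtr0 // => i _.
by rewrite mxE /= expr0n addr0.
Qed.

Lemma opnorm_le M a : 0 <= a -> mb a M -> opnorm M <= n%:R * (n%:R * a).
Proof. by move=> a0 H; apply: ge_sup; [exact: opset_ne | exact: opset_ub]. Qed.

Lemma le_opnorm M i j : nc (M i j) <= opnorm M.
Proof.
have Hd : vnorm (delta_mx j 0 : 'cV[C]_n) <= 1.
  rewrite /vnorm (bigD1 j) //= big1 => [|k kj]; last first.
    by rewrite mxE (negbTE kj) /= expr0n addr0.
  by rewrite mxE !eqxx /= expr1n expr0n !addr0 sqrtr1.
apply: (@le_trans _ _ (vnorm (M *m delta_mx j 0))).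
  apply: le_trans (nc_le_vnorm _ i); rewrite -colE mxE; exact: lexx.
apply: ub_le_sup; last by exists (delta_mx j 0).
exists (n%:R * (n%:R * mxmax M)); apply: opset_ub; [exact: mxmax_ge0 | exact: mb_max].
Qed.

End OperatorNorm.

Section CrNorm.
Variables (R : realType) (d n : nat).
Local Notation C := R[i].
Local Notation nc := (@normc R).
Implicit Types (Z : 'rV[R]_d -> 'M[C]_n).

Let crset r Z := [set y : R | exists (s : seq 'I_d) (x : 'rV[R]_d),
                      (size s <= r)%N /\ y = opnorm (mx_partial s Z x)].

Lemma mb_partial r a Z s x : Cm r a Z -> (size s <= r)%N -> mb (2 * a) (mx_partial s Z x).
Proof.
move=> H sr i j; rewrite mxE; have [h1 h2] := H i j; apply: (le_trans (nc_le _)) => /=.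
by have := Cb_bound (Cb_iter h1 sr) x; have := Cb_bound (Cb_iter h2 sr) x; lra.
Qed.

Lemma crset_ub r a Z : 0 <= a -> Cm r a Z -> ubound (crset r Z) (n%:R * (n%:R * (2 * a))).
Proof.
move=> a0 H _ [s [x [sr ->]]]; apply: opnorm_le; first by rewrite mulr_ge0.
exact: (mb_partial _ H sr).
Qed.

Lemma crset_ne r Z : crset r Z !=set0.
Proof. by exists (opnorm (mx_partial [::] Z 0)), [::], 0. Qed.

Lemma Cr_norm_le r a Z : 0 <= a -> Cm r a Z -> Cr_norm r Z <= n%:R * (n%:R * (2 * a)).
Proof. by move=> a0 H; apply: ge_sup; [exact: crset_ne | exact: crset_ub]. Qed.

(** The a priori bound [a] makes the set under [sup] bounded, since [sup] carries no information
    otherwise; after that [Cr_norm] itself bounds the entries and their derivatives. *)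
Lemma Cm_Cr_norm r a Z : Cm r a Z -> Cm r (Cr_norm r Z) Z.
Proof.
move=> H i j; have a0 : 0 <= a by have [/Cb_ge0] := H i j.
have B s x : (size s <= r)%N -> nc (mx_partial s Z x i j) <= Cr_norm r Z.
  move=> sr; apply: le_trans (le_opnorm _ i j) _.
  apply: ub_le_sup; last by exists s, x.
  by exists (n%:R * (n%:R * (2 * a))); exact: crset_ub.
have [h1 h2] := H i j.
split; apply: Cb_intro => s sr; [have := Cb_iter h1 sr | have := Cb_iter h2 sr] => K;
  (split; [exact: Cb_cont K| |exact: (Cb_derivable K)]) => x; apply: le_trans (B s x sr);
  rewrite mxE; [exact: le_trans (nc_Re _) | exact: le_trans (nc_Im _)].
Qed.

Lemma smooth_Cm Z : smooth_mx Z -> Zperiodic Z -> forall m, exists2 a : R, 0 <= a & Cm m a Z.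
Proof.
move=> sm per m.
have P i j : exists a, Cc m a (fun x => Z x i j).
  have [s1 s2] := sm i j.
  have [a Ha] := smooth_Cb s1 (fun x k => congr1 (fun M : 'M[C]_n => Re (M i j)) (per x k)) m.
  have [b Hb] := smooth_Cb s2 (fun x k => congr1 (fun M : 'M[C]_n => Im (M i j)) (per x k)) m.
  have a0 := Cb_ge0 Ha; have b0 := Cb_ge0 Hb.
  by exists (a + b); split; [apply: Cb_le Ha | apply: Cb_le Hb]; rewrite ?lerDl ?lerDr.
pose b i j := projT1 (cid (P i j)).
have Hb i j : Cc m (b i j) (fun x => Z x i j) by exact: (projT2 (cid (P i j))).
exists (\big[Num.max/0]_(p : 'I_n * 'I_n) b p.1 p.2); first exact: bigmax_ge_id.
by move=> i j; apply: Cc_le (Hb i j); exact: (le_bigmax 0 (fun p => b p.1 p.2) (i, j)).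
Qed.

Lemma Cm_smooth Z : (forall m, exists a : R, Cm m a Z) -> smooth_mx Z.
Proof.
by move=> H i j; split; apply: Cb_smooth => m; have [a /(_ i j)[h1 h2]] := H m; exists a.
Qed.

End CrNorm.

(** * Discrete Fourier transform *)

Section Differences.
Variables (R : realType) (d : nat).
Local Notation C := R[i].
Local Notation nc := (@normc R).
Implicit Types (g : 'rV[R]_d -> R) (x v : 'rV[R]_d).

Lemma derive_shiftv g (c : 'rV[R]_d) x v : 'D_v (fun y : 'rV[R]_d => g (y + c)) x = 'D_v g (x + c).
Proof.
rewrite /derive; set F := (fun h => h^-1 *: _); set G := (fun h => h^-1 *: _).
suff -> : F = G by [].
by apply/funext => h; rewrite /F /G /= addrA.
Qed.

Lemma derivable_shiftv g (c : 'rV[R]_d) x v : derivable g (x + c) v -> derivable (fun y : 'rV[R]_d => g (y + c)) x v.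
Proof.
rewrite /derivable; set F := (fun h => h^-1 *: _); set G := (fun h => h^-1 *: _).
suff -> : F = G by [].
by apply/funext => h; rewrite /F /G /= addrA.
Qed.

Lemma shift_continuous g (c : 'rV[R]_d) : continuous (g : 'rV[R]_d -> R) -> continuous (fun y : 'rV[R]_d => g (y + c)).
Proof.
move=> cg x; have H : {for x + c, continuous g} := cg (x + c).
suff : {for x, continuous (fun y : 'rV[R]_d => g (y + c))} by [].
rewrite continuous_shift in H; rewrite continuous_shift.
have -> : (fun y : 'rV[R]_d => g (y + c)) \o shift x = g \o shift (x + c).
  by apply/funext => y /=; rewrite addrA.
exact: H.
Qed.

Lemma Cb_shift m a g (c : 'rV[R]_d) : Cb m a g -> Cb m a (fun y : 'rV[R]_d => g (y + c)).
Proof.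
elim: m g => [|m IH] g [c1 c2 c3 c4].
all: have cs := @shift_continuous _ c c1.
all: have ds l x : derivable (fun y : 'rV[R]_d => g (y + c)) x (ev R l) by
  (apply: derivable_shiftv; exact: c3).
  by split.
split => // l.
have -> : (fun x => 'D_(ev R l) (fun y : 'rV[R]_d => g (y + c)) x) = (fun x => 'D_(ev R l) g (x + c)).
  by apply/funext => x; rewrite derive_shiftv.
exact: IH (c4 l).
Qed.

Lemma Cb_diff m a g l (h : R) : 0 <= h -> Cb m.+1 a g ->
  Cb m (h * a) (fun x => g (x + h *: ev R l) - g x).
Proof.
move=> h0; elim: m g => [|m IH] g Hg.
all: have B x : `|g (x + h *: ev R l) - g x| <= h * a by
 (have [t _ E] := MVT_line (@Cb_derivable _ _ _ _ _ Hg l) x h; rewrite (addrC x) E normrM ger0_norm //;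
  apply: ler_wpM2l => //; exact: (Cb_bound (Cb_partial l Hg))).
all: have [c1 c2 c3 _] := CbD (Cb_shift (h *: ev R l) Hg) (CbN Hg).
  by split.
split => // l'.
have D1 x := @Cb_derivable _ _ _ _ _ Hg l' x.
have D2 x := @Cb_derivable _ _ _ _ _ (Cb_shift (h *: ev R l) Hg) l' x.
have -> : (fun x => 'D_(ev R l') (fun x => g (x + h *: ev R l) - g x) x) =
  (fun x => 'D_(ev R l') g (x + h *: ev R l) - 'D_(ev R l') g x).
  by apply/funext => x; rewrite (deriveB (D2 x) (D1 x)) derive_shiftv.
exact: IH (Cb_partial l' Hg).
Qed.

Lemma Cb_taylor a g l (h : R) x : 0 <= h -> Cb 2 a g ->
  `|g (x + h *: ev R l) - g x - h * 'D_(ev R l) g x| <= h ^+ 2 * a.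
Proof.
move=> h0 Hg; have Hg' := Cb_partial l Hg; have Hg'' := Cb_partial l Hg'.
have [t th E] := MVT_line (@Cb_derivable _ _ _ _ _ Hg l) x h.
have [u ut E2] := MVT_line (@Cb_derivable _ _ _ _ _ Hg' l) x t.
rewrite (addrC x) E -mulrBr E2 !normrM (ger0_norm h0) expr2 -mulrA; apply: ler_wpM2l => //.
by apply: ler_pM => //; [rewrite -(ger0_norm h0) | exact: (Cb_bound Hg'')].
Qed.

Implicit Types (f : 'rV[R]_d -> C).

Definition Cdiff l (h : R) f x := f (x + h *: ev R l) - f x.

Lemma Cc_diff m a f l (h : R) : 0 <= h -> Cc m.+1 a f -> Cc m (h * a) (Cdiff l h f).
Proof.
move=> h0 [h1 h2]; split.
  by have := Cb_diff l h0 h1; congr Cb; apply/funext => x; rewrite /Cdiff; case: (f _); case: (f x).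
by have := Cb_diff l h0 h2; congr Cb; apply/funext => x; rewrite /Cdiff; case: (f _); case: (f x).
Qed.

(** Each difference spends one derivative and gains a factor [h]; with [h = 1/N] this becomes the
    decay of high frequencies. *)
Lemma Cc_diffn r a f l (h : R) : 0 <= h -> Cc r a f ->
  forall x, nc (iter r (Cdiff l h) f x) <= 2 * (h ^+ r * a).
Proof.
move=> h0; elim: r f a => [|r IH] f a Hf x.
  by rewrite expr0 mul1r; exact: (Cc_bound Hf).
by rewrite iterSr exprSr -mulrA; apply: IH; exact: Cc_diff.
Qed.

Lemma Cc_taylor a f l (h : R) x : 0 <= h -> Cc 2 a f ->
  nc (f (x + h *: ev R l) - f x - Complex h 0 * Cdir (ev R l) f x) <= 2 * (h ^+ 2 * a).
Proof.
move=> h0 [h1 h2]; apply: (le_trans (nc_le _)).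
have := Cb_taylor l x h0 h1; have := Cb_taylor l x h0 h2.
rewrite /Cdir; case: (f _) => a1 b1; case: (f x) => a2 b2 /=.
by rewrite !mul0r subr0 addr0; lra.
Qed.

End Differences.

(** * Roots of unity and the length of chords *)

Section UnitCircle.
Variable R : realType.
Local Notation C := R[i].
Local Notation nc := (@normc R).

Definition e1 (t : R) : C := Complex (cos (2 * pi * t)) (sin (2 * pi * t)).

Lemma e1D s t : e1 (s + t) = e1 s * e1 t.
Proof.
rewrite /e1 mulrDr cosD sinD; apply/eqP; rewrite eq_complex /= eqxx /=; apply/eqP; ring.
Qed.
Lemma e10 : e1 0 = 1. Proof. by rewrite /e1 mulr0 cos0 sin0. Qed.
Lemma e1_nat (k : nat) : e1 k%:R = 1.
Proof.
elim: k => [|k IH]; first exact: e10.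
rewrite -natr1 e1D IH mul1r /e1 mulr1; have -> : 2 * pi = pi *+ 2 :> R by rewrite mulr_natl.
by rewrite cos2pi sin2pi.
Qed.
Lemma e1N t : e1 (- t) = conjc (e1 t).
Proof. by rewrite /e1 mulrN cosN sinN. Qed.
Lemma e1_int (k : int) : e1 k%:~R = 1.
Proof.
case: k => k; first exact: e1_nat.
by rewrite NegzE mulrNz e1N e1_nat; apply/eqP; rewrite eq_complex /= oppr0 !eqxx.
Qed.
Lemma nc_e1 t : nc (e1 t) = 1.
Proof. by rewrite /= cos2Dsin2 sqrtr1. Qed.
Lemma e1X t k : e1 t ^+ k = e1 (k%:R * t).
Proof.
elim: k => [|k IH]; first by rewrite mul0r e10.
by rewrite exprS IH -e1D -natr1 mulrDl mul1r addrC.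
Qed.

Lemma cos_le0 (y : R) : pi / 2 <= y <= pi -> cos y <= 0.
Proof.
move=> /andP[y1 y2]; have -> : y = (y - pi / 2) + pi / 2 by ring.
rewrite cosDpihalf oppr_le0; apply: sin_ge0_pi; have := pi_gt0 R; lra.
Qed.

(* Among the powers of [e1 t], the one landing in the left half plane is at distance at least 1 from 1. *)
Lemma e1_lower_pos (t : R) : 0 < t <= 2^-1 -> 2 * t <= nc (e1 t - 1).
Proof.
move=> /andP[t0 t2].
(* [m] is the integer part of [1 / (2 t)], so the angle [2 pi m t] lies between a quarter turn and a
   half turn. *)
have [m [m0 m1 m2]] : exists m : nat, [/\ (0 < m)%N, m%:R * t <= 2^-1 & 4^-1 <= m%:R * t].
  pose y := (2 * t)^-1.
  have y1 : 1 <= y by rewrite /y invf_ge1; lra.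
  have y0 : 0 <= y by lra.
  pose m := Num.truncn y.
  have /andP[my ym] := truncn_itv y0; rewrite -/m in my ym.
  have m0 : (0 < m)%N by rewrite lt0n; apply/eqP => m0; move: ym; rewrite m0 => ?; lra.
  have yt : y * t = 2^-1 by rewrite /y; field; apply/eqP => ?; lra.
  exists m; split => //; first by rewrite -yt ler_wpM2r // ltW.
  have : y * t < m.+1%:R * t by rewrite ltr_pM2r.
  rewrite yt -[m.+1%:R]natr1 mulrDl mul1r => H.
  have [t4|t4] := lerP t 4^-1; first lra.
  have : 1 * t <= m%:R * t by rewrite ler_pM2r // ler1n.
  lra.
have P : 1 <= nc (e1 t ^+ m - 1).
  rewrite e1X; apply: le_trans (nc_Re _) => /=.
  have : cos (2 * pi * (m%:R * t)) <= 0.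
    apply: cos_le0; have p0 := pi_gt0 R.
    have : 2 * pi * 4^-1 <= 2 * pi * (m%:R * t) by apply: ler_wpM2l => //; lra.
    have : 2 * pi * (m%:R * t) <= 2 * pi * 2^-1 by apply: ler_wpM2l => //; lra.
    lra.
  move=> c0; rewrite ler0_norm; lra.
have Q : nc (e1 t ^+ m - 1) <= m%:R * nc (e1 t - 1).
  rewrite subrX1 ncM mulrC; apply: ler_wpM2r; first exact: nc_ge0.
  rewrite -[X in _ <= X%:R](card_ord m) -[X in _ <= X]mulr1; apply: nc_sum_le => // i _.
  by rewrite ncX nc_e1 expr1n.
have mp : (0:R) < m%:R by rewrite ltr0n.
rewrite -(ler_pM2l mp); lra.
Qed.

Lemma e1_lower (t : R) : `|t| <= 2^-1 -> 2 * `|t| <= nc (e1 t - 1).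
Proof.
move=> t2; have [->|t0] := eqVneq t 0; first by rewrite normr0 mulr0 nc_ge0.
have [tp|tn] := lerP 0 t.
  by rewrite ger0_norm // in t2 *; apply: e1_lower_pos; rewrite lt_def t0 tp.
rewrite ltr0_norm // in t2 *.
have -> : nc (e1 t - 1) = nc (e1 (- t) - 1).
  rewrite e1N -[in RHS]nc_conj; congr nc.
  by case: (e1 t) => a b; apply/eqP; rewrite eq_complex /= !subr0 opprK !eqxx.
by apply: e1_lower_pos; rewrite oppr_gt0 tn.
Qed.

End UnitCircle.

(** * Fourier components over a finite grid *)

Section DFT.
Variables (R : realType) (d H : nat).
Local Notation C := R[i].
Local Notation nc := (@normc R).
Let N := (2 * H).+1.
Local Notation idx := {ffun 'I_d -> 'I_N}.
Implicit Types (f g : 'rV[R]_d -> C) (x v : 'rV[R]_d) (k y : idx).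

Definition zR (z : 'rV[int]_d) : 'rV[R]_d := map_mx intr z.

(* Frequencies are centred: coordinates of [dft_freq k] range over [-H, H]. *)
Definition dft_freq k : 'rV[int]_d := \row_l ((k l)%:Z - H%:Z).
Definition dft_pt y : 'rV[R]_d := \row_l ((y l)%:R / N%:R).

(** The variable [x] is kept: this is a function on the torus, the part of a periodic [f] carried by
    all frequencies congruent modulo [N] to [dft_freq k], and not a single coefficient. *)
Definition dft k f x : C :=
  (N%:R ^+ d)^-1 * \sum_y f (x + dft_pt y) * expc (- zR (dft_freq k)) (dft_pt y).

Lemma N0 : (N%:R : C) != 0. Proof. by rewrite pnatr_eq0. Qed.
Lemma Nd0 : (N%:R : C) ^+ d != 0. Proof. by rewrite expf_neq0 // N0. Qed.

Lemma expc_prod (k x : 'rV[R]_d) : expc k x = \prod_l e1 (k 0 l * x 0 l).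
Proof.
rewrite /expc /phase; elim/big_rec2 : _ => [|l z s _ IH].
  by rewrite mulr0 cos0 sin0.
rewrite -/(e1 _) in IH *.
by rewrite -IH -e1D.
Qed.

Lemma expc_sub_int (z : 'rV[int]_d) : Zperiodic (expc (zR z)).
Proof.
move=> x l; rewrite expcD -[RHS]mulr1; congr (_ * _); rewrite expc_prod.
apply: big1 => j _; rewrite !mxE.
by case: (_ && _); rewrite ?mulr1 ?mulr0 ?e1_int ?e10.
Qed.

Lemma dft_orthogonal_coord (y : 'I_N) :
  \sum_(m < N) e1 (- (m%:R - H%:R) * (y%:R / N%:R) : R) = (if y == 0 :> nat then N%:R else 0).
Proof.
have Np : (0 : R) < N%:R by rewrite ltr0n.
under eq_bigr => m _ do (rewrite (_ : - (m%:R - H%:R) * (y%:R / N%:R) =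
   H%:R * (y%:R / N%:R) + m%:R * - (y%:R / N%:R)); last ring).
under eq_bigr => m _ do rewrite e1D -[e1 (m%:R * _)]e1X.
rewrite -mulr_sumr; case: eqP => [->|/eqP y0].
  rewrite mul0r mulr0 oppr0 e10 mul1r.
  by under eq_bigr => m _ do rewrite expr1n; rewrite sumr_const card_ord.
set z := e1 (- _); have zN : z ^+ N = 1.
  rewrite e1X mulrN mulrCA mulfV ?gt_eqF // mulr1.
  by rewrite -[y%:R]/((y%:Z)%:~R) -mulrNz e1_int.
have : (z - 1) * \sum_(m < N) z ^+ m = 0 by rewrite -subrX1 zN subrr.
move/eqP; rewrite mulf_eq0 => /orP[z1|/eqP -> //]; last by rewrite mulr0.
exfalso; move: z1; rewrite subr_eq0 => /eqP z1.
(* [z = e1 (-y/N) = e1 (1 - y/N)]; one of the two arguments is in [-1/2, 1/2]. *)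
have yN : (y%:R / N%:R : R) < 1 by rewrite ltr_pdivrMr // mul1r ltr_nat ltn_ord.
have y0' : (0 : R) < y%:R / N%:R by rewrite divr_gt0 // ltr0n lt0n.
have [t2|t2] := lerP (y%:R / N%:R : R) 2^-1.
  have := @e1_lower _ (- (y%:R / N%:R : R)); rewrite -/z z1 subrr nc0 normrN gtr0_norm //.
  by move=> /(_ t2) ?; lra.
have := @e1_lower _ (1 - (y%:R / N%:R : R)).
rewrite e1D -/z z1 mulr1 (e1_nat _ 1) subrr nc0 gtr0_norm ?subr_gt0 // => K.
have ? := K ltac:(lra); lra.
Qed.

(** Summing the characters over all [k] kills every grid point but the origin. The identity is
    therefore exact at each [x], on the grid or off it, and asks for no regularity of [f]. *)
Lemma dft_inv f x : f x = \sum_k dft k f x.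
Proof.
rewrite /dft -mulr_sumr exchange_big /=.
under eq_bigr => y _ do rewrite -mulr_sumr.
have E y : \sum_k expc (- zR (dft_freq k)) (dft_pt y) = (if [forall l, y l == 0 :> nat] then N%:R ^+ d else 0).
  under eq_bigr => k _ do rewrite expc_prod.
  have -> : \sum_k \prod_l e1 ((- zR (dft_freq k)) 0 l * dft_pt y 0 l) =
     \prod_l \sum_(m < N) e1 (- (m%:R - H%:R) * ((y l)%:R / N%:R) : R).
    rewrite bigA_distr_bigA /=; apply: eq_bigr => k _; apply: eq_bigr => l _.
    by rewrite !mxE intrB.
  under eq_bigr => l _ do rewrite dft_orthogonal_coord.
  case: ifPn => [/forallP Y|].
    by under eq_bigr => l _ do rewrite (eqP (Y l)) eqxx; rewrite prodr_const card_ord.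
  rewrite negb_forall => /existsP[l yl].
  by rewrite (bigD1 l) //= (negbTE yl) mul0r.
under eq_bigr => y _ do rewrite E.
pose y0 : idx := [ffun=> ord0].
rewrite (bigD1 y0) //= big1 ?addr0 => [|y yy].
  have -> : [forall l, y0 l == 0 :> nat] by apply/forallP => l; rewrite ffunE.
  rewrite mulrC mulfK ?Nd0 //; congr f; rewrite -[x in LHS]addr0; congr (_ + _).
  by apply/rowP => l; rewrite !mxE ffunE mul0r.
case: forallP => [Y|_]; last by rewrite mulr0.
by case/eqP: yy; apply/ffunP => l; rewrite ffunE; apply/val_inj/eqP/Y.
Qed.

Lemma dft_le k f a : 0 <= a -> (forall x, nc (f x) <= a) -> forall x, nc (dft k f x) <= a.
Proof.
move=> a0 Hf x; rewrite /dft ncM ncV ncX nc_nat.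
have Np : (0 : R) < N%:R ^+ d by rewrite exprn_gt0 // ltr0n.
rewrite -(ler_pM2l Np) mulrA mulfV ?gt_eqF // mul1r.
have -> : (N%:R ^+ d : R) = #|{: idx}|%:R by rewrite card_ffun !card_ord natrX.
by apply: nc_sum_le => // y _; rewrite ncM nc_expc mulr1.
Qed.

Lemma dftD k f g x : dft k (fun x => f x + g x) x = dft k f x + dft k g x.
Proof. by rewrite /dft -mulrDr -big_split /=; congr (_ * _); apply: eq_bigr => y _; rewrite mulrDl. Qed.

Lemma dftZ k (c : C) f x : dft k (fun x => c * f x) x = c * dft k f x.
Proof.
by rewrite /dft mulrCA; congr (_ * _); rewrite mulr_sumr; apply: eq_bigr => y _; rewrite mulrA.
Qed.

Lemma dft_ext k f g : f =1 g -> dft k f =1 dft k g.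
Proof. by move=> E x; rewrite /dft; congr (_ * _); apply: eq_bigr => y _; rewrite E. Qed.

Lemma dftB k f g x : dft k (fun x => f x - g x) x = dft k f x - dft k g x.
Proof.
rewrite (@dft_ext _ _ (fun x => f x + (-1) * g x)) => [|y]; last by rewrite mulN1r.
by rewrite dftD dftZ mulN1r.
Qed.

Lemma dft_sum k I (r : seq I) (P : pred I) (F : I -> 'rV[R]_d -> C) x :
  dft k (fun x => \sum_(i <- r | P i) F i x) x = \sum_(i <- r | P i) dft k (F i) x.
Proof.
rewrite /dft -mulr_sumr exchange_big /=; congr (_ * _).
by apply: eq_bigr => y _; rewrite mulr_suml.
Qed.

(** A shift by one grid step permutes the grid cyclically; periodicity undoes the wrap-around of the
    index [2 * H] to 0. *)
Lemma dft_shift_sum (G : 'rV[R]_d -> C) l : Zperiodic G ->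
  \sum_y G (N%:R^-1 *: ev R l + dft_pt y) = \sum_y G (dft_pt y).
Proof.
move=> per.
pose sh (b : idx) : idx := [ffun j => if j == l then ordS (b j) else b j].
pose hs (b : idx) : idx := [ffun j => if j == l then ord_pred (b j) else b j].
have shK : cancel sh hs by move=> b; apply/ffunP => j; rewrite !ffunE; case: eqP => // _; rewrite ordSK.
have hsK : cancel hs sh by move=> b; apply/ffunP => j; rewrite !ffunE; case: eqP => // _; rewrite ord_predK.
rewrite [RHS](reindex sh); last by exists hs => b _.
apply: eq_bigr => y _.
have Np : (N%:R : R) != 0 by rewrite pnatr_eq0.
have [yN|yN] := eqVneq (y l : nat) (2 * H)%N.
  rewrite -(per (dft_pt (sh y)) l); congr G; apply/rowP => j; rewrite !mxE ffunE eqxx /=.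
  case: eqP => [->|_]; last by rewrite mulr0 add0r addr0.
  by rewrite /= yN modnn mul0r add0r mulr1 -[X in X + _]mul1r -mulrDl addrC natr1 mulfV.
congr G; apply/rowP => j; rewrite !mxE ffunE eqxx /=.
case: eqP => [->|_]; last by rewrite mulr0 add0r.
rewrite /= modn_small; first by rewrite mulr1 -[X in X + _]mul1r -mulrDl addrC natr1.
by have := ltn_ord (y l); rewrite !ltnS leq_eqVlt (negbTE yN).
Qed.

(** Frequencies congruent modulo [N] agree on grid vectors, so a grid shift acts on a component by
    an exact scalar. Differences of step [1/N] are thus diagonalized exactly, derivatives only
    approximately. *)
Lemma dft_shift k f l x : Zperiodic f ->
  dft k f (x + N%:R^-1 *: ev R l) = expc (zR (dft_freq k)) (N%:R^-1 *: ev R l) * dft k f x.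
Proof.
move=> per; rewrite /dft mulrCA; congr (_ * _).
pose G z := f (x + z) * expc (- zR (dft_freq k)) z.
have perG : Zperiodic G.
  move=> z j; rewrite /G addrA per; congr (_ * _).
  have -> : - zR (dft_freq k) = zR (- dft_freq k).
    by apply/rowP => i; rewrite !mxE mulrNz.
  exact: expc_sub_int.
rewrite -(dft_shift_sum l perG) mulr_sumr; apply: eq_bigr => y _.
rewrite /G expcD addrA -[LHS]mul1r -(expcNM (zR (dft_freq k)) (N%:R^-1 *: ev R l)); ring.
Qed.

Lemma dft_diff k f l x : Zperiodic f ->
  dft k (Cdiff l N%:R^-1 f) x = (expc (zR (dft_freq k)) (N%:R^-1 *: ev R l) - 1) * dft k f x.
Proof.
move=> per; rewrite /Cdiff dftB mulrBl mul1r -(dft_shift _ _ _ per); congr (_ - _).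
by rewrite /dft; congr (_ * _); apply: eq_bigr => y _; rewrite addrAC.
Qed.

(** An [r]-fold difference of step [1/N] multiplies the component by [(e1 (k_l / N) - 1) ^+ r],
    while it is at most [2 a N^-r]. Centred frequencies satisfy [|k_l / N| <= 1/2], so the chord
    bound applies; the powers of [N] cancel and the decay does not depend on the grid. *)
Lemma dft_high r (a : R) k f l x : Zperiodic f -> Cc r a f ->
  (2 * `|(dft_freq k 0 l)%:~R : R|) ^+ r * nc (dft k f x) <= 2 * a.
Proof.
move=> per Hf.
have Np : (0 : R) < N%:R by rewrite ltr0n.
have Nip : (0 : R) <= N%:R^-1 by rewrite invr_ge0 ltW.
have D : dft k (iter r (Cdiff l N%:R^-1) f) x =
   (expc (zR (dft_freq k)) (N%:R^-1 *: ev R l) - 1) ^+ r * dft k f x.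
  elim: r f per {Hf} => [|r IH] f per; first by rewrite expr0 mul1r.
  rewrite iterSr IH; last by move=> z j; rewrite /Cdiff addrAC !per.
  by rewrite dft_diff // mulrA exprSr.
have B : nc (dft k (iter r (Cdiff l N%:R^-1) f) x) <= 2 * (N%:R^-1 ^+ r * a).
  apply: dft_le; first by rewrite mulr_ge0 // mulr_ge0 ?exprn_ge0 //; exact: Cc_ge0 Hf.
  exact: Cc_diffn.
have fE : expc (zR (dft_freq k)) (N%:R^-1 *: ev R l) = e1 ((dft_freq k 0 l)%:~R / N%:R).
  rewrite expc_prod (bigD1 l) //= big1 ?mulr1 => [|j jl]; last first.
    by rewrite !mxE /= (negbTE jl) !mulr0 e10.
  by rewrite !mxE !eqxx mulr1.
have L : 2 * (`|(dft_freq k 0 l)%:~R : R| / N%:R) <= nc (e1 ((dft_freq k 0 l)%:~R / N%:R : R) - 1).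
  have -> : `|(dft_freq k 0 l)%:~R : R| / N%:R = `|(dft_freq k 0 l)%:~R / N%:R|.
    by rewrite normrM (ger0_norm Nip).
  apply: e1_lower; rewrite normrM (ger0_norm Nip) ler_pdivrMr // -intr_norm mxE.
  have : (2 * `|(k l)%:Z - H%:Z| <= N%:Z)%R by have := ltn_ord (k l); rewrite /N; lia.
  rewrite -(ler_int R) intrM -[2%:~R]/(2 : R) -[(N%:Z)%:~R]/(N%:R : R); lra.
move: B; rewrite D fE ncM ncX exprVn => B.
have Nr : (0 : R) < N%:R ^- r by rewrite invr_gt0 exprn_gt0.
rewrite -(ler_pM2l Nr) mulrA -exprVn -exprMn.
apply: (@le_trans _ _ (nc (e1 ((dft_freq k 0 l)%:~R / N%:R : R) - 1) ^+ r * nc (dft k f x))).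
  apply: ler_wpM2r; first exact: nc_ge0.
  apply: lerXn2r; rewrite ?nnegrE ?nc_ge0 ?mulr_ge0 //.
  by apply: le_trans L; rewrite mulrCA (mulrC `|_|).
by rewrite exprVn mulrCA.
Qed.

(** The derivative and the factor [2 pi i k_l] are both compared with a difference of step [1/N],
    which acts exactly. The two Taylor errors are quadratic in the step and lose one order on
    division by it; the constant 6 is 4 from the character plus 2 from [f]. *)
Lemma dft_partial (X a : R) k f l x : Zperiodic f -> 1 <= X ->
  (forall j, `|2 * pi * (dft_freq k 0 j)%:~R| <= X) -> Cc 2 a f ->
  nc (dft k (Cdir (ev R l) f) x - Complex 0 (2 * pi * (dft_freq k 0 l)%:~R) * dft k f x)
    <= 6 * X ^+ 2 * a / N%:R.
Proof.
move=> per X1 Xk Hf; have a0 := Cc_ge0 Hf.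
have Np : (0 : R) < N%:R by rewrite ltr0n.
set h : R := N%:R^-1; have hp : 0 < h by rewrite invr_gt0.
have h0 := ltW hp.
set E := expc (zR (dft_freq k)) (h *: ev R l).
set c := Complex 0 (2 * pi * (dft_freq k 0 l)%:~R).
have X1' : 1 <= X ^+ 2 by exact: exprn_ege1.
have TE : nc (E - 1 - Complex h 0 * c) <= 2 * (h ^+ 2 * X ^+ 2).
  have Xk' j : `|2 * pi * zR (dft_freq k) 0 j| <= X by rewrite mxE.
  have := Cc_taylor l 0 h0 (Cc_expc 2 X1 Xk').
  by rewrite (Cdir_expc _ _ _).2 phase_ev add0r expc0 mulr1 mxE.
pose t z := Cdiff l h f z - Complex h 0 * Cdir (ev R l) f z.
have Ht : nc (dft k t x) <= 2 * (h ^+ 2 * a).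
  apply: dft_le; first by rewrite !mulr_ge0 // exprn_ge0.
  move=> y; exact: Cc_taylor.
have tE : dft k t x = (E - 1) * dft k f x - Complex h 0 * dft k (Cdir (ev R l) f) x.
  by rewrite /t dftB dftZ -dft_diff.
have fk : nc (dft k f x) <= 2 * a by apply: dft_le => [|y]; [exact: mulr_ge0 | exact: (Cc_bound Hf)].
rewrite -(ler_pM2l hp) -[X in X * nc _](ger0_norm h0) -nc_real -ncM.
have -> : Complex h 0 * (dft k (Cdir (ev R l) f) x - c * dft k f x) =
   (E - 1 - Complex h 0 * c) * dft k f x - dft k t x by rewrite tE; ring.
apply: (le_trans (ncB _ _)); rewrite ncM.
apply: (@le_trans _ _ (2 * (h ^+ 2 * X ^+ 2) * (2 * a) + 2 * (h ^+ 2 * a))).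
  by apply: lerD => //; apply: ler_pM => //; exact: nc_ge0.
rewrite -/h.
have -> : h * (6 * X ^+ 2 * a * h) = 4 * (h ^+ 2 * a) * X ^+ 2 + 2 * (h ^+ 2 * a) * X ^+ 2 by ring.
apply: lerD; first by rewrite le_eqVlt; apply/orP; left; apply/eqP; ring.
by rewrite ler_peMr // !mulr_ge0 // exprn_ge0.
Qed.

(* Since [D_w f = mu f + g], a frequency at distance at least [eps] from [mu] carries little mass. *)
Lemma dft_nonresonant (w : 'rV[R]_d) (mu : C) (X a eps : R) k f g x : Zperiodic f -> 1 <= X ->
  (forall j, `|2 * pi * (dft_freq k 0 j)%:~R| <= X) -> (forall l, `|w 0 l| <= X) ->
  Cc 2 a f -> (forall z, Cdir w f z = mu * f z + g z) ->
  0 < eps -> eps <= `|Im mu - phase (zR (dft_freq k)) w| ->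
  nc (dft k f x) <= eps^-1 * (nc (dft k g x) + d%:R * (6 * X ^+ 3 * a / N%:R)).
Proof.
move=> per X1 Xk Xw Hf fE e0 He.
have a0 := Cc_ge0 Hf.
rewrite ler_pdivlMl //.
set r := \sum_l Complex (w 0 l) 0 * (dft k (Cdir (ev R l) f) x -
    Complex 0 (2 * pi * (dft_freq k 0 l)%:~R) * dft k f x).
have rE : r = (mu - Complex 0 (phase (zR (dft_freq k)) w)) * dft k f x + dft k g x.
  have E1 : dft k (Cdir w f) x = mu * dft k f x + dft k g x.
    by rewrite (dft_ext k fE) dftD dftZ.
  have E2 : dft k (Cdir w f) x = \sum_l Complex (w 0 l) 0 * dft k (Cdir (ev R l) f) x.
    rewrite (@dft_ext k _ (fun z => \sum_l Complex (w 0 l) 0 * Cdir (ev R l) f z)); last first.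
      by move=> y; exact: (Cdir_sum_coord y w Hf).
    by rewrite dft_sum; apply: eq_bigr => l _; rewrite dftZ.
  have E3 : Complex 0 (phase (zR (dft_freq k)) w) =
     \sum_l Complex (w 0 l) 0 * Complex 0 (2 * pi * (dft_freq k 0 l)%:~R) :> C.
    apply/eqP; rewrite eq_complex Re_sum Im_sum /= /phase mulr_sumr; apply/andP; split; apply/eqP.
      by rewrite big1 // => l _; rewrite mulr0 mul0r subr0.
    by apply: eq_bigr => l _; rewrite mul0r addr0 mxE; ring.
  rewrite /r mulrBl addrAC -E1 E2 E3 mulr_suml -sumrB; apply: eq_bigr => l _; ring.
have Hr : nc r <= d%:R * (6 * X ^+ 3 * a / N%:R).
  rewrite -[X in X%:R](card_ord d); apply: nc_sum_le => [|l _].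
    by rewrite !mulr_ge0 // ?exprn_ge0 //; lra.
  rewrite ncM nc_real.
  have -> : 6 * X ^+ 3 * a / N%:R = X * (6 * X ^+ 2 * a / N%:R) by ring.
  by apply: ler_pM => //; [exact: nc_ge0 | exact: dft_partial].
apply: (@le_trans _ _ (nc (r - dft k g x))); last first.
  by apply: (le_trans (ncB _ _)); rewrite addrC; apply: lerD.
rewrite rE addrK ncM; apply: ler_wpM2r; first exact: nc_ge0.
apply: (le_trans He); apply: le_trans (nc_Im _); by case: (mu).
Qed.

Lemma Cc_lip m (a : R) f x v : Cc m.+1 a f -> nc (f (v + x) - f x) <= (\sum_l `|v 0 l|) * (2 * a).
Proof.
move=> [h1 h2].
have L (g : 'rV[R]_d -> R) : Cb m.+1 a g -> `|g (v + x) - g x| <= (\sum_l `|v 0 l|) * a.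
  move=> Hg; have [t _ E] := MVT_line (fun z => (Cb_dir Hg z v).1) x 1.
  move: E; rewrite scale1r mul1r => ->; rewrite (Cb_dir Hg _ v).2 mulr_suml.
  apply: (le_trans (ler_norm_sum _ _ _)); apply: ler_sum => l _.
  by rewrite normrM; apply: ler_wpM2l => //; exact: (Cb_bound (Cb_partial l Hg)).
apply: (le_trans (nc_le _)); have := L _ h1; have := L _ h2.
case: (f (v + x)) => a1 b1; case: (f x) => a2 b2 /=; lra.
Qed.

(** Aliasing prevents a component from being exactly a character. Multiplied by the conjugate
    character it is however periodic for the finer lattice of step [1/N], so [x] can be replaced by
    a point [v] with coordinates in [[0, 1/N]], over which the component and the character vary by
    [O(1/N)]. *)
Lemma dft_mode (X a : R) k f x : Zperiodic f -> 1 <= X ->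
  (forall j, `|2 * pi * (dft_freq k 0 j)%:~R| <= X) -> Cc 1 a f ->
  nc (dft k f x - dft k f 0 * expc (zR (dft_freq k)) x) <= d%:R * (6 * X * a) / N%:R.
Proof.
move=> per X1 Xk Hf; have a0 := Cc_ge0 Hf.
have Np : (0 : R) < N%:R by rewrite ltr0n.
have Nn0 : (N%:R : R) != 0 by rewrite gt_eqF.
set z := zR (dft_freq k).
pose h x := expc (- z) x * dft k f x.
pose Q (u : 'rV[R]_d) := h (N%:R^-1 *: u).
have Qper : Zperiodic Q.
  move=> u l; rewrite /Q /h scalerDr dft_shift // expcD -/z.
  set b := expc z _; set b' := expc (- z) (_ *: ev R l).
  have bb : b' * b = 1 by exact: expcNM.
  by rewrite -[RHS]mul1r -bb; ring.
pose v := N%:R^-1 *: fracv (N%:R *: x).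
have hx : h x = h v.
  rewrite /v -/(Q _) (Zperiodic_int Qper (fun l => - Num.floor ((N%:R *: x) 0 l))) /Q.
  by rewrite scalerA mulVf // scale1r.
have vl : \sum_l `|v 0 l| <= d%:R * N%:R^-1.
  rewrite -[X in X%:R](card_ord d) mulr_natl -sumr_const; apply: ler_sum => l _.
  rewrite mxE normrM ger0_norm ?invr_ge0 ?ler0n // -[X in _ <= X]mulr1.
  by apply: ler_wpM2l; [rewrite invr_ge0 ler0n | rewrite ger0_norm; have /andP[] := fracv_bound (N%:R *: x) l].
have B1 : nc (dft k f v - dft k f 0) <= d%:R * N%:R^-1 * (2 * a).
  have -> : dft k f v - dft k f 0 = dft k (fun u => f (v + u) - f u) 0.
    rewrite dftB; congr (_ - _); rewrite /dft; congr (_ * _); apply: eq_bigr => y _.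
    by rewrite add0r.
  apply: dft_le => [|y]; first by rewrite !mulr_ge0 // invr_ge0.
  apply: (le_trans (Cc_lip y v Hf)); apply: ler_wpM2r => //; exact: mulr_ge0.
have B2 : nc (expc z v - 1) <= d%:R * N%:R^-1 * (2 * X).
  have Xk' j : `|2 * pi * z 0 j| <= X by rewrite mxE.
  have := Cc_lip 0 v (Cc_expc 1 X1 Xk'); rewrite addr0 expc0 expr1 => H'.
  by apply: (le_trans H'); apply: ler_wpM2r => //; apply: mulr_ge0 => //; lra.
have fk : nc (dft k f 0) <= 2 * a by apply: dft_le => [|y]; [exact: mulr_ge0 | exact: (Cc_bound Hf)].
have E1 : dft k f x - dft k f 0 * expc z x =
  expc z x * (expc (- z) v * ((dft k f v - dft k f 0) - dft k f 0 * (expc z v - 1))).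
  have hx' : dft k f x = expc z x * (expc (- z) v * dft k f v).
    by rewrite -/(h v) -hx /h mulrA (mulrC (expc z x)) expcNM mul1r.
  have ev1 := expcNM z v; rewrite hx'.
  rewrite -[X in _ - X]mulr1 -[X in _ - _ * X]ev1; ring.
rewrite E1 ncM nc_expc mul1r ncM nc_expc mul1r; apply: (le_trans (ncB _ _)); rewrite ncM.
apply: (@le_trans _ _ (d%:R * N%:R^-1 * (2 * a) + 2 * a * (d%:R * N%:R^-1 * (2 * X)))).
  by apply: lerD => //; apply: ler_pM => //; exact: nc_ge0.
set q := d%:R * N%:R^-1; have q0 : 0 <= q by rewrite mulr_ge0 // invr_ge0.
have -> : d%:R * (6 * X * a) / N%:R = q * (2 * a) * X + 2 * a * (q * (2 * X)) by rewrite /q; ring.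
by rewrite lerD2r ler_peMr // !mulr_ge0.
Qed.

End DFT.

(** * Block diagonalization with polynomial bounds *)

Section BlockDiag.
Variable R : realType.
Local Notation C := R[i].
Local Notation nc := (@normc R).
Variables (n : nat) (K : eqType) (key : 'I_n -> K).
Implicit Types (T P : 'M[C]_n).

(** Order of elimination: by distance from the diagonal, then by row. Clearing (i, j) alters only
    entries (a, j) with [a > i] and (i, b) with [b < j], all of higher rank. *)
Let rk (a b : 'I_n) := ((a - b) * n + a)%N.

Lemma rk_lt (a b a' b' : 'I_n) : (a - b < a' - b')%N -> (rk a b < rk a' b')%N.
Proof.
move=> h; rewrite /rk; have := ltn_ord a.
have : ((a - b).+1 * n <= (a' - b') * n)%N by rewrite leq_mul2r h orbT.
rewrite mulSn; move: ((a - b) * n)%N ((a' - b') * n)%N => p q; lia.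
Qed.

Lemma rk_ltl (i j a : 'I_n) : (j < i)%N -> (i < a)%N -> (rk i j < rk a j)%N.
Proof. by move=> *; apply: rk_lt; lia. Qed.

Lemma rk_ltr (i j b : 'I_n) : (j < i)%N -> (b < j)%N -> (rk i j < rk i b)%N.
Proof. by move=> *; apply: rk_lt; lia. Qed.

Lemma rk_inj (a b a' b' : 'I_n) : (b < a)%N -> (b' < a')%N -> rk a b = rk a' b' -> a = a' /\ b = b'.
Proof.
move=> h h' e; have [l|l|E] := ltngtP (a - b)%N (a' - b')%N.
- by have := rk_lt l; rewrite e ltnn.
- by have := rk_lt l; rewrite e ltnn.
move: e; rewrite /rk E => /addnI e; have ea : a = a' by exact/val_inj.
by split => //; apply/val_inj => /=; rewrite -ea in E h'; lia.
Qed.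

(* Conjugating by [1 + x E_ij] kills the entry (i, j) of a lower triangular matrix and
   otherwise only alters entries further away from the diagonal. *)
Lemma elim_step T (i j : 'I_n) (x : C) : (j < i)%N -> is_trig_mx T ->
  let E := delta_mx i j in
  (1%:M - x *: E) *m (1%:M + x *: E) = 1%:M /\
  forall a b, ((1%:M - x *: E) *m T *m (1%:M + x *: E)) a b =
    T a b + x * (T a i *+ (b == j)) - x * (T j b *+ (a == i)).
Proof.
move=> ji /is_trig_mxP tT E.
have nij : i != j by apply/eqP => e; rewrite e ltnn in ji.
have TE (M : 'M[C]_n) a b : (M *m E) a b = M a i *+ (b == j).
  rewrite mxE (bigD1 i) //= big1 => [|l li]; last by rewrite mxE (negbTE li) mulr0.
  by rewrite addr0 mxE eqxx /= eq_sym; case: eqP; rewrite ?mulr1 ?mulr0 // => ->; rewrite eqxx.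
have ET (M : 'M[C]_n) a b : (E *m M) a b = M j b *+ (a == i).
  rewrite mxE (bigD1 j) //= big1 => [|l lj]; last by rewrite mxE (negbTE lj) andbF mul0r.
  by rewrite addr0 mxE eqxx andbT; case: eqP; rewrite ?mul1r ?mul0r.
have EE : E *m E = 0.
  by apply/matrixP => a b; rewrite TE !mxE (negbTE nij) andbF mul0rn.
split.
  rewrite mulmxDr mulmx1 mulmxBl mul1mx -scalemxAr -scalemxAl EE !scaler0 subr0.
  by rewrite subrK.
move=> a b; rewrite mulmxDr mulmx1 mulmxBl mul1mx -scalemxAr mulmxBl -!scalemxAl scalerBr.
have -> : E *m T *m E = 0.
  apply/matrixP => a' b'; rewrite TE ET tT // mul0rn mul0rn mxE //.
rewrite !scaler0 subr0 -(TE T) -(ET T); set TE' := T *m E; set ET' := E *m T.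
by rewrite !mxE addrAC.
Qed.

(** The diagonal never changes, so the gaps assumed for [T] remain available at every step and only
    the sizes grow. A step at most raises the bound to its fifth power, whence [5 ^ t]. *)
Lemma block_diag_step (t : nat) T (X : R) : 2 <= X -> is_trig_mx T -> mb X T ->
  (forall a b, key a != key b -> X^-1 <= nc (T a a - T b b)) ->
  exists P P' T', [/\ P' *m P = 1%:M /\ P' *m T *m P = T', is_trig_mx T',
    forall a, T' a a = T a a,
    forall a b : 'I_n, (b < a)%N -> key a != key b -> (rk a b < t)%N -> T' a b = 0 &
    [/\ mb (X ^+ (5 ^ t)) P, mb (X ^+ (5 ^ t)) P' & mb (X ^+ (5 ^ t)) T']].
Proof.
move=> X2 tT bT Hk; elim: t => [|t [P [P' [T' [[PP PT] tT' dT' zT' [bP bP' bT']]]]]].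
  exists 1%:M, 1%:M, T; split => //; rewrite ?mulmx1 ?mul1mx //.
  rewrite expn0 expr1; split => //; apply: mb_le (@mb1 R n); lra.
have Y2 : 2 <= X ^+ (5 ^ t).
  by apply: (le_trans X2); rewrite -[X in X <= _]expr1; apply: leXX; [lra|rewrite expn_gt0].
have YS : X ^+ (5 ^ t.+1) = (X ^+ (5 ^ t)) ^+ 5 by rewrite expnSr exprM.
have XY : X <= X ^+ (5 ^ t).
  by rewrite -[X in X <= _]expr1; apply: leXX; [lra|rewrite expn_gt0].
set Y := X ^+ (5 ^ t) in Y2 YS XY bP bP' bT'.
have Y0 : 0 <= Y by lra.
have [[i j] /= /and3P[ji kij /eqP rij]|none] :=
  pickP (fun p : 'I_n * 'I_n => [&& (p.2 < p.1)%N, key p.1 != key p.2 & rk p.1 p.2 == t]); last first.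
  have YY : Y <= Y ^+ 5 by apply: ler_eXnr => //; lra.
  exists P, P', T'; split => // [a b ba kab|]; last first.
    by rewrite YS; split; [exact: mb_le bP|exact: mb_le bP'|exact: mb_le bT'].
  rewrite ltnS leq_eqVlt => /orP[/eqP e|]; last exact: zT'.
  by have := none (a, b); rewrite /= ba kab e eqxx.
have [Hlow] := (Hk _ _ kij).
(* The solution of [T'_ij + x T'_ii - x T'_jj = 0]. *)
pose x := T' i j / (T' j j - T' i i).
have D0 : T' j j - T' i i != 0.
  rewrite !dT' -nc_gt0 ncBC; apply: lt_le_trans Hlow; rewrite invr_gt0; lra.
have xb : nc x <= Y * X.
  rewrite /x ncM ncV; apply: ler_pM; rewrite ?nc_ge0 ?invr_ge0 ?nc_ge0 //.
  rewrite !dT' ncBC invf_ple ?posrE //; first by rewrite ncBC -nc_gt0 -!dT' // in D0 *.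
  lra.
have [QQ QT] := elim_step x ji tT'.
set E := delta_mx i j in QQ QT.
set T1 := (1%:M - x *: E) *m T' *m (1%:M + x *: E) in QT.
have bT1 : mb (Y + Y * X * Y + Y * X * Y) T1.
  have xY q (c : bool) : nc q <= Y -> nc (x * (q *+ c)) <= Y * X * Y.
    move=> qY; rewrite ncM; case: c; rewrite ?mulr1n ?mulr0n.
      by apply: ler_pM; rewrite ?nc_ge0.
    by rewrite nc0 mulr0 !mulr_ge0 //; lra.
  move=> a b; rewrite QT; apply: (le_trans (ncB _ _)); apply: lerD.
    by apply: (le_trans (ncD _ _)); apply: lerD; [exact: bT' | apply: xY; exact: bT'].
  by apply: xY; exact: bT'.
have bE (M : 'M[C]_n) : mb Y M -> mb (Y + Y * X * Y) (M *m (1%:M + x *: E)) /\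
    mb (Y + Y * X * Y) ((1%:M - x *: E) *m M).
  move=> bM.
  have P1 a b : nc (M a b) <= Y by exact: bM.
  have Y1 : 0 <= Y * X * Y by rewrite !mulr_ge0 //; lra.
  split=> a b.
    rewrite mulmxDr mulmx1 -scalemxAr mxE [X in _ + X]mxE; apply: (le_trans (ncD _ _)).
    apply: lerD => //; rewrite ncM mxE (bigD1 i) //= big1 => [|l li]; last by rewrite mxE (negbTE li) mulr0.
    rewrite addr0 mxE eqxx /=; apply: ler_pM; rewrite ?nc_ge0 //; case: (b == j); rewrite ?mulr1 // mulr0 nc0; lra.
  rewrite mulmxBl mul1mx -scalemxAl mxE [X in _ + X]mxE [X in _ - X]mxE; apply: (le_trans (ncB _ _)).
  apply: lerD => //; rewrite ncM mxE (bigD1 j) //= big1 => [|l lj]; last by rewrite mxE (negbTE lj) andbF mul0r.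
  rewrite addr0 mxE eqxx andbT; apply: ler_pM; rewrite ?nc_ge0 //; case: (a == i); rewrite ?mul1r // mul0r nc0; lra.
have big : Y + Y * X * Y + Y * X * Y <= Y ^+ 5.
  have Y3 : Y * X * Y <= Y ^+ 3.
    have -> : Y ^+ 3 = Y * Y * Y by ring.
    by apply: ler_wpM2r => //; apply: ler_wpM2l.
  have Y3' : Y <= Y ^+ 3 by apply: ler_eXnr => //; lra.
  have Y5 : 4 * Y ^+ 3 <= Y ^+ 5.
    have -> : Y ^+ 5 = Y * Y * Y ^+ 3 by ring.
    apply: ler_wpM2r; first exact: exprn_ge0.
    have : 2 * 2 <= Y * Y by apply: ler_pM.
    lra.
  have : 0 <= Y ^+ 3 by exact: exprn_ge0.
  lra.
have big' : Y + Y * X * Y <= Y ^+ 5.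
  by apply: le_trans big; rewrite lerDl !mulr_ge0 //; lra.
have tT1 : is_trig_mx T1.
  apply/is_trig_mxP => a b ab; rewrite QT; have tT'0 := is_trig_mxP tT'; rewrite (tT'0 a b ab).
  have -> : T' a i *+ (b == j) = 0.
    by case: eqP => // e; rewrite mulr1n; apply: tT'0; rewrite e in ab; exact: ltn_trans ji.
  have -> : T' j b *+ (a == i) = 0.
    by case: eqP => // e; rewrite mulr1n; apply: tT'0; rewrite e in ab; exact: ltn_trans ab.
  by rewrite !mulr0 addr0 subr0.
have dT1 a : T1 a a = T a a.
  rewrite QT -dT'; have Tji : T' j i = 0 by exact: (is_trig_mxP tT').
  have -> : T' a i *+ (a == j) = 0 by case: eqP => // ->; rewrite Tji.
  have -> : T' j a *+ (a == i) = 0 by case: eqP => // ->; rewrite Tji.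
  by rewrite !mulr0 addr0 subr0.
exists (P *m (1%:M + x *: E)), ((1%:M - x *: E) *m P'), T1; split => //.
- split; first by rewrite mulmxA -[_ *m P' *m P]mulmxA PP mulmx1; exact: QQ.
  by rewrite /T1 -PT !mulmxA.
- move=> a b ba kab; rewrite ltnS leq_eqVlt => /orP[/eqP e|rt].
    have [-> ->] : a = i /\ b = j by apply: rk_inj => //; rewrite e rij.
    rewrite QT !eqxx !mulr1n /x; move: D0; move: (T' j j) (T' i i) (T' i j) => p q r D0.
    by field.
  (* Entries cleared earlier stay zero: what would be added to them either lies above the diagonal
     and vanishes, or would give them a rank at least that of (i, j). *)
  rewrite QT (zT' _ _ ba kab rt) add0r.
  have -> : T' a i *+ (b == j) = 0.
    case: eqP => // e; rewrite mulr1n; rewrite e in ba rt *.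
    have [ai|ia|/val_inj ai] := ltngtP a i.
    - exact: (is_trig_mxP tT').
    - by have := ltn_trans (rk_ltl ji ia) rt; rewrite rij ltnn.
    - by move: rt; rewrite ai rij ltnn.
  have -> : T' j b *+ (a == i) = 0.
    case: eqP => // e; rewrite mulr1n; rewrite e in ba rt *.
    have [jb|bj|/val_inj jb] := ltngtP j b.
    - exact: (is_trig_mxP tT').
    - by have := ltn_trans (rk_ltr ji bj) rt; rewrite rij ltnn.
    - by move: rt; rewrite -jb rij ltnn.
  by rewrite !mulr0 subr0.
rewrite YS; split.
- by apply: mb_le big' _; exact: (bE _ bP).1.
- by apply: mb_le big' _; exact: (bE _ bP').2.
- exact: mb_le big bT1.
Qed.

Lemma block_diag T (X : R) : 2 <= X -> is_trig_mx T -> mb X T ->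
  (forall a b, key a != key b -> X^-1 <= nc (T a a - T b b)) ->
  exists P P' T', [/\ P' *m P = 1%:M /\ P' *m T *m P = T', is_trig_mx T',
    forall a, T' a a = T a a,
    forall a b, key a != key b -> T' a b = 0 &
    [/\ mb (X ^+ (5 ^ (n * n))) P, mb (X ^+ (5 ^ (n * n))) P' & mb (X ^+ (5 ^ (n * n))) T']].
Proof.
move=> X2 tT bT Hk; have [P [P' [T' [h1 h3 h4 h5 h6]]]] := block_diag_step (n * n) X2 tT bT Hk.
exists P, P', T'; split => // a b kab.
have [ab|ba|/val_inj e] := ltngtP a b; last by rewrite e eqxx in kab.
  exact: (is_trig_mxP h3).
apply: h5 => //; rewrite /rk; have an := ltn_ord a.
have : ((a - b).+1 * n <= n * n)%N by rewrite leq_mul2r; apply/orP; right; lia.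
rewrite mulSn; move: ((a - b) * n)%N (n * n)%N => p q; lia.
Qed.

End BlockDiag.

(** * Triangularization without loss, and a good point of the unit circle *)

Section SchurCircle.
Variable R : realType.
Local Notation C := R[i].
Local Notation nc := (@normc R).

Lemma schur_bounded n (B : 'M[C]_n) : (0 < n)%N ->
  exists P P' : 'M[C]_n, [/\ P' *m P = 1%:M, is_trig_mx (P' *m B *m P), mb 1 P & mb 1 P'].
Proof.
move=> n0; have [U Uu tU] := Schur B n0.
have uU := unitarymx_unit Uu.
have UU := unitarymxP Uu.
have bU : mb 1 U.
  move=> i j.
  have : \sum_k (U i k * (U i k)^* ) = 1.
    by move/matrixP: UU => /(_ i i); rewrite !mxE eqxx mulr1n => <-; apply: eq_bigr => k _; rewrite !mxE.
  move/(congr1 (@complex.Re R)); rewrite Re_sum /= => E.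
  have sq k : Re (U i k * (U i k)^* ) = nc (U i k) ^+ 2.
    rewrite ncE sqr_sqrtr ?addr_ge0 ?sqr_ge0 //.
    have -> : (U i k)^* = conjc (U i k) by [].
    by case: (U i k) => a b /=; rewrite mulrN opprK !expr2.
  have : nc (U i j) ^+ 2 <= 1.
    by rewrite -E (bigD1 j) //= sq lerDl; apply: sumr_ge0 => k _; rewrite sq sqr_ge0.
  by rewrite -[X in _ <= X](expr1n _ 2) ler_pXn2r ?nnegrE ?nc_ge0.
exists (invmx U), U; split => //.
- exact: mulmxV.
- by rewrite -conjumx.
- move=> i j; rewrite invmx_unitary // !mxE.
  have -> : (U j i)^* = conjc (U j i) by [].
  by rewrite nc_conj; exact: bU.
Qed.

Lemma e1_neq1 (t : R) : 0 < t < 1 -> e1 t != 1.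
Proof.
move=> /andP[t0 t1]; apply/eqP => z1.
have [t2|t2] := lerP t 2^-1.
  have := @e1_lower _ t; rewrite z1 subrr nc0 gtr0_norm // => /(_ t2) ?; lra.
have := @e1_lower _ (t - 1); have -> : e1 (t - 1) = 1 by rewrite e1D z1 mul1r e1N (e1_nat _ 1) conjc1.
rewrite subrr nc0 ltr0_norm ?subr_lt0 // => K; have ? := K ltac:(lra); lra.
Qed.

(* The average of [p(u) u^-n] over the (n+1)-st roots of unity is the leading coefficient. *)
Lemma circle_char_poly n (M : 'M[C]_n) : exists2 z : C, nc z = 1 & 1 <= nc (\det ((z * z)%:M + M)).
Proof.
pose p := char_poly (- M).
have pE u : p.[u] = \det (u%:M + M).
  rewrite /p /char_poly -[LHS]/(horner_eval u (\det (char_poly_mx (- M)))) -det_map_mx.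
  congr (\det _); apply/matrixP => i j; rewrite !mxE /= /horner_eval hornerD hornerN hornerC opprK.
  by case: (i == j); rewrite ?mulr1n ?mulr0n ?hornerX ?horner0.
pose m := n.+1; pose t : R := m%:R^-1.
have mt : m%:R * t = 1 by rewrite mulfV // pnatr_eq0.
have rho i : (0 < i < m)%N -> \sum_(j < m) (e1 t ^+ j) ^+ i = 0.
  move=> /andP[i0 im]; under eq_bigr => j _ do rewrite exprAC.
  have : (e1 t ^+ i - 1) * \sum_(j < m) (e1 t ^+ i) ^+ j = 0.
    by rewrite -subrX1 exprAC e1X mt (e1_nat _ 1) expr1n subrr.
  move/eqP; rewrite mulf_eq0 => /orP[|/eqP //]; rewrite subr_eq0 e1X => h.
  have := @e1_neq1 (i%:R * t); rewrite h => /(_ _)/negP; case => //.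
  by rewrite mulr_gt0 ?ltr0n ?invr_gt0 //= ltr_pdivrMr // mul1r ltr_nat.
(* The order [m = n.+1] gives [u = u^-n] for each root of unity [u], so multiplying by [e1 t ^+ j]
   is the announced division by an [n]-th power. *)
have S : \sum_(j < m) e1 t ^+ j * p.[e1 t ^+ j] = m%:R.
  have sp : size p = m by rewrite size_char_poly.
  under eq_bigr => j _ do rewrite horner_coef sp mulr_sumr.
  rewrite exchange_big /= big_ord_recr /=.
  rewrite big1 ?add0r => [|i _]; last first.
    under eq_bigr => j _ do rewrite mulrCA -exprS.
    by rewrite -mulr_sumr rho ?mulr0 //=; have := ltn_ord i; rewrite /m; lia.
  have pn : p`_n = 1 by have /monicP := char_poly_monic (- M); rewrite lead_coefE size_char_poly.
  under eq_bigr => j _ do rewrite pn mul1r -exprS exprAC e1X mt (e1_nat _ 1) expr1n.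
  by rewrite sumr_const card_ord.
have [j Hj] : exists j : 'I_m, 1 <= nc (p.[e1 t ^+ j]).
  apply/existsP; apply: contraT; rewrite negb_exists => /forallP H; exfalso.
  have : nc (\sum_(j < m) e1 t ^+ j * p.[e1 t ^+ j]) < m%:R.
    apply: (le_lt_trans (nc_sum _ _ _)).
    rewrite -[X in _ < X%:R](card_ord m) -sumr_const; apply: ltr_sum => [|j _].
      by apply/hasP; exists ord0 => //; rewrite mem_index_enum.
    by rewrite ncM ncX nc_e1 expr1n mul1r ltNge H.
  by rewrite S nc_nat ltxx.
(* Half the angle gives a square root on the circle. A square is wanted because factoring [conj(z)]
   out of [z + conj(z) M] leaves [z z + M]. *)
exists (e1 (j%:R * t / 2)); first exact: nc_e1.
have -> : e1 (j%:R * t / 2) * e1 (j%:R * t / 2) = e1 t ^+ j.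
  by rewrite -e1D e1X; congr e1; field.
by rewrite -pE.
Qed.

End SchurCircle.

(** * Resonances *)

Section ResonanceLabels.
Variables (R : realType) (d : nat) (w : 'rV[R]_d).
Implicit Types (k : 'rV[int]_d).

Definition kdot k : R := \sum_i (k 0 i)%:~R * w 0 i.

Lemma kdotD k k' : kdot (k + k') = kdot k + kdot k'.
Proof. by rewrite -big_split; apply: eq_bigr => i _; rewrite mxE intrD mulrDl. Qed.
Lemma kdotN k : kdot (- k) = - kdot k.
Proof. by rewrite -sumrN; apply: eq_bigr => i _; rewrite mxE mulrNz mulNr. Qed.
Lemma knormD k k' : knorm (k + k') <= knorm k + knorm k'.
Proof. by rewrite -big_split; apply: ler_sum => i _; rewrite mxE; exact: ler_normD. Qed.
Lemma knormN k : knorm (- k) = knorm k.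
Proof. by apply: eq_bigr => i _; rewrite mxE normrN. Qed.
Lemma knorm0 : knorm (0 : 'rV[int]_d) = 0.
Proof. by apply: big1 => i _; rewrite mxE normr0. Qed.
Lemma knorm_ge k l : `|k 0 l| <= knorm k.
Proof. by rewrite /knorm (bigD1 l) //= lerDl; apply: sumr_ge0. Qed.

(** Since [knorm k >= 1], the real exponent [tau] can be raised to the natural number [t], which
    keeps later bounds among integer powers. *)
Lemma DC_lower (kappa tau : R) (t L : nat) k : 0 < kappa -> tau <= t%:R -> (1 <= L)%N -> DC w kappa tau ->
  k != 0 -> knorm k <= L%:Z -> kappa / L%:R ^+ t <= `|kdot k|.
Proof.
move=> kp tt L1 hw k0 kL; apply: le_trans (hw k k0); apply: ler_wpM2l; first exact: ltW.
have k1 : (1 : R) <= (knorm k)%:~R.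
  have : 1 <= knorm k.
    have [l kl] : exists l, k 0 l != 0.
      apply/existsP; apply: contraT; rewrite negb_exists => /forallP H; exfalso.
      by case/eqP: k0; apply/rowP => l; have := H l; rewrite negbK mxE => /eqP.
    by apply: le_trans (knorm_ge k l); move: kl; lia.
  by rewrite -(ler_int R).
have kL' : ((knorm k)%:~R : R) <= L%:R by rewrite -[L%:R]/((L%:Z)%:~R) ler_int.
have L0 : (0 : R) < L%:R by rewrite ltr0n.
have q0 : (0 : R) < (knorm k)%:~R by lra.
rewrite powRN lef_pV2 ?posrE ?exprn_gt0 ?powR_gt0 //.
apply: (@le_trans _ _ ((knorm k)%:~R `^ t%:R)); first by apply: ler_powR.
by rewrite powR_mulrn; [apply: lerXn2r; rewrite ?nnegrE //; lra | lra].
Qed.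

Definition sgnv (V : zmodType) (s : bool) (x : V) := if s then - x else x.

Variables (n : nat) (b : 'I_n -> R).

(** With [s = true] this is a resonance of the entry (i, j) of the defect of reality; with
    [s = false] and [k = 0] two exponents almost coincide. The other cases arise by composition: the
    maps [x |-> +-x + 2 <k, w>] form a group, which makes the relation symmetric, and transitive up
    to losses in [L] and [eps]. *)
Definition resonant (L : nat) (eps : R) (i j : 'I_n) :=
  exists s k, knorm k <= L%:Z /\ `|b i - (sgnv s (b j) + 2 * kdot k)| <= eps.

Lemma resonant_sym L eps i j : resonant L eps i j -> resonant L eps j i.
Proof.
move=> [[] [k [kL H]]].
  exists true, k; split => //; rewrite /= in H *.
  by have -> : b j - (- b i + 2 * kdot k) = b i - (- b j + 2 * kdot k) by ring.
exists false, (- k); rewrite knormN kdotN; split => //; rewrite /= in H *.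
by rewrite -normrN; have -> : - (b j - (b i + 2 * - kdot k)) = b i - (b j + 2 * kdot k) by ring.
Qed.

Lemma resonant_trans L L' eps eps' i j m : resonant L eps i j -> resonant L' eps' j m ->
  resonant (L + L') (eps + eps') i m.
Proof.
move=> [s [k [kL H]]] [s' [k' [kL' H']]].
exists (s (+) s'), (k + sgnv s k'); split.
  apply: (le_trans (knormD _ _)); rewrite PoszD; apply: lerD => //.
  by case: s {H} => //=; rewrite knormN.
apply: le_trans (lerD H H'); rewrite kdotD.
have -> : b i - (sgnv (s (+) s') (b m) + 2 * (kdot k + kdot (sgnv s k'))) =
  (b i - (sgnv s (b j) + 2 * kdot k)) + sgnv s (b j - (sgnv s' (b m) + 2 * kdot k')).
  by case: s {H}; case: s' {H'}; rewrite /= ?kdotN; ring.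
by apply: (le_trans (ler_normD _ _)); case: s {H} => //=; rewrite normrN.
Qed.

Variables (K : nat) (eps : R).
Hypothesis eps0 : 0 <= eps.
Hypothesis nonres : forall k, k != 0 -> knorm k <= ((2 * (2 * n + 1)) * K)%:Z -> (2 * n + 1)%:R * eps < `|kdot k|.

Let e : rel 'I_n := fun i j => `[< resonant K eps i j >].

Lemma resonant_path p i : path e i p -> resonant (size p * K) ((size p)%:R * eps) i (last i p).
Proof.
elim: p i => [|j p IH] i /=.
  move=> _; exists false, 0; rewrite knorm0 mul0n mul0r; split => //=.
  have -> : kdot 0 = 0 by apply: big1 => l _; rewrite mxE mul0r.
  by rewrite mulr0 addr0 subrr normr0.
move=> /andP[/asboolP ij /IH jp]; rewrite mulSn -natr1 mulrDl mul1r addrC.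
exact: resonant_trans jp.
Qed.

Lemma resonantW L L' e1 e2 i j : (L <= L')%N -> e1 <= e2 -> resonant L e1 i j -> resonant L' e2 i j.
Proof.
move=> LL ee [s [k [kL H]]]; exists s, k; split; first by apply: (le_trans kL); rewrite lez_nat.
exact: le_trans ee.
Qed.

(** Shortening the path to one without repetition caps its length by [n], hence also the accumulated
    frequency and error. *)
Lemma resonant_connect i j : connect e i j -> resonant (n * K) (n%:R * eps) i j.
Proof.
move=> /connectP[p ep ->]; case/shortenP: ep => p' ep' up' _.
have sp : (size p' <= n)%N.
  by have := max_card (mem (i :: p')); rewrite card_ord (card_uniqP up') /=; exact: ltnW.
apply: resonantW (resonant_path ep'); first by rewrite leq_mul2r sp orbT.
by apply: ler_wpM2r => //; rewrite ler_nat.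
Qed.

Lemma e_sym : connect_sym e.
Proof.
apply: sym_connect_sym => i j; apply/asboolP/asboolP; exact: resonant_sym.
Qed.

(* Along a connected component all [b i] are images of the value [b r] at the root under
   [x |-> +-x + 2<k,w>]; if a reflection almost fixes [b r], then [b r] is close to some [<k,w>],
   with [k] unique by the Diophantine condition, and otherwise the label of the root is free. *)
Lemma resonance_labels : exists kk : 'I_n -> 'rV[int]_d,
  (forall i, knorm (kk i) <= ((4 * n + 1) * K)%:Z) /\
  forall i j s k, knorm k <= K%:Z -> `|b i - (sgnv s (b j) + 2 * kdot k)| <= eps ->
    kk i = sgnv s (kk j) + k *+ 2.
Proof.
(* The reflection [x |-> -x + 2 <k, w>] almost fixes [b r]. The factor [2 n + 1] leaves room for two
   routes to the root, each of length at most [n], and one further resonance. *)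
pose near_root r k := knorm k <= ((2 * n + 1) * K)%:Z /\ `|2 * b r - 2 * kdot k| <= (2 * n + 1)%:R * eps.
have zx r : exists x, knorm x <= ((2 * n + 1) * K)%:Z /\ forall k, near_root r k -> k = x.
  have [[x nx]|no] := pselect (exists x, near_root r x); last first.
    by exists 0; rewrite knorm0; split => // k nk; case: no; exists k.
  exists x; split; first by case: nx.
  move=> k [k1 k2]; case: nx => [x1 x2].
  apply/eqP; rewrite -subr_eq0; apply: contraT => kx0.
  have kxn : knorm (k - x) <= ((2 * (2 * n + 1)) * K)%:Z.
    apply: (le_trans (knormD _ _)); rewrite knormN; move: k1 x1.
    have -> : (2 * (2 * n + 1) * K = (2 * n + 1) * K + (2 * n + 1) * K)%N by lia.
    by rewrite PoszD => ? ?; apply: lerD.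
  have := nonres kx0 kxn; rewrite kdotD kdotN ltNge => /negP; case.
  have : `|(2 * b r - 2 * kdot x) - (2 * b r - 2 * kdot k)| <= (2 * n + 1)%:R * eps + (2 * n + 1)%:R * eps.
    by apply: (le_trans (ler_normB _ _)); apply: lerD.
  have -> : (2 * b r - 2 * kdot x) - (2 * b r - 2 * kdot k) = 2 * (kdot k - kdot x) by ring.
  rewrite normrM ger0_norm //; lra.
pose x r := projT1 (cid (zx r)).
have xP r : knorm (x r) <= ((2 * n + 1) * K)%:Z /\ forall k, near_root r k -> k = x r.
  exact: (projT2 (cid (zx r))).
have P i : exists g : bool * 'rV[int]_d, knorm g.2 <= (n * K)%:Z /\
    `|b i - (sgnv g.1 (b (fingraph.root e i)) + 2 * kdot g.2)| <= n%:R * eps.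
  by have [s [k H]] := resonant_connect (connect_root e i); exists (s, k).
pose g i := projT1 (cid (P i)).
have gP i : knorm (g i).2 <= (n * K)%:Z /\
    `|b i - (sgnv (g i).1 (b (fingraph.root e i)) + 2 * kdot (g i).2)| <= n%:R * eps.
  exact: (projT2 (cid (P i))).
(* [b i] is close to [+-b r + 2 <g, w>]; when [b r] is close to [<x r, w>], this is close to
   [<kk i, w>]. *)
exists (fun i => sgnv (g i).1 (x (fingraph.root e i)) + (g i).2 *+ 2); split.
  move=> i; have [x1 _] := xP (fingraph.root e i); have [g1 _] := gP i.
  apply: (le_trans (knormD _ _)).
  have : knorm (sgnv (g i).1 (x (fingraph.root e i))) <= ((2 * n + 1) * K)%:Z by case: (g i).1; rewrite /= ?knormN.
  have : knorm ((g i).2 *+ 2) <= (n * K)%:Z + (n * K)%:Z.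
    by rewrite mulr2n; apply: (le_trans (knormD _ _)); apply: lerD.
  have -> : ((4 * n + 1) * K = (2 * n + 1) * K + (n * K + n * K))%N by lia.
  by rewrite !PoszD => h1 h2; exact: lerD.
move=> i j s k kK H.
have rij : fingraph.root e j = fingraph.root e i.
  apply/eqP; rewrite eq_sym root_connect; last exact: e_sym.
  by apply: connect1; apply/asboolP; exists s, k.
have [gi1 gi2] := gP i; have [gj1 gj2] := gP j; have [x1 x2] := xP (fingraph.root e i).
move: gj2; rewrite rij; move: (fingraph.root e i) x1 x2 gi2 gj1 gi1 => r.
move: (x r) (g i) (g j) => q [si ki] [sj kj] /= q1 q2 gi2 gj1 gi1 gj2.
have nrm : knorm (sgnv s kj + k - ki) <= ((2 * n + 1) * K)%:Z.
  apply: (le_trans (knormD _ _)); rewrite knormN.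
  have : knorm (sgnv s kj + k) <= (n * K)%:Z + K%:Z.
    by apply: (le_trans (knormD _ _)); apply: lerD => //; case: (s); rewrite /= ?knormN.
  have -> : ((2 * n + 1) * K = n * K + K + n * K)%N by lia.
  by rewrite !PoszD => ?; apply: lerD.
have tot : `|sgnv si (b r) - sgnv s (sgnv sj (b r)) - 2 * kdot (sgnv s kj + k - ki)| <= (2 * n + 1)%:R * eps.
  have -> : sgnv si (b r) - sgnv s (sgnv sj (b r)) - 2 * kdot (sgnv s kj + k - ki) =
    (b i - (sgnv s (b j) + 2 * kdot k)) - (b i - (sgnv si (b r) + 2 * kdot ki))
     + sgnv s (b j - (sgnv sj (b r) + 2 * kdot kj)).
    by rewrite !kdotD kdotN; case: (s); case: (si); case: (sj); rewrite /= ?kdotN; ring.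
  have -> : (2 * n + 1)%:R * eps = (eps + n%:R * eps) + n%:R * eps by rewrite natrD natrM; ring.
  apply: (le_trans (ler_normD _ _)); apply: lerD.
    by apply: (le_trans (ler_normB _ _)); apply: lerD.
  by case: (s); rewrite /= ?normrN.
(* Two routes from [i] to the root are compared, the direct one and the one through [j]. With equal
   orientations they differ by an almost trivial translation, trivial by [nonres]; with opposite
   ones they produce a reflection almost fixing [b r], whose frequency must be the one recorded at
   the root. *)
have [E|E] := eqVneq si (s (+) sj).
  have Z : sgnv s kj + k - ki = 0.
    apply/eqP; apply: contraT => Z0; exfalso.
    have nrm' : knorm (sgnv s kj + k - ki) <= ((2 * (2 * n + 1)) * K)%:Z.
      by apply: (le_trans nrm); rewrite lez_nat -mulnA leq_pmull.
    have := nonres Z0 nrm'; rewrite ltNge => /negP; case.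
    move: tot; rewrite E; have -> : sgnv (s (+) sj) (b r) - sgnv s (sgnv sj (b r)) = 0.
      by case: (s); case: (sj); rewrite /=; ring.
    rewrite sub0r normrN normrM ger0_norm // => h.
    by have := normr_ge0 (kdot (sgnv s kj + k - ki)); lra.
  have -> : ki = sgnv s kj + k by apply/eqP; rewrite eq_sym -subr_eq0 Z.
  rewrite E; apply/rowP => l; case: (s); case: (sj); rewrite /= !mulr2n !mxE; ring.
have Q : sgnv si (sgnv s kj + k - ki) = q.
  apply: q2; split; first by case: (si); rewrite /= ?knormN.
  apply: le_trans tot.
  have -> : 2 * b r - 2 * kdot (sgnv si (sgnv s kj + k - ki)) =
    sgnv si (sgnv si (b r) - sgnv s (sgnv sj (b r)) - 2 * kdot (sgnv s kj + k - ki)).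
    by move: E; case: (s); case: (si); case: (sj) => //= _; rewrite ?kdotN; ring.
  by case: (si); rewrite /= ?normrN.
rewrite -Q; apply/rowP => l; move: E; case: (s); case: (si); case: (sj) => //= _; rewrite !mulr2n !mxE; ring.
Qed.

End ResonanceLabels.

(** * Fourier modes of a solution of the triangular linear equation *)

Section Modes.
Variables (R : realType) (d H : nat).
Local Notation C := R[i].
Local Notation nc := (@normc R).
Let N := (2 * H).+1.
Local Notation idx := {ffun 'I_d -> 'I_N}.

Lemma low_count (K : nat) : (#|[pred k : idx | [forall l, (`|dft_freq k 0 l| <= K%:Z)%R]]| <= (2 * K).+1 ^ d)%N.
Proof.
pose A : pred 'I_N := [pred m : 'I_N | `|(m : nat)%:Z - H%:Z| <= K%:Z].
rewrite (eq_card (B := mem (ffun_on A))); last first.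
  move=> k; rewrite !inE; apply/forallP/ffun_onP => h l; have := h l; by rewrite ?inE mxE.
rewrite card_ffun_on card_ord; case: (d) => [|d']; first by rewrite !expn0.
rewrite leq_exp2r //.
pose f (c : 'I_(2 * K).+1) : 'I_N := inord (c + (H - K)).
have sub : A \subset codom f.
  apply/fintype.subsetP => m; rewrite inE => mA; have mN := ltn_ord m.
  have cK : (m - (H - K) < (2 * K).+1)%N by move: mA; rewrite /N in mN; lia.
  have mE : (m - (H - K) + (H - K) = m :> nat)%N by apply: subnK; move: mA; lia.
  by apply/codomP; exists (Ordinal cK); apply/val_inj; rewrite /f /= mE inord_val.
apply: (leq_trans (subset_leq_card sub)); apply: (leq_trans (leq_image_card _ _)).
by rewrite card_ord.
Qed.

(** The low frequencies outside [S] are bounded by [eta] one by one, but there are at most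
    [(2 K + 1)^d] of them; the high ones may fill the grid, but each decays like [K^-r]. Counting
    them separately allows a grid much finer than the cutoff. *)
Lemma dft_reconstruct_low (S : pred idx) r (K : nat) (a eta : R) (f : 'rV[R]_d -> C) x : Zperiodic f -> Cc r a f ->
  (0 < K)%N -> 0 <= eta ->
  (forall k, ~~ S k -> (forall l, `|dft_freq k 0 l| <= K%:Z) -> nc (dft k f x) <= eta) ->
  nc (f x - \sum_(k | S k) dft k f x) <= (2 * K).+1%:R ^+ d * eta + N%:R ^+ d * (2 * a / K%:R ^+ r).
Proof.
move=> per Hf K0 eta0 Hlow; have a0 := Cc_ge0 Hf.
have Kp : (0 : R) < K%:R ^+ r by rewrite exprn_gt0 // ltr0n.
have q0 : 0 <= 2 * a / K%:R ^+ r by rewrite !mulr_ge0 // invr_ge0 ltW.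
rewrite [X in nc (X - _)](dft_inv H) (bigID S) /= addrAC subrr add0r.
pose low (k : idx) := [forall l, `|dft_freq k 0 l| <= K%:Z].
rewrite (bigID low) /=; apply: (le_trans (ncD _ _)); apply: lerD.
  apply: (le_trans (nc_sum _ _ _)).
  apply: (@le_trans _ _ (\sum_(k : idx | low k) eta)).
    rewrite big_mkcond [X in _ <= X]big_mkcond; apply: ler_sum => k _.
    case: ifP => [/andP[Sk lk]|_]; last by case: ifP.
    by rewrite lk; apply: Hlow => //; exact/forallP.
  rewrite sumr_const -[X in X <= _]mulr_natl; apply: ler_wpM2r => //.
  by rewrite -natrX ler_nat; exact: low_count.
have -> : (N%:R ^+ d : R) = #|{: idx}|%:R by rewrite card_ffun !card_ord natrX.
apply: nc_sum_le => // k /andP[Sk]; rewrite negb_forall => /existsP[l]; rewrite -ltNge => Kl.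
rewrite ler_pdivlMr // mulrC; apply: le_trans (dft_high k l x per Hf).
apply: ler_wpM2r; first exact: nc_ge0.
have : (K%:R : R) <= `|(dft_freq k 0 l)%:~R|.
  by rewrite -intr_norm -[K%:R]/((K%:Z)%:~R) ler_int ltW.
move=> h; apply: lerXn2r; rewrite ?nnegrE ?mulr_ge0 //.
by apply: le_trans h _; rewrite ler_peMl //; lra.
Qed.

Variables (n : nat) (w : 'rV[R]_d) (kk : 'I_n -> 'rV[int]_d).
Variables (T : 'M[C]_n) (W G : 'rV[R]_d -> 'M[C]_n).
Variables (K r : nat) (X a tb eps eg : R).
Hypothesis perW : Zperiodic W.
Hypothesis CW : Cm r.+2 a W.
Hypothesis trigT : is_trig_mx T.
Hypothesis blockT : forall i j, kk i != kk j -> T i j = 0.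
Hypothesis bT : mb tb T.
Hypothesis bG : forall x, mb eg (G x).
Hypothesis eqW : forall x, mx_dir w W x = map_mx conjc T *m W x - W x *m T + G x.
Hypotheses (X1 : 1 <= X) (tb0 : 0 <= tb) (eg0 : 0 <= eg) (e0 : 0 < eps) (K0 : (0 < K)%N) (a0 : 0 <= a).
Hypothesis Xw : forall l, `|w 0 l| <= X.
Hypothesis XK : 2 * pi * K%:R <= X.
Hypothesis Xkk : forall i l, 2 * pi * `|(kk i 0 l)%:~R| <= X.
Hypothesis separated : forall i j (k : 'rV[int]_d), (forall l, `|k 0 l| <= K%:Z) -> k *+ 2 != kk i + kk j ->
  eps <= `|- (Im (T i i) + Im (T j j)) - phase (zR R k) w|.

Let E := d%:R * (6 * X ^+ 3 * a / N%:R).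
Let Y := 1 + eps^-1 * (2 * n%:R * tb + 1).

Lemma perWij i j : Zperiodic (fun x => W x i j).
Proof. by move=> x l; rewrite perW. Qed.

Lemma measure_ltl (l i j : 'I_n) s : (l < i)%N -> (i + (n - j) < s.+1)%N -> (l + (n - j) < s)%N.
Proof. by move=> h; rewrite ltnS; apply: leq_trans; rewrite ltn_add2r. Qed.

Lemma measure_ltr (l i j : 'I_n) s : (j < l)%N -> (i + (n - j) < s.+1)%N -> (i + (n - l) < s)%N.
Proof.
move=> h; rewrite ltnS; apply: leq_trans; rewrite ltn_add2l; apply: ltn_sub2l => //.
Qed.

(** A lower triangular [T] couples the entry (i, j) only to (l, j) with [l < i] and to (i, l) with
    [l > j], so [i + (n - j)] drops. Coupled entries also have the same sum of labels by [blockT],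
    hence the same non-resonance at [k]. Each step costs one factor [Y], essentially [tb / eps]. *)
Lemma mode_small s (i j : 'I_n) (k : idx) (x : 'rV[R]_d) : (i + (n - j) < s)%N ->
  (forall l, `|dft_freq k 0 l| <= K%:Z) -> dft_freq k *+ 2 != kk i + kk j ->
  nc (dft k (fun x => W x i j) x) <= Y ^+ s * (eg + E).
Proof.
move=> sij low nr.
have X0 : 0 <= X by exact: le_trans ler01 X1.
have E0 : 0 <= E by rewrite /E !mulr_ge0 // ?invr_ge0 ?ler0n // exprn_ge0.
have ei0 : 0 <= eps^-1 by rewrite invr_ge0 ltW.
have Y1 : 1 <= Y by rewrite lerDl !mulr_ge0 // addr_ge0 // !mulr_ge0.
have Y0 : 0 <= Y by exact: le_trans ler01 Y1.
elim: s i j sij nr => // s IH i j sij nr.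
(* Conjugation turns the difference of imaginary parts into minus their sum, which is why labels are
   added and not subtracted. *)
pose mu := conjc (T i i) - T j j.
pose g x := (\sum_(l | l != i) conjc (T i l) * W x l j - \sum_(l | l != j) T l j * W x i l) + G x i j.
have fE z : Cdir w (fun x => W x i j) z = mu * W z i j + g z.
  have := congr1 (fun M : 'M[C]_n => M i j) (eqW z); rewrite mx_dirE mxE => ->.
  have s1 : (map_mx conjc T *m W z) i j = conjc (T i i) * W z i j + \sum_(l | l != i) conjc (T i l) * W z l j.
    rewrite mxE (bigD1 i) //= mxE; congr (_ + _).
    by apply: eq_bigr => l _; rewrite mxE.
  have s2 : (W z *m T) i j = T j j * W z i j + \sum_(l | l != j) T l j * W z i l.
    rewrite mxE (bigD1 j) //= mulrC; congr (_ + _).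
    by apply: eq_bigr => l _; rewrite mulrC.
  rewrite mxE [X in X + _]mxE s1 [X in _ + X + _]mxE s2 /g /mu; ring.
have Yse : 0 <= Y ^+ s * (eg + E) by apply: mulr_ge0; [exact: exprn_ge0 | exact: addr_ge0].
have gk : nc (dft k g x) <= 2 * n%:R * tb * (Y ^+ s * (eg + E)) + eg.
  rewrite /g dftD dftB; apply: (le_trans (ncD _ _)); apply: lerD; last first.
    by apply: dft_le => // z; exact: bG.
  have -> : 2 * n%:R * tb * (Y ^+ s * (eg + E)) =
      n%:R * (tb * (Y ^+ s * (eg + E))) + n%:R * (tb * (Y ^+ s * (eg + E))) by ring.
  apply: (le_trans (ncB _ _)); rewrite !dft_sum.
  have Z0 : 0 <= tb * (Y ^+ s * (eg + E)) by exact: mulr_ge0.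
  apply: lerD; rewrite -[X in _ <= X%:R * _](card_ord n); apply: nc_sum_le => // l li; rewrite dftZ ncM ?nc_conj.
    have [kil|kil] := eqVneq (kk i) (kk l); last by rewrite (blockT kil) nc0 mul0r.
    have [il|il|/val_inj e] := ltngtP i l; last by rewrite e eqxx in li.
      by rewrite (is_trig_mxP trigT _ _ il) nc0 mul0r.
    apply: ler_pM; rewrite ?nc_ge0 //; apply: IH; first exact: measure_ltl sij.
    by rewrite -kil.
  have [kil|kil] := eqVneq (kk l) (kk j); last by rewrite (blockT kil) nc0 mul0r.
  have [lj|lj|/val_inj e] := ltngtP l j; last by rewrite e eqxx in li.
    by rewrite (is_trig_mxP trigT _ _ lj) nc0 mul0r.
  apply: ler_pM; rewrite ?nc_ge0 //; apply: IH; last by rewrite kil.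
  exact: measure_ltr sij.
have Xk l : `|2 * pi * (dft_freq k 0 l)%:~R| <= X.
  apply: le_trans XK; rewrite normrM ger0_norm ?mulr_ge0 ?pi_ge0 //; apply: ler_wpM2l; first by rewrite mulr_ge0 ?pi_ge0.
  by rewrite -intr_norm -[K%:R]/((K%:Z)%:~R) ler_int.
have He : eps <= `|Im mu - phase (zR R (dft_freq k)) w|.
  have -> : Im mu = - (Im (T i i) + Im (T j j)).
    by rewrite /mu; case: (T i i) => ? ?; case: (T j j) => ? ? /=; ring.
  exact: separated.
have C2 : Cc 2 a (fun x => W x i j) by apply: CcW (CW i j).
have := dft_nonresonant x (perWij i j) X1 Xk Xw C2 fE e0 He.
move=> h; apply: (le_trans h); rewrite -/E.
set q := Y ^+ s * (eg + E) in Yse gk *.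
have qE : eg + E <= q by rewrite /q ler_peMl ?addr_ge0 //; exact: exprn_ege1.
apply: (@le_trans _ _ (eps^-1 * ((2 * n%:R * tb + 1) * q))).
  apply: ler_wpM2l => //; rewrite mulrDl mul1r.
  by move: gk qE; move: (2 * n%:R * tb * q) => u; lra.
have -> : Y ^+ s.+1 * (eg + E) = Y * q by rewrite /q exprS mulrA.
by rewrite mulrA; apply: ler_wpM2r => //; rewrite /Y lerDr.
Qed.

Lemma dft_freq_inj : injective (@dft_freq d H).
Proof.
move=> k k' e; apply/ffunP => l; apply/val_inj; have := congr1 (fun v : 'rV[int]_d => v 0 l) e.
by rewrite !mxE => /addIr [].
Qed.

Lemma double_inj (a' b' : int) : a' + a' = b' + b' -> a' = b'.
Proof. clear; lia. Qed.

Let err := (2 * K).+1%:R ^+ d * (Y ^+ (2 * n) * (eg + E)) + N%:R ^+ d * (2 * a / K%:R ^+ r.+2).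

(** Doubling is injective on integer vectors, so at most one grid frequency is resonant. Its
    coefficient is replaced by the value of the entry at 0, which costs the second [err]. Without a
    resonant frequency, for instance when [kk i + kk j] has an odd coordinate, the whole entry is
    negligible. *)
Lemma mode_dichotomy (i j : 'I_n) :
  (exists2 k : 'rV[int]_d, k *+ 2 = kk i + kk j &
     forall x, nc (W x i j - W 0 i j * expc (zR R k) x) <= 2 * err + E) \/
  (forall x, nc (W x i j) <= err).
Proof.
have X0 : 0 <= X by exact: le_trans ler01 X1.
have E0 : 0 <= E by rewrite /E !mulr_ge0 // ?invr_ge0 ?ler0n // exprn_ge0.
have ei0 : 0 <= eps^-1 by rewrite invr_ge0 ltW.
have Y1 : 1 <= Y by rewrite lerDl !mulr_ge0 // addr_ge0 // !mulr_ge0.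
have Y0 : 0 <= Y by exact: le_trans ler01 Y1.
pose S : pred idx := [pred k | dft_freq k *+ 2 == kk i + kk j].
have rec x : nc (W x i j - \sum_(k | S k) dft k (fun x => W x i j) x) <= err.
  apply: (@dft_reconstruct_low S r.+2 K a (Y ^+ (2 * n) * (eg + E)) (fun x => W x i j) x (@perWij i j) (CW i j) K0).
    by apply: mulr_ge0; [exact: exprn_ge0 | exact: addr_ge0].
  move=> k nS low; apply: mode_small => //.
  by rewrite mul2n -addnn -addSn; apply: leq_add; rewrite ?leq_subr.
have [k Sk|none] := pickP S; last first.
  by right=> x; have := rec x; rewrite big_pred0 // subr0.
have Sum x : \sum_(k' | S k') dft k' (fun x => W x i j) x = dft k (fun x => W x i j) x.
  rewrite (bigD1 k) //= big1 ?addr0 // => k' /andP[Sk' kk'].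
  case/eqP: kk'; apply: dft_freq_inj; move: Sk Sk'; rewrite /S /= => /eqP <- /eqP e.
  by apply/rowP => l; have := congr1 (fun v : 'rV[int]_d => v 0 l) e; rewrite !mulr2n !mxE; exact: double_inj.
left; exists (dft_freq k); first exact/eqP.
have Xk l : `|2 * pi * (dft_freq k 0 l)%:~R| <= X.
  have : dft_freq k *+ 2 = kk i + kk j by exact/eqP.
  move=> /(congr1 (fun v : 'rV[int]_d => v 0 l)); rewrite mulr2n !mxE => e.
  have {}e : (((k l)%:Z - H%:Z)%:~R : R) = ((kk i 0 l)%:~R + (kk j 0 l)%:~R) / 2.
    by rewrite -intrD -e intrD; field.
  rewrite e normrM ger0_norm ?mulr_ge0 ?pi_ge0 // normrM.
  have : 2 * pi * `|(kk i 0 l)%:~R + (kk j 0 l)%:~R : R| <= X + X.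
    apply: (@le_trans _ _ (2 * pi * (`|(kk i 0 l)%:~R| + `|(kk j 0 l)%:~R|))).
      by apply: ler_wpM2l; [rewrite mulr_ge0 ?pi_ge0 | exact: ler_normD].
    by rewrite mulrDr; exact: lerD (Xkk i l) (Xkk j l).
  have -> : `|2^-1 : R| = 2^-1 by rewrite ger0_norm.
  by rewrite mulrA; move: (2 * pi * _) => u; lra.
move=> x; have r1 := rec x; have r0 := rec 0; rewrite !Sum in r1 r0.
have C1 : Cc 1 a (fun x => W x i j) by apply: CcW (CW i j).
have md := dft_mode x (@perWij i j) X1 Xk C1.
have mdE : d%:R * (6 * X * a) / N%:R <= E.
  rewrite /E -mulrA; apply: ler_wpM2l => //; apply: ler_wpM2r; first by rewrite invr_ge0.
  apply: ler_wpM2r => //; apply: ler_wpM2l => //.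
  by apply: ler_eXnr.
have -> : W x i j - W 0 i j * expc (zR R (dft_freq k)) x =
  (W x i j - dft k (fun x => W x i j) x) +
  (dft k (fun x => W x i j) x - dft k (fun x => W x i j) 0 * expc (zR R (dft_freq k)) x) -
  (W 0 i j - dft k (fun x => W x i j) 0) * expc (zR R (dft_freq k)) x by ring.
apply: (le_trans (ncB _ _)); rewrite ncM nc_expc mulr1.
have -> : 2 * err + E = (err + E) + err by ring.
apply: lerD r0; apply: (le_trans (ncD _ _)); exact: lerD r1 (le_trans md mdE).
Qed.

End Modes.

(** * Near-constancy of the defect of reality *)

Section PowerCalculus.
Variables (R : realType) (n : nat).
Local Notation C := R[i].
Local Notation nc := (@normc R).
Variable X : R.
Hypotheses (X2 : 2 <= X) (nX : n%:R <= X).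

Lemma pow_ge0 k : 0 <= X ^+ k. Proof. exact: X_ge0. Qed.
Lemma pow_gt0 k : 0 < X ^+ k. Proof. by apply: exprn_gt0; exact: lt_le_trans X2. Qed.
Lemma powD a b : X ^+ a * X ^+ b = X ^+ (a + b). Proof. by rewrite exprD. Qed.
Lemma le_pow a b : (a <= b)%N -> X ^+ a <= X ^+ b.
Proof. by apply: leXX; exact: ge1_2. Qed.
Lemma pow_div a b c : (a + c <= b)%N -> X ^+ a / X ^+ b <= (X ^+ c)^-1.
Proof.
move=> h; rewrite ler_pdivrMr ?pow_gt0 // mulrC ler_pdivlMr ?pow_gt0 // powD.
exact: le_pow.
Qed.
Lemma pow_add a b : X ^+ a + X ^+ b <= X ^+ (maxn a b).+1.
Proof.
have ha : X ^+ a <= X ^+ maxn a b by apply: le_pow; exact: leq_maxl.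
have hb : X ^+ b <= X ^+ maxn a b by apply: le_pow; exact: leq_maxr.
rewrite exprS; apply: (@le_trans _ _ (2 * X ^+ maxn a b)).
  by rewrite mulr_natl mulr2n; exact: lerD.
by apply: ler_wpM2r => //; exact: pow_ge0.
Qed.

Lemma mbMX a b (P Q : 'M[C]_n) : mb (X ^+ a) P -> mb (X ^+ b) Q -> mb (X ^+ (a + b + 1)) (P *m Q).
Proof.
move=> hP hQ; apply: mb_le (mbM (pow_ge0 _) (pow_ge0 _) hP hQ).
by rewrite powD addn1 exprS; apply: ler_wpM2r => //; exact: pow_ge0.
Qed.
Lemma mbDX a b (P Q : 'M[C]_n) : mb (X ^+ a) P -> mb (X ^+ b) Q -> mb (X ^+ (maxn a b).+1) (P + Q).
Proof. by move=> hP hQ; apply: mb_le (mbD hP hQ); exact: pow_add. Qed.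
Lemma mbBX a b (P Q : 'M[C]_n) : mb (X ^+ a) P -> mb (X ^+ b) Q -> mb (X ^+ (maxn a b).+1) (P - Q).
Proof. by move=> hP hQ; apply: mb_le (mbB hP hQ); exact: pow_add. Qed.
Lemma mbWX a b (P : 'M[C]_n) : (a <= b)%N -> mb (X ^+ a) P -> mb (X ^+ b) P.
Proof. by move=> ab; apply: mb_le; exact: le_pow. Qed.
Lemma mb_small a (e : R) (P Q : 'M[C]_n) : 0 <= e -> mb (X ^+ a) P -> mb e Q ->
  mb (X ^+ a.+1 * e) (P *m Q) /\ mb (X ^+ a.+1 * e) (Q *m P).
Proof.
move=> e0 hP hQ; split.
  apply: mb_le (mbM (pow_ge0 _) e0 hP hQ).
  by rewrite exprS -mulrA; apply: ler_wpM2r => //; apply: mulr_ge0 => //; exact: pow_ge0.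
apply: mb_le (mbM e0 (pow_ge0 _) hQ hP).
by rewrite exprS (mulrC e) -mulrA; apply: ler_wpM2r => //; apply: mulr_ge0 => //; exact: pow_ge0.
Qed.

Variables (d m : nat).
Hypothesis nmX : n%:R * 2 ^+ m.+1 <= X.

Lemma CmMX a b (Z W : 'rV[R]_d -> 'M[C]_n) : Cm m (X ^+ a) Z -> Cm m (X ^+ b) W ->
  Cm m (X ^+ (a + b + 1)) (fun x => Z x *m W x).
Proof.
move=> hZ hW; apply: Cm_le (CmM hZ hW).
by rewrite powD addn1 [in leRHS]exprS mulrA; apply: ler_wpM2r => //; exact: pow_ge0.
Qed.
End PowerCalculus.

Section NormalForm.
Variables (R : realType) (d n t : nat) (w : 'rV[R]_d) (kappa tau : R).
Local Notation C := R[i].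
Local Notation nc := (@normc R).
Hypotheses (d0 : (0 < d)%N) (n0 : (0 < n)%N) (kp : 0 < kappa) (tt : tau <= t%:R) (hw : DC w kappa tau).

Lemma phase_kdot k : phase (zR R k) w = 2 * pi * kdot w k.
Proof. by rewrite /phase /kdot; congr (_ * _); apply: eq_bigr => l _; rewrite mxE. Qed.

(** The labels are read off the Schur diagonal, which the block diagonalization preserves, so the
    separation estimates survive it. The exponent depends on [n], [t] and [pB] but not on the scale
    [M]. *)
Lemma normal_form pB : exists p, forall (M : nat) (B : 'M[C]_n), let X := M%:R : R in
  2 <= X -> (4 * n + 1)%:R <= X -> d%:R <= X -> kappa^-1 <= X -> mb (X ^+ pB) B ->
  exists (kk : 'I_n -> 'rV[int]_d) (P P' T : 'M[C]_n),
  [/\ P' *m P = 1%:M /\ P' *m B *m P = T, is_trig_mx T /\ (forall i j, kk i != kk j -> T i j = 0),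
      [/\ mb (X ^+ p) P, mb (X ^+ p) P' & mb (X ^+ p) T],
      forall i l, `|(kk i 0 l)%:~R| <= X ^+ 3 &
      forall i j (k : 'rV[int]_d), (forall l, `|k 0 l| <= M%:Z) -> k *+ 2 != kk i + kk j ->
        (X ^+ (4 * t + 3))^-1 <= `|- (Im (T i i) + Im (T j j)) - phase (zR R k) w|].
Proof.
pose Q := (maxn (4 * t + 3) (pB + 3))%N.
exists (Q * 5 ^ (n * n) + 1)%N => M B X X2 n4X dX kX bB.
have X1 : 1 <= X := ge1_2 X2.
have nX : n%:R <= X by apply: le_trans n4X; rewrite ler_nat; (clear; lia).
have [P1 [P1' [PP1 tT1 bP1 bP1']]] := schur_bounded B n0.
set T1 := P1' *m B *m P1 in tT1.
have bT1 : mb (X ^+ (pB + 3)) T1.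
  have b1 : mb (X ^+ 0) P1 by rewrite expr0.
  have b1' : mb (X ^+ 0) P1' by rewrite expr0.
  by apply: mbWX (mbMX X2 nX (mbMX X2 nX b1' bB) b1) => //; (clear; lia).
(* With this normalization [- (Im T_ii + Im T_jj) - 2 pi <k, w>] is [pi (b_i + b_j - 2 <k, w>)], a
   resonance with reflection. *)
pose b i := - Im (T1 i i) / pi.
(* Bounds [knorm k] when every coordinate of [k] is at most [M]. *)
pose K := (d * M)%N.
(* The frequencies met in [nonres] have norm at most [X ^+ 4], which gives [4 * t]; the three
   further powers pay for [kappa], for the factor [2 * n + 1] and for strictness. *)
pose eps := (X ^+ (4 * t + 3))^-1.
have eps0 : 0 < eps by rewrite invr_gt0; exact: pow_gt0.
have M0 : (0 < M)%N by rewrite -(ltr_nat R); apply: lt_le_trans X2.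
have nonres k : k != 0 -> knorm k <= ((2 * (2 * n + 1)) * K)%:Z -> (2 * n + 1)%:R * eps < `|kdot w k|.
  move=> k0 kL; have L1 : (1 <= 2 * (2 * n + 1) * K)%N by rewrite !muln_gt0 addn_gt0 orbT d0 M0.
  apply: lt_le_trans (DC_lower kp tt L1 hw k0 kL).
  have LX : ((2 * (2 * n + 1) * K)%:R : R) <= X ^+ 4.
    have -> : X ^+ 4 = X * X * (X * X) by ring.
    rewrite /K !natrM; apply: ler_pM; rewrite ?mulr_ge0 //; apply: ler_pM => //.
    by apply: le_trans n4X; rewrite ler_nat; (clear; lia).
  have LX' : ((2 * (2 * n + 1) * K)%:R ^+ t : R) <= X ^+ (4 * t).
    by rewrite exprM; apply: lerXn2r; rewrite ?nnegrE ?exprn_ge0 //; lra.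
  have Lp : (0 : R) < (2 * (2 * n + 1) * K)%:R ^+ t by rewrite exprn_gt0 // ltr0n.
  apply: (@lt_le_trans _ _ (X ^+ (4 * t + 1))^-1); last first.
    rewrite exprD expr1 invfM mulrC; apply: ler_pM; rewrite ?invr_ge0 ?exprn_ge0 //; try lra.
      by rewrite invf_ple ?posrE //; lra.
    by rewrite lef_pV2 ?posrE // pow_gt0.
  apply: (@le_lt_trans _ _ (X * eps)).
    apply: ler_wpM2r; first exact: ltW.
    by apply: le_trans n4X; rewrite ler_nat; (clear; lia).
  rewrite /eps -[X in X / _]expr1; apply: (@le_lt_trans _ _ (X ^+ (4 * t + 2))^-1).
    by apply: pow_div => //; (clear; lia).
  by rewrite ltf_pV2 ?posrE ?pow_gt0 // ltr_eXn2l //; [(clear; lia)|lra].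
have [kk [kkb kkE]] := resonance_labels b (ltW eps0) nonres.
have pi1 : (1 : R) <= pi by have := pi_ge2 R; lra.
have pi0 : (0 : R) < pi by lra.
have bE i : Im (T1 i i) = - (pi * b i) by rewrite /b mulrC divfK ?opprK // gt_eqF.
have sep i j : kk i != kk j -> eps <= nc (T1 i i - T1 j j).
  move=> kij; apply: le_trans (nc_Im _).
  have -> : Im (T1 i i - T1 j j) = - (pi * (b i - b j)).
    have -> : Im (T1 i i - T1 j j) = Im (T1 i i) - Im (T1 j j) by case: (T1 i i) (T1 j j) => ? ? [].
    by rewrite !bE; ring.
  rewrite normrN normrM gtr0_norm //.
  (* A gap of at most [eps] is a resonance without reflection at frequency 0 and would force equal
     labels. *)
  have [le|lt] := lerP `|b i - b j| eps.
    case/eqP: kij; rewrite (kkE i j false 0) //= ?mul0rn ?addr0 ?knorm0 //.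
    have -> : kdot w 0 = 0 by apply: big1 => l _; rewrite mxE mul0r.
    by rewrite mulr0 addr0.
  by apply: (le_trans (ltW lt)); rewrite ler_peMl.
have Q1 : (1 <= Q)%N by rewrite /Q leq_max addn3.
have XQ2 : 2 <= X ^+ Q by apply: (le_trans X2); rewrite -[X in X <= _]expr1; exact: le_pow.
have bT1Q : mb (X ^+ Q) T1 by apply: mbWX bT1 => //; exact: leq_maxr.
have sepQ i j : kk i != kk j -> (X ^+ Q)^-1 <= nc (T1 i i - T1 j j).
  move=> kij; apply: le_trans (sep i j kij); rewrite /eps lef_pV2 ?posrE ?pow_gt0 //.
  by apply: le_pow => //; exact: leq_maxl.
have [U [U' [T [[UU UT] tT dT zT [bU bU' bT]]]]] := block_diag XQ2 tT1 bT1Q sepQ.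
rewrite -!exprM in bU bU' bT.
exists kk, (P1 *m U), (U' *m P1'), T; split.
- split; first by rewrite mulmxA -(mulmxA U') PP1 mulmx1.
  by rewrite -UT /T1 !mulmxA.
- by [].
- have b1 : mb (X ^+ 0) P1 by rewrite expr0.
  have b1' : mb (X ^+ 0) P1' by rewrite expr0.
  split; last by apply: mbWX bT => //; rewrite leq_addr.
    by apply: mbWX (mbMX X2 nX b1 bU).
  by apply: mbWX (mbMX X2 nX bU' b1') => //; rewrite addn0.
- move=> i l; rewrite -intr_norm; apply: (@le_trans _ _ (((4 * n + 1) * K)%:Z)%:~R).
    by rewrite ler_int; exact: le_trans (knorm_ge _ _) (kkb i).
  rewrite -[((_ * K)%:Z)%:~R]/(((4 * n + 1) * K)%:R : R) /K !natrM.
  have -> : X ^+ 3 = X * (X * X) by ring.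
  by apply: ler_pM; rewrite ?mulr_ge0 //; apply: ler_pM.
move=> i j k kM knr; rewrite !dT !bE phase_kdot.
have -> : - (- (pi * b i) + - (pi * b j)) - 2 * pi * kdot w k = pi * (b i - (- b j + 2 * kdot w k)) by ring.
rewrite normrM gtr0_norm //.
have [le|lt] := lerP `|b i - (- b j + 2 * kdot w k)| eps; last first.
  by apply: (le_trans (ltW lt)); rewrite ler_peMl.
have kK : knorm k <= K%:Z.
  rewrite /knorm /K; apply: (@le_trans _ _ (\sum_(l < d) M%:Z)); first exact: ler_sum.
  by rewrite sumr_const card_ord -[X in X <= _]mulr_natl PoszM natz.
by case/eqP: knr; rewrite (kkE i j true k kK le) /= addrAC addNr add0r.
Qed.

End NormalForm.

(** * Choice of the grid exponent and of the number of derivatives *)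

Section ErrorBudget.
Variables (R : realType) (d n M h r p q pa mu : nat).
Let X : R := M%:R.
Let N := (2 * M ^ h).+1.
Let c := (3 * d + 2 * n * (q + p + 4))%N.
Let E : R := d%:R * (6 * (X ^+ 6) ^+ 3 * X ^+ pa / N%:R).
Variable eg : R.
Let err : R := (2 * M).+1%:R ^+ d * ((1 + (X ^+ q)^-1^-1 * (2 * n%:R * X ^+ p + 1)) ^+ (2 * n) * (eg + E))
   + N%:R ^+ d * (2 * X ^+ pa / M%:R ^+ r.+2).
Hypotheses (X2 : 2 <= X) (nX : n%:R <= X) (dX : d%:R <= X) (eg0 : 0 <= eg).
Hypotheses (hh : (pa + 22 + (mu + c + 3) <= h)%N) (hr : ((h + 2) * d + 1 + pa + (mu + 3) <= r.+2)%N).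
Hypothesis (heg : eg <= (X ^+ (mu + c + 3))^-1).

(** The grid exponent [h] comes first: it makes the discretization error [E] beat the factor
    [X ^+ c], where [c] accounts for the number of low modes and for [2 n] factors [Y]. Only then is
    [r] fixed, because the tail has as many terms as the grid, about [X ^+ (h * d)]. *)
Lemma error_budget : 2 * err + E <= (X ^+ mu)^-1 /\ 2 * err <= (X ^+ mu)^-1.
Proof.
have X1 : 1 <= X := ge1_2 X2.
have X0 : 0 <= X by exact: le_trans ler01 X1.
have P0 k := pow_ge0 X2 k.
have P1 k := pow_gt0 X2 k.
have Nh : X ^+ h <= N%:R.
  by rewrite /X -natrX ler_nat /N ltnW // ltnS leq_pmull.
have Np : (0 : R) < N%:R by rewrite ltr0n.
have half k : (X ^+ k.+1)^-1 + (X ^+ k.+1)^-1 <= (X ^+ k)^-1.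
  rewrite exprS invfM -mulrDl -[leRHS]mul1r; apply: ler_wpM2r; first by rewrite invr_ge0.
  have : X^-1 <= 2^-1 by rewrite lef_pV2 ?posrE //; exact: lt_le_trans X2.
  move=> ?; have : (2^-1 + 2^-1 : R) = 1 by field.
  by move=> <-; apply: lerD.
have E0 : 0 <= E by rewrite /E !mulr_ge0 // ?invr_ge0 ?ltW // exprn_ge0.
have EX : E <= (X ^+ (mu + c + 3))^-1.
  apply: (@le_trans _ _ (X ^+ (pa + 22) / X ^+ h)); last exact: pow_div.
  rewrite /E mulrA; apply: ler_pM; rewrite ?invr_ge0 ?(ltW Np) //.
  - by rewrite !mulr_ge0 // exprn_ge0.
  (* 22 is 1 for [d], 3 for the constant 6 and 18 for the cube of [X ^+ 6]. *)
  - have -> : X ^+ (pa + 22) = X * (X ^+ 3 * (X ^+ 6) ^+ 3 * X ^+ pa).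
      by rewrite -exprM -!exprD -exprS; congr (_ ^+ _); clear; lia.
    apply: ler_pM => //; first by rewrite !mulr_ge0 // exprn_ge0.
    apply: ler_wpM2r => //; apply: ler_wpM2r; first by rewrite exprn_ge0.
    by apply: le_trans (le2X 3 X2); rewrite !exprS expr0; lra.
  - by rewrite lef_pV2 ?posrE.
have YX : 1 + (X ^+ q)^-1^-1 * (2 * n%:R * X ^+ p + 1) <= X ^+ (q + p + 4).
  rewrite invrK.
  have h1 : 2 * n%:R * X ^+ p + 1 <= X ^+ (p + 3).
    apply: (@le_trans _ _ (X ^+ (p + 2) + X ^+ 0)); last first.
      by apply: le_trans (pow_add X2 _ _) _; apply: le_pow => //; clear; lia.
    apply: lerD; last by rewrite expr0.
    have -> : X ^+ (p + 2) = X * X * X ^+ p by rewrite addn2 !exprS mulrA.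
    by apply: ler_wpM2r => //; apply: ler_pM.
  apply: (@le_trans _ _ (X ^+ 0 + X ^+ (q + p + 3))); last first.
    by apply: le_trans (pow_add X2 _ _) _; apply: le_pow => //; clear; lia.
  rewrite expr0; apply: lerD => //.
  have -> : X ^+ (q + p + 3) = X ^+ q * X ^+ (p + 3) by rewrite -exprD addnA.
  exact: ler_wpM2l.
have Y0 : 0 <= 1 + (X ^+ q)^-1^-1 * (2 * n%:R * X ^+ p + 1).
  by rewrite addr_ge0 // mulr_ge0 ?addr_ge0 ?mulr_ge0 // invrK.
have t1 : (2 * M).+1%:R ^+ d * ((1 + (X ^+ q)^-1^-1 * (2 * n%:R * X ^+ p + 1)) ^+ (2 * n) * (eg + E))
   <= (X ^+ (mu + 2))^-1.
  apply: (@le_trans _ _ (X ^+ c / X ^+ (mu + c + 2))); last by apply: pow_div => //; clear; lia.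
  have -> : X ^+ c = X ^+ (3 * d) * X ^+ ((q + p + 4) * (2 * n)).
    by rewrite -exprD; congr (_ ^+ _); rewrite /c mulnC [X in (_ + X)%N]mulnC.
  rewrite -[leRHS]mulrA; apply: ler_pM; rewrite ?exprn_ge0 //.
  - by apply: mulr_ge0; [exact: exprn_ge0 | exact: addr_ge0].
  - rewrite exprM; apply: lerXn2r; rewrite ?nnegrE ?P0 //.
    have -> : (2 * M).+1%:R = 2 * X + 1 by rewrite -natr1 natrM.
    apply: (@le_trans _ _ (X ^+ 2 + X ^+ 0)); last first.
      exact: pow_add.
    by rewrite expr0; apply: lerD => //; rewrite expr2; apply: ler_wpM2r.
  apply: ler_pM; [exact: exprn_ge0 | exact: addr_ge0 | |].
    by rewrite [leRHS]exprM; apply: lerXn2r; rewrite ?nnegrE ?P0.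
  apply: le_trans (lerD heg EX) _.
  have -> : (mu + c + 3 = (mu + c + 2).+1)%N by clear; lia.
  exact: half.
have t2 : N%:R ^+ d * (2 * X ^+ pa / M%:R ^+ r.+2) <= (X ^+ (mu + 3))^-1.
  apply: (@le_trans _ _ (X ^+ ((h + 2) * d + 1 + pa) / X ^+ r.+2)); last exact: pow_div.
  rewrite mulrA; apply: ler_wpM2r; first by rewrite invr_ge0.
  rewrite !exprD expr1 exprM mulrA; apply: ler_wpM2r => //.
  apply: ler_pM; rewrite ?exprn_ge0 ?(ltW Np) //.
  apply: lerXn2r; rewrite ?nnegrE ?P0 ?(ltW Np) //.
  have -> : (N%:R : R) = 2 * X ^+ h + 1 by rewrite /N -natr1 natrM natrX.
  apply: (@le_trans _ _ (X ^+ h.+1 + X ^+ 0)); last first.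
    by apply: le_trans (pow_add X2 _ _) _; apply: le_pow => //; clear; lia.
  by rewrite expr0 exprS; apply: lerD => //; apply: ler_wpM2r.
have u1 := half (mu + 2)%N; have u2 := half (mu + 1)%N; have u3 := half mu.
have EX3 : E <= (X ^+ (mu + 3))^-1.
  apply: (le_trans EX); rewrite lef_pV2 ?posrE //; apply: le_pow => //; clear; lia.
have Q0 k : 0 <= (X ^+ k)^-1 by rewrite invr_ge0.
move: t1 t2 u1 u2 u3 EX3 E0 (Q0 (mu + 3)%N); rewrite /err.
have -> : (mu + 2).+1 = (mu + 3)%N by clear; lia.
have -> : (mu + 1).+1 = (mu + 2)%N by clear; lia.
have -> : (mu.+1 = mu + 1)%N by clear; lia.
move: (_ * (_ * (eg + E))) (N%:R ^+ d * _) => A1 A2.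
move: ((X ^+ (mu + 3))^-1) ((X ^+ (mu + 2))^-1) ((X ^+ (mu + 1))^-1) ((X ^+ mu)^-1) => v3 v2 v1 v0.
by move=> b1 b2 b3 b4 b5 b6 b7 b8; split; lra.
Qed.

End ErrorBudget.

Section StageA.
Variables (R : realType) (d n t : nat) (w : 'rV[R]_d) (kappa tau : R).
Local Notation C := R[i].
Local Notation nc := (@normc R).
Hypotheses (d0 : (0 < d)%N) (n0 : (0 < n)%N) (kp : 0 < kappa) (tt : tau <= t%:R) (hw : DC w kappa tau).
Variable A : 'rV[R]_d -> 'M[C]_n.
Hypothesis realA : forall x, map_mx conjc (A x) = A x.

(** Almost reducibility puts no bound on the constant matrices; solving the equation for [B] at the
    single point 0 supplies one. *)
Lemma coefficient_bound (X : R) (Z F : 'rV[R]_d -> 'M[C]_n) (B : 'M[C]_n) :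
  2 <= X -> n%:R <= X -> d%:R <= X -> (forall l, `|w 0 l| <= X) -> mb X (A 0) ->
  Cm 1 X Z -> Cm 0 X (fun x => invmx (Z x)) -> Z 0 \in unitmx -> mb 1 (F 0) ->
  mx_dir w Z 0 = A 0 *m Z 0 - Z 0 *m (B + F 0) -> mb (X ^+ 10) B.
Proof.
move=> X2 nX dX Xw bA CZ CZi uZ bF eq.
have X1 := ge1_2 X2; have X0 : 0 <= X by exact: le_trans ler01 X1.
have BE : B = invmx (Z 0) *m (A 0 *m Z 0 - mx_dir w Z 0) - F 0.
  have -> : A 0 *m Z 0 - mx_dir w Z 0 = Z 0 *m (B + F 0) by rewrite eq opprB addrC subrK.
  by rewrite mulKmx // addrK.
have b1 (P : 'M[C]_n) : mb (2 * X) P -> mb (X ^+ 2) P.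
  by apply: mb_le; rewrite expr2; apply: ler_wpM2r.
have bZ : mb (X ^+ 2) (Z 0) by apply: b1; exact: (Cm_mb CZ).
have bZi : mb (X ^+ 2) (invmx (Z 0)) by apply: b1; exact: (Cm_mb CZi).
have bD : mb (X ^+ 5) (mx_dir w Z 0).
  apply: mb_le (Cm_mb (Cm_dir w CZ) 0).
  have -> : X ^+ 5 = X * (X * (X * (X * X))) by rewrite !exprS expr0 mulr1.
  have m0 : 0 <= \big[Num.max/0]_l `|w 0 l| by exact: bigmax_ge_id.
  have mX : \big[Num.max/0]_l `|w 0 l| <= X by apply/bigmax_leP.
  rewrite expr1; apply: ler_pM => //; first by rewrite !mulr_ge0.
  apply: ler_pM => //; first by rewrite !mulr_ge0.
  apply: ler_pM => //; first by rewrite !mulr_ge0.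
  exact: ler_pM.
rewrite BE.
have bA' : mb (X ^+ 1) (A 0) by rewrite expr1.
have bF' : mb (X ^+ 0) (F 0) by rewrite expr0.
exact: (mbBX X2 (mbMX X2 nX bZi (mbBX X2 (mbMX X2 nX bA' bZ) bD)) bF').
Qed.

Lemma conj_mxM m1 m2 m3 (P : 'M[C]_(m1, m2)) (Q : 'M[C]_(m2, m3)) :
  map_mx conjc (P *m Q) = map_mx conjc P *m map_mx conjc Q.
Proof. exact: map_mxM. Qed.

(* [W] conjugates the equation of [Z] into the one of its complex conjugate. *)
Lemma transition_eq m a b (Z F : 'rV[R]_d -> 'M[C]_n) (Zi : 'rV[R]_d -> 'M[C]_n) (T : 'M[C]_n) :
  Cm m.+1 a Z -> Cm m.+1 b Zi -> (forall x, Zi x *m Z x = 1%:M) ->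
  (forall x, mx_dir w Z x = A x *m Z x - Z x *m (T + F x)) ->
  let W x := map_mx conjc (Zi x) *m Z x in
  forall x, mx_dir w W x = map_mx conjc T *m W x - W x *m T +
    (map_mx conjc (F x) *m W x - W x *m F x).
Proof.
move=> CZ CZi ZiZ eqZ W x.
have ZZi y : Z y *m Zi y = 1%:M by exact: mulmx1C.
have cZZi y : map_mx conjc (Z y) *m map_mx conjc (Zi y) = 1%:M by rewrite -conj_mxM ZZi map_mx1.
have cZiZ y : map_mx conjc (Zi y) *m map_mx conjc (Z y) = 1%:M by rewrite -conj_mxM ZiZ map_mx1.
have dZ := Cm_der x w CZ; have dZi := Cm_der x w CZi.
have [dcZ cZE] := mx_dir_conj dZ.
have [dcZi cZiE] := mx_dir_conj dZi.
have [dW WE] := mx_dir_conj dZ.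
have [dWW _] := mx_dirM dcZi dZ.
have [_ prodE] := mx_dirM dcZ dWW.
(* Differentiating [conj(Z) W = Z] and solving for the derivative of [W] avoids a formula for the
   derivative of the inverse; only its existence is used. *)
have E : (fun y => map_mx conjc (Z y) *m (map_mx conjc (Zi y) *m Z y)) = Z.
  by apply/funext => y; rewrite mulmxA cZZi mul1mx.
rewrite E -/W cZE eqZ in prodE.
have ZW : map_mx conjc (Z x) *m W x = Z x by rewrite /W mulmxA cZZi mul1mx.
have solve (p q r s : 'M[C]_n) : p - q = p - r + s -> s = r - q.
  by move=> h; apply: (addrI (p - r)); rewrite -h addrA subrK.
rewrite map_mxB !conj_mxM realA map_mxD mulmxBl -(mulmxA (A x)) ZW -(mulmxA (map_mx conjc (Z x))) in prodE.
have := congr1 (mulmx (map_mx conjc (Zi x))) (solve _ _ _ _ prodE).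
rewrite mulmxBr !mulmxA cZiZ !mul1mx -/(W x) => ->.
rewrite -!(mulmxA _ _ (Z x)) -/(W x) mulmxDl mulmxDr opprD; exact: addrACA.
Qed.

Lemma expc_double k (x : 'rV[R]_d) : expc (zR R k) (2 *: x) = expc (zR R (k *+ 2)) x.
Proof.
have E : phase (zR R k) (2 *: x) = phase (zR R (k *+ 2)) x.
  by rewrite /phase; congr (_ * _); apply: eq_bigr => l _; rewrite mulr2n !mxE intrD; ring.
by rewrite /expc E.
Qed.

Lemma pi_le4 : pi <= 4 :> R.
Proof. by have := pihalf_lt2 R; lra. Qed.

(** The cost [p] of the normal form precedes the precision [mu]. Later losses depend on [p], so [mu]
    can be chosen large against them without circularity. *)
Lemma stage_modes : exists p, forall mu, exists (r m : nat) (X0 : R),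
  forall (M : nat) (Z F : 'rV[R]_d -> 'M[C]_n) (B : 'M[C]_n), let X : R := M%:R in
  X0 <= X -> Zperiodic Z -> Cm r X Z -> Cm r X (fun x => invmx (Z x)) -> (forall x, Z x \in unitmx) ->
  (forall x, mb (X ^+ m)^-1 (F x)) ->
  (forall x, mx_dir w Z x = A x *m Z x - Z x *m (B + F x)) ->
  exists (kk : 'I_n -> 'rV[int]_d) (P P' T : 'M[C]_n),
  [/\ P' *m P = 1%:M /\ P' *m B *m P = T, forall i j, kk i != kk j -> T i j = 0,
      [/\ mb (X ^+ p) P, mb (X ^+ p) P' & mb (X ^+ p) T],
      forall i l, `|(kk i 0 l)%:~R| <= X ^+ 3 &
      let W x := map_mx conjc (P' *m invmx (Z x)) *m (Z x *m P) in
      forall i j x, nc (W (2 *: x) i j * expc (- zR R (kk i + kk j)) x - W 0 i j) <= (X ^+ mu)^-1].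
Proof.
have [p Hp] := @normal_form R d n t w kappa tau d0 n0 kp tt hw 10.
exists p => mu.
(* [q] is the exponent of the small divisors and [pa] that of [W], a product of two maps of exponent
   [p + 2]. In [m], the part [4 * p + 10] pays for carrying [F] through [P], [P'] and [W]. *)
pose q := (4 * t + 3)%N; pose pa := (2 * p + 5)%N.
pose c := (3 * d + 2 * n * (q + p + 4))%N.
pose h := (pa + 22 + (mu + c + 3))%N.
pose r := ((h + 2) * d + 1 + pa + (mu + 3))%N.
pose m := (4 * p + 10 + (mu + c + 3))%N.
pose mw : R := \big[Num.max/0]_l `|w 0 l|.
pose X0 : R := 2 + (4 * n + 1)%:R + d%:R + kappa^-1 + mw + mxmax (A 0) + n%:R * 2 ^+ r.+3.
exists r.+2, m, X0 => M Z F B X XX0 perZ CZ CZi uZ bF eqZ.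
have mw0 : 0 <= mw by exact: bigmax_ge_id.
have mA0 := mxmax_ge0 (A 0).
have k0 : 0 <= kappa^-1 by rewrite invr_ge0 ltW.
have n40 : (0 : R) <= (4 * n + 1)%:R by [].
have dd0 : (0 : R) <= d%:R by [].
have nn0 : (0 : R) <= n%:R * 2 ^+ r.+3 by rewrite mulr_ge0 ?exprn_ge0.
have [X2 n4X dX kX] : [/\ 2 <= X, (4 * n + 1)%:R <= X, d%:R <= X & kappa^-1 <= X].
  by move: XX0; rewrite /X0; split; lra.
have [wX AX nrX] : [/\ mw <= X, mxmax (A 0) <= X & n%:R * 2 ^+ r.+3 <= X].
  by move: XX0; rewrite /X0; split; lra.
have Xw l : `|w 0 l| <= X by apply: le_trans wX; exact: (le_bigmax 0 (fun l => `|w 0 l|) l).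
have bA : mb X (A 0) by apply: mb_le AX (@mb_max _ _ _ _).
have nX : n%:R <= X by apply: le_trans n4X; rewrite ler_nat; clear; lia.
have X1 := ge1_2 X2; have X00 : 0 <= X by exact: le_trans ler01 X1.
have P0 k := pow_ge0 X2 k.
have P1 k := pow_gt0 X2 k.
have M0 : (0 < M)%N by rewrite -(ltr_nat R); apply: lt_le_trans X2.
set e := (X ^+ m)^-1 in bF.
have e0 : 0 <= e by rewrite invr_ge0.
have bB : mb (X ^+ 10) B.
  apply: (coefficient_bound (F := F) X2 nX dX Xw bA (CmW _ CZ) (CmW _ CZi) (uZ 0)) => //.
  by apply: mb_le (bF 0); rewrite /e invf_le1 //; exact: X_ge1.
have [kk [P [P' [T [[PP PT] [trigT blockT] [bP bP' bT] kkX sep]]]]] := Hp M B X2 n4X dX kX bB.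
exists kk, P, P', T; split => //.
move=> W i j x.
have PP' : P *m P' = 1%:M by exact: mulmx1C.
pose Zt y := Z y *m P; pose Zi y := P' *m invmx (Z y).
have CZt : Cm r.+2 (X ^+ (1 + p + 1)) Zt by apply: (CmMX X2 nrX) (Cm_cst _ _ bP); rewrite expr1.
have CZti : Cm r.+2 (X ^+ (p + 1 + 1)) Zi by apply: (CmMX X2 nrX) (Cm_cst _ _ bP') _; rewrite expr1.
have CW : Cm r.+2 (X ^+ pa) W.
  have := CmMX X2 nrX (Cm_conj CZti) CZt; congr (Cm _ (X ^+ _) _); rewrite /pa; clear; lia.
pose Ft y := P' *m F y *m P.
have eqZt y : mx_dir w Zt y = A y *m Zt y - Zt y *m (T + Ft y).
  have [_ ->] := mx_dirM (Cm_der y w CZ) (mx_dir_cst w P y).1.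
  rewrite (mx_dir_cst w P y).2 mulmx0 addr0 eqZ mulmxBl -!mulmxA; congr (_ - _).
  have TF : T + Ft y = P' *m ((B + F y) *m P) by rewrite /Ft -PT mulmxDl mulmxDr !mulmxA.
  by rewrite TF (mulmxA P) PP' mul1mx.
have ZiZt y : Zi y *m Zt y = 1%:M.
  by rewrite /Zi /Zt mulmxA -(mulmxA P') mulVmx // mulmx1.
pose G y := map_mx conjc (Ft y) *m W y - W y *m Ft y.
have eqW y : mx_dir w W y = map_mx conjc T *m W y - W y *m T + G y.
  have TE := transition_eq CZt CZti ZiZt eqZt; exact: (TE y).
have bFt y : mb (X ^+ p.+1 * (X ^+ p.+1 * e)) (Ft y).
  have [h1 _] := mb_small X2 nX e0 bP' (bF y).
  by have [_ h2] := mb_small X2 nX (mulr_ge0 (P0 _) e0) bP h1.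
pose e' := X ^+ p.+1 * (X ^+ p.+1 * e).
have e'0 : 0 <= e' by rewrite !mulr_ge0.
have bG y : mb (X ^+ (4 * p + 10) * e) (G y).
  have bWy : mb (X ^+ pa.+1) (W y).
    by apply: mb_le (Cm_mb CW y); rewrite exprS; apply: ler_wpM2r.
  have [_ h1] := mb_small X2 nX e'0 bWy (mb_conj (bFt y)).
  have [h2 _] := mb_small X2 nX e'0 bWy (bFt y).
  apply: mb_le (mbB h1 h2).
  have -> : X ^+ (4 * p + 10) * e = X * (X ^+ pa.+2 * e').
    have -> : (4 * p + 10 = (pa.+2 + (p.+1 + p.+1)).+1)%N by rewrite /pa; clear; lia.
    by rewrite exprS !exprD /e' !mulrA.
  rewrite -mulr2n -mulr_natl; apply: ler_wpM2r => //; exact: mulr_ge0.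
have eg0 : 0 <= X ^+ (4 * p + 10) * e by exact: mulr_ge0.
have heg : X ^+ (4 * p + 10) * e <= (X ^+ (mu + c + 3))^-1 by rewrite /e; exact: pow_div.
have pi0 := pi_ge0 R.
have pi8 : 2 * pi <= X ^+ 3.
  by apply: le_trans (le2X 3 X2); rewrite !exprS expr0; have := pi_le4; lra.
have X6 a : 0 <= a -> a <= X ^+ 3 -> 2 * pi * a <= X ^+ 6.
  move=> a0 aX; have -> : X ^+ 6 = X ^+ 3 * X ^+ 3 by rewrite -exprD.
  by apply: ler_pM => //; exact: mulr_ge0.
have X13 : X <= X ^+ 3 by apply: ler_eXnr.
have X16 : X <= X ^+ 6 by apply: ler_eXnr.
have perW : Zperiodic W by move=> y l; rewrite /W perZ.
have eps0 : 0 < (X ^+ q)^-1 by rewrite invr_gt0.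
have [bud1 bud2] : _ /\ _ := @error_budget R d n M h r p q pa mu (X ^+ (4 * p + 10) * e) X2 nX dX eg0
  (leqnn _) (leqW (leqW (leqnn _))) heg.
(* The cutoff is [M] itself and the grid has [2 * M ^ h + 1] points in each direction. *)
have := @mode_dichotomy R d (M ^ h) n w kk T W G M r (X ^+ 6) (X ^+ pa) (X ^+ p) (X ^+ q)^-1
   (X ^+ (4 * p + 10) * e) perW CW trigT blockT bT bG eqW (X_ge1 6 X2) (P0 _) eg0 eps0 M0 (P0 _)
   (fun l => le_trans (Xw l) X16) (X6 _ X00 X13) (fun i l => X6 _ (normr_ge0 _) (kkX i l)) sep i j.
case=> [[k kE H]|H].
  have -> : W (2 *: x) i j * expc (- zR R (kk i + kk j)) x - W 0 i j =
     (W (2 *: x) i j - W 0 i j * expc (zR R k) (2 *: x)) * expc (- zR R (kk i + kk j)) x.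
    by rewrite mulrBl expc_double kE -mulrA (mulrC (expc (zR R _) x)) expcNM mulr1.
  by rewrite ncM nc_expc mulr1; exact: le_trans (H _) bud1.
apply: (le_trans (ncB _ _)); rewrite ncM nc_expc mulr1; apply: le_trans bud2.
by rewrite mulr_natl mulr2n; exact: lerD.
Qed.

End StageA.

(** * Passage to real matrices *)

Section Realify.
Variables (R : realType) (d n : nat).
Local Notation C := R[i].
Local Notation nc := (@normc R).
Implicit Types (V W : 'rV[R]_d -> 'M[C]_n).

Let half := (2^-1 : C).

Lemma nc_half : nc half = 2^-1.
Proof. by rewrite /half ncV (nc_nat R 2). Qed.

Lemma mb_half m1 m2 a (P : 'M[C]_(m1, m2)) : mb (2 * a) P -> mb a (half *: P).
Proof. by move=> /(mbZ half); rewrite nc_half mulKf // pnatr_eq0. Qed.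

Lemma conjc_half : conjc half = half.
Proof. by rewrite /half fmorphV rmorph_nat. Qed.

Lemma conj_mxZ (c : C) (P : 'M[C]_n) : map_mx conjc (c *: P) = conjc c *: map_mx conjc P.
Proof. by apply/matrixP => i j; rewrite !mxE rmorphM. Qed.

Lemma conj_mxK (P : 'M[C]_n) : map_mx conjc (map_mx conjc P) = P.
Proof. by apply/matrixP => i j; rewrite !mxE conjcK. Qed.

Lemma conj_mx_inv (P : 'M[C]_n) : map_mx conjc (invmx P) = invmx (map_mx conjc P).
Proof. exact: map_invmx. Qed.

(* With [S = V - conj V], the real matrix [V + conj V] solves the equation of [V] up to a term linear in [S]. *)
Lemma twice_real_part_eq m a v (A2 V D : 'rV[R]_d -> 'M[C]_n) x :
  Cm m.+1 a V -> map_mx conjc (A2 x) = A2 x -> mx_dir v V x = A2 x *m V x - V x *m D x ->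
  let N y := V y + map_mx conjc (V y) in N x \in unitmx ->
  invmx (N x) *m (A2 x *m N x - mx_dir v N x) =
  half *: (D x + map_mx conjc (D x)) +
  half *: (invmx (N x) *m ((V x - map_mx conjc (V x)) *m (D x - map_mx conjc (D x)))).
Proof.
move=> CV rA eq N uN.
have dV := Cm_der x v CV; have [dcV cVE] := mx_dir_conj dV.
have [_ ->] := mx_dirD dV dcV.
rewrite cVE eq map_mxB !conj_mxM rA.
set cV := map_mx conjc (V x); set cD := map_mx conjc (D x).
have two : (2 : C) != 0 by rewrite pnatr_eq0.
have key : A2 x *m N x - (A2 x *m V x - V x *m D x + (A2 x *m cV - cV *m cD)) =
  half *: (N x *m (D x + cD) + (V x - cV) *m (D x - cD)).
  rewrite /N -/cV; apply: (scalerI two); rewrite scalerA divff // scale1r scaler_nat mulr2n.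
  rewrite !(mulmxDl, mulmxDr, mulmxBl, mulmxBr, mulmxN, mulNmx).
  move: (A2 x *m V x) (V x *m D x) (A2 x *m cV) (cV *m cD) (V x *m cD) (cV *m D x) => a1 a2 a3 a4 a5 a6.
  by apply/matrixP => i j; rewrite !mxE; ring.
rewrite key -(scalemxAr half (invmx (N x))) mulmxDr (mulKmx uN).
exact: scalerDr.
Qed.

Definition realified V y := V y + map_mx conjc (V y).
(** The equation of the real map solved for its perturbation, so that it will hold by construction
    and only estimates remain. *)
Definition real_remainder v (A2 V : 'rV[R]_d -> 'M[C]_n) (B : 'M[C]_n) y :=
  invmx (realified V y) *m (A2 y *m realified V y - mx_dir v (realified V) y)
    - half *: (B + map_mx conjc B).

(** [V + conj(V)] is [2 V] minus the small matrix [V - conj(V)], hence invertible by perturbation.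
    The remainder receives two bounds of different nature: a merely polynomial one in C^m, from its
    defining formula, and a small one in C^0, from [twice_real_part_eq]. *)
Lemma realify m k : exists c, forall (X e : R) (v : 'rV[R]_d) (A2 V Vi F : 'rV[R]_d -> 'M[C]_n) (B : 'M[C]_n),
  2 <= X -> n%:R <= X -> d%:R <= X -> n%:R * 2 ^+ m.+2 <= X -> 2 ^+ m.+1 <= X ->
  (forall l, `|v 0 l| <= X) -> 0 <= e -> X ^+ c * e <= 1 ->
  (forall y, map_mx conjc (A2 y) = A2 y) ->
  Cm m.+1 (X ^+ k) A2 -> Cm m.+1 (X ^+ k) V ->
  (forall y, Vi y *m V y = 1%:M) -> (forall y, mb (X ^+ k) (Vi y)) -> mb (X ^+ k) B ->
  (forall y, mb e (F y)) -> (forall y, mb e (V y - map_mx conjc (V y))) ->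
  (forall y, mx_dir v V y = A2 y *m V y - V y *m (B + F y)) ->
  (forall y, realified V y \in unitmx) /\
  [/\ Cm m.+1 (X ^+ c) (realified V), Cm m.+1 (X ^+ c) (fun y => invmx (realified V y)),
      Cm m (X ^+ c) (real_remainder v A2 V B) & forall y, mb (X ^+ c * e) (real_remainder v A2 V B y)].
Proof.
have [p3 Hp3] := @Cc_det R d 0 n; have [p4 Hp4] := @Cm_inv R d m.+1 n.
pose y0 := ((k + 1) * p3 + 1 + k)%N.
exists (y0 * p4 + 3 * k + 8 + y0)%N; set c := (_ + _ + 8 + _)%N.
move=> X e v A2 V Vi F B X2 nX dX nmX mX vX e0 ce rA CA CV ViV bVi bB bF bS eq.
have X1 := ge1_2 X2; have X0 : 0 <= X by exact: le_trans ler01 X1.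
have small j : (j <= c)%N -> X ^+ j * e <= 1.
  by move=> jc; apply: le_trans ce; apply: ler_wpM2r => //; exact: le_pow.
have e1 : e <= 1 by have := small 0 (leq0n _); rewrite expr0 mul1r.
have VVi y : V y *m Vi y = 1%:M by exact: mulmx1C.
have uV y : V y \in unitmx by have /mulmx1_unit[] := VVi y.
have ViE y : invmx (V y) = Vi y by rewrite -[LHS]mul1mx -(ViV y) mulmxK.
set N := realified V.
have twice a : X ^+ a + X ^+ a <= X ^+ a.+1 by have := pow_add X2 a a; rewrite maxnn.
have [uN bNi] : (forall y, N y \in unitmx) /\ (forall y, mb (X ^+ (k + 1)) (invmx (N y))).
  suff H y : N y \in unitmx /\ mb (X ^+ (k + 1)) (invmx (N y)) by split=> y; have [] := H y.
  have two : (2 : C) \is a GRing.unit by rewrite unitfE pnatr_eq0.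
  have NE : N y = 2 *: V y + - (V y - map_mx conjc (V y)).
    by rewrite /N /realified scaler_nat mulr2n opprB -addrA; congr (_ + _); rewrite [RHS]addrC subrK.
  have u2 : 2 *: V y \in unitmx by rewrite unitmxZ.
  have bi : mb (X ^+ k) (invmx (2 *: V y)).
    rewrite invmxZ // ViE; apply: mb_half; apply: mb_le (bVi y).
    by rewrite mulr_natl mulr2n lerDl; exact: X_ge0.
  have [] := inv_perturb u2 (X_ge0 _ X2) e0 bi (mbN (bS y)).
    apply: (@le_trans _ _ (X ^+ k.+2 * e)).
      rewrite !exprS -!mulrA; apply: ler_pM => //; first by rewrite !mulr_ge0 ?X_ge0.
      by apply: ler_pM => //; rewrite !mulr_ge0 ?X_ge0.
    have := small k.+3 ltac:(rewrite /c; clear; lia); rewrite exprS -mulrA => h.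
    rewrite -(ler_pM2l (_ : 0 < 2)) // divff ?pnatr_eq0 //; apply: le_trans h.
    by apply: ler_wpM2r => //; rewrite mulr_ge0 ?X_ge0.
  rewrite -NE => uN bN; split => //; apply: mb_le bN.
  by rewrite addn1 exprS; apply: ler_wpM2r => //; exact: X_ge0.
split => //.
have CN : Cm m.+1 (X ^+ (k + 1)) N by rewrite addn1; apply: Cm_le (twice k) (CmD CV (Cm_conj CV)).
have Y2 : 2 <= X ^+ y0 by apply: (le_trans X2); rewrite -[X in X <= _]expr1; apply: le_pow => //; rewrite /y0; clear; lia.
have CNi : Cm m.+1 (X ^+ (y0 * p4)) (fun y => invmx (N y)).
  rewrite exprM; apply: Hp4 => //.
    by apply: Cm_le CN; apply: le_pow => //; rewrite /y0; clear; lia.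
  (* The determinant bound, applied to the constant map with value the inverse at [y], becomes a
     lower bound on the determinant of [N y]. *)
  move=> y; have := @Hp3 (X ^+ (k + 1)) (fun=> invmx (N y)).
  have Z2 : 2 <= X ^+ (k + 1) by apply: (le_trans X2); rewrite -[X in X <= _]expr1; apply: le_pow => //; clear; lia.
  move=> /(_ Z2 (Cm_cst _ _ (bNi y)))/Cc_bound/(_ 0); rewrite det_inv ncV -exprM => h.
  have dN : 0 < nc (\det (N y)) by rewrite nc_gt0 -unitfE -unitmxE.
  rewrite -[leRHS]invrK lef_pV2 ?posrE ?invr_gt0 ?pow_gt0 //; apply: (le_trans h).
  apply: (@le_trans _ _ (X ^+ ((k + 1) * p3).+1)); first by rewrite exprS; apply: ler_wpM2r => //; exact: X_ge0.
  by apply: le_pow => //; rewrite /y0; clear; lia.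
have nmX' : n%:R * 2 ^+ m.+1 <= X.
  by apply: le_trans nmX; apply: ler_wpM2l => //; apply: leXX => //; rewrite ler1n.
have bBr : mb (X ^+ k) (half *: (B + map_mx conjc B)).
  by apply: mb_half; rewrite mulr_natl mulr2n; apply: mbD => //; exact: mb_conj.
have Fr_eq y : real_remainder v A2 V B y = half *: (F y + map_mx conjc (F y)) +
    half *: (invmx (N y) *m ((V y - map_mx conjc (V y)) *m (B + F y - map_mx conjc (B + F y)))).
  rewrite /real_remainder (twice_real_part_eq (D := fun y => B + F y) CV (rA y) (eq y) (uN y)) addrAC.
  have E : B + F y + map_mx conjc (B + F y) - (B + map_mx conjc B) = F y + map_mx conjc (F y).
    by rewrite map_mxD; move: (map_mx _ B) (map_mx _ (F y)) => b' f'; apply/matrixP => i j; rewrite !mxE; ring.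
  by congr (_ + _); rewrite -scalerBr E.
split.
- by apply: Cm_le CN; apply: le_pow => //; rewrite /c; clear; lia.
- by apply: Cm_le CNi; apply: le_pow => //; rewrite /c; clear; lia.
- have C1 : Cm m (X ^+ (2 * k + 4)) (fun y => A2 y *m N y).
    apply: Cm_le (CmW (leqnSn m) (CmMX X2 nmX CA CN)); apply: le_pow => //; clear; lia.
  have C2 : Cm m (X ^+ (2 * k + 4)) (mx_dir v N).
    apply: Cm_le (Cm_dir v CN).
    apply: (@le_trans _ _ (X ^+ (3 + (k + 1)))); last by apply: le_pow => //; clear; lia.
    have v0 : 0 <= \big[Num.max/0]_l `|v 0 l| by exact: bigmax_ge_id.
    have vX' : \big[Num.max/0]_l `|v 0 l| <= X by apply/bigmax_leP.
    rewrite [leRHS]exprD [X ^+ 3]exprS expr2 -!mulrA; apply: ler_pM => //; first by rewrite !mulr_ge0 ?exprn_ge0.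
    apply: ler_pM => //; rewrite ?mulr_ge0 ?exprn_ge0 //.
    by apply: ler_wpM2r => //; exact: X_ge0.
  have C3 := CmD C1 (CmN C2).
  have C4 : Cm m (X ^+ (2 * k + 5)) (fun y => A2 y *m N y - mx_dir v N y).
    by apply: Cm_le C3; apply: le_trans (twice _) _; apply: le_pow => //; clear; lia.
  have C5 := CmMX X2 nmX' (CmW (leqnSn m) CNi) C4.
  apply: Cm_le (CmD C5 (CmN (Cm_cst d m bBr))).
  by apply: le_trans (pow_add X2 _ _) _; apply: le_pow => //; rewrite /c; clear; lia.
move=> y; rewrite Fr_eq.
have bFF : mb e (half *: (F y + map_mx conjc (F y))).
  by apply: mb_half; rewrite mulr_natl mulr2n; apply: mbD => //; exact: mb_conj.
have bD : mb (X ^+ (k + 2)) (B + F y - map_mx conjc (B + F y)).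
  have h1 : mb (X ^+ (k + 1)) (B + F y).
    have := mbDX X2 bB (_ : mb (X ^+ 0) (F y)); rewrite maxn0 addn1; apply.
    by rewrite expr0; exact: mb_le e1 (bF y).
  have := mbBX X2 h1 (mb_conj h1); rewrite maxnn; congr (mb (X ^+ _) _); clear; lia.
have [_ b1] := mb_small X2 nX e0 bD (bS y).
have e'0 : 0 <= X ^+ (k + 2).+1 * e by rewrite mulr_ge0 ?X_ge0.
have [b2 _] := mb_small X2 nX e'0 (bNi y) b1.
have b3 : mb (X ^+ (2 * k + 5) * e) (half *: (invmx (N y) *m ((V y - map_mx conjc (V y)) *m (B + F y - map_mx conjc (B + F y))))).
  apply: mb_half; apply: mb_le b2; rewrite mulrA powD.
  have -> : ((k + 1).+1 + (k + 2).+1 = 2 * k + 5)%N by clear; lia.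
  by rewrite mulr_natl mulr2n lerDl mulr_ge0 ?X_ge0.
apply: mb_le (mbD bFF b3).
rewrite -[X in X + _]mul1r -[X in X * e + _](expr0 X) -mulrDl; apply: ler_wpM2r => //.
by apply: le_trans (pow_add X2 _ _) _; apply: le_pow => //; rewrite /c; clear; lia.
Qed.

End Realify.

(** * Maps bounded at every order *)

Section Smoothness.
Variables (R : realType) (d n : nat).
Local Notation C := R[i].
Local Notation nc := (@normc R).
Implicit Types (Z W : 'rV[R]_d -> 'M[C]_n).

Definition Cm_all Z := forall m, exists a : R, Cm m a Z.

Lemma Cm_allM Z W : Cm_all Z -> Cm_all W -> Cm_all (fun x => Z x *m W x).
Proof. by move=> hZ hW m; have [a ha] := hZ m; have [b hb] := hW m; eexists; exact: CmM ha hb. Qed.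
Lemma Cm_allD Z W : Cm_all Z -> Cm_all W -> Cm_all (fun x => Z x + W x).
Proof. by move=> hZ hW m; have [a ha] := hZ m; have [b hb] := hW m; eexists; exact: CmD ha hb. Qed.
Lemma Cm_allN Z : Cm_all Z -> Cm_all (fun x => - Z x).
Proof. by move=> hZ m; have [a ha] := hZ m; eexists; exact: CmN ha. Qed.
Lemma Cm_all_conj Z : Cm_all Z -> Cm_all (fun x => map_mx conjc (Z x)).
Proof. by move=> hZ m; have [a ha] := hZ m; eexists; exact: Cm_conj ha. Qed.
Lemma Cm_all_cst (P : 'M[C]_n) : Cm_all (fun=> P).
Proof. by move=> m; eexists; apply: Cm_cst; exact: mb_max. Qed.
Lemma Cm_all_scale2 Z : Cm_all Z -> Cm_all (fun x : 'rV[R]_d => Z (2 *: x)).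
Proof. by move=> hZ m; have [a ha] := hZ m; eexists; exact: Cm_scale2 ha. Qed.
Lemma Cm_all_dir v Z : Cm_all Z -> Cm_all (mx_dir v Z).
Proof. by move=> hZ m; have [a ha] := hZ m.+1; eexists; exact: Cm_dir ha. Qed.

(** [1 / |det Z|^2] is continuous and periodic, hence bounded. This is qualitative: it serves where
    finiteness of the bounds is enough. *)
Lemma Cm_all_inv Z : Zperiodic Z -> Cm_all Z -> (forall x, Z x \in unitmx) ->
  Cm_all (fun x => invmx (Z x)).
Proof.
move=> per hZ uZ m.
have [p0 H0] := @Cc_det R d 0 n; have [p1 H1] := @Cm_inv R d m n.
have [a ha] := hZ 0; have [b hb] := hZ m.
have h2 : Cc 0 ((2 + `|a|) ^+ p0) (fun x => \det (Z x)).
  apply: H0; first by rewrite lerDl.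
  by apply: Cm_le ha; apply: le_trans (ler_norm a) _; rewrite lerDr.
pose N x := Re (\det (Z x)) * Re (\det (Z x)) + Im (\det (Z x)) * Im (\det (Z x)).
have NE x : N x = nc (\det (Z x)) ^+ 2.
  by rewrite ncE sqr_sqrtr /N ?expr2 // addr_ge0 ?sqr_ge0.
have D0 x : 0 < nc (\det (Z x)) by rewrite nc_gt0 -unitfE -unitmxE.
have N0 x : N x != 0 by rewrite NE expf_neq0 // gt_eqF.
have cN : continuous N.
  by apply: Cb_cont (CbD (CbM h2.1 h2.1) (CbM h2.2 h2.2)).
have cV : continuous (fun x => (N x)^-1) by move=> x; exact: (cvgV (N0 x) (cN x)).
have [K HK] := Zperiodic_bounded cV (fun x k => congr1 (fun M : 'M[C]_n => (Re (\det M) * Re (\det M) + Im (\det M) * Im (\det M))^-1) (per x k)).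
pose X := 2 + `|b| + `|K|.
have X0 : 0 < X by rewrite /X -addrA ltr_wpDr // addr_ge0.
exists (X ^+ p1); apply: H1.
- by rewrite /X -addrA lerDl addr_ge0.
- by apply: Cm_le hb; apply: le_trans (ler_norm b) _; rewrite /X addrAC lerDr addr_ge0.
move=> x; have [h|h] := lerP 1 (nc (\det (Z x))).
  apply: le_trans h; rewrite invf_le1 // /X -addrA; apply: (@le_trans _ _ 2); first by rewrite ler1n.
  by rewrite lerDl addr_ge0.
apply: (@le_trans _ _ (N x)); last first.
  by rewrite NE expr2 ler_piMl // ltW.
have Np : 0 < N x by rewrite NE exprn_gt0.
rewrite -[leRHS]invrK lef_pV2 ?posrE ?invr_gt0 //.
apply: le_trans (ler_norm _) _; apply: le_trans (HK x) _; apply: le_trans (ler_norm _) _.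
by rewrite /X lerDr addr_ge0.
Qed.

End Smoothness.

(** * Removing the labels by a diagonal matrix of characters *)

Section Gauge.
Variables (R : realType) (d n : nat) (w : 'rV[R]_d).
Local Notation C := R[i].
Local Notation nc := (@normc R).
Variable A : 'rV[R]_d -> 'M[C]_n.
Implicit Types u : 'I_n -> 'rV[int]_d.

Definition diag_expc (u : 'I_n -> 'rV[int]_d) (x : 'rV[R]_d) : 'M[C]_n :=
  diag_mx (\row_i expc (zR R (u i)) x).

Lemma diag_expcE u x i j : diag_expc u x i j = expc (zR R (u i)) x *+ (i == j).
Proof. by rewrite !mxE; case: eqP => [->|]. Qed.

Lemma diag_expc_mulE u v x (M : 'M[C]_n) i j :
  (diag_expc u x *m M *m diag_expc v x) i j = expc (zR R (u i)) x * M i j * expc (zR R (v j)) x.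
Proof. by rewrite mul_mx_diag mxE mul_diag_mx !mxE. Qed.

Lemma zRN (k : 'rV[int]_d) : zR R (- k) = - zR R k.
Proof. by apply/matrixP => i j; rewrite !mxE intrN. Qed.

Lemma diag_expcK u x : diag_expc (fun i => - u i) x *m diag_expc u x = 1%:M.
Proof.
apply/matrixP => i j; rewrite mul_diag_mx !mxE zRN.
by case: eqP => [->|_]; rewrite ?mulr0n ?mulr0 // !mulr1n expcNM.
Qed.

Lemma diag_expc_conj u x : map_mx conjc (diag_expc u x) = diag_expc (fun i => - u i) x.
Proof.
apply/matrixP => i j; rewrite mxE !diag_expcE zRN expcN.
by case: (i == j); rewrite ?mulr1n // !mulr0n conjc0.
Qed.

Lemma mb_diag_expc u v x a (M : 'M[C]_n) : mb a M -> mb a (diag_expc u x *m M *m diag_expc v x).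
Proof. by move=> H i j; rewrite diag_expc_mulE !ncM !nc_expc mul1r mulr1. Qed.

Lemma Zperiodic_diag_expc u : Zperiodic (diag_expc u).
Proof. by move=> x l; apply/matrixP => i j; rewrite !diag_expcE expc_sub_int. Qed.

Lemma Cm_diag_expc m u (X : R) : 1 <= X -> (forall i l, `|2 * pi * (u i 0 l)%:~R| <= X) ->
  Cm m (X ^+ m) (diag_expc u).
Proof.
move=> X1 uX i j; under [X in Cc _ _ X]funext => x do rewrite diag_expcE.
case: (i == j); last first.
  under [X in Cc _ _ X]funext => x do rewrite mulr0n.
  by apply: Cc_le (Cc_cst _ _ _); rewrite nc0 exprn_ge0 // (le_trans ler01).
under [X in Cc _ _ X]funext => x do rewrite mulr1n.
by apply: Cc_expc => // l; rewrite mxE.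
Qed.

Lemma Cm_all_diag_expc u : Cm_all (diag_expc u).
Proof.
move=> m; pose X : R := 1 + \sum_i \sum_l `|2 * pi * (u i 0 l)%:~R|.
exists (X ^+ m); apply: Cm_diag_expc => [|i l].
  by rewrite /X lerDl; apply: sumr_ge0 => i _; apply: sumr_ge0.
apply: (@le_trans _ _ (\sum_l `|2 * pi * (u i 0 l)%:~R|)).
  by rewrite [leRHS](bigD1 l) //= lerDl; exact: sumr_ge0.
apply: (@le_trans _ _ (\sum_i \sum_l `|2 * pi * (u i 0 l)%:~R|)); last by rewrite /X lerDr.
by rewrite [leRHS](bigD1 i) //= lerDl; apply: sumr_ge0 => k _; exact: sumr_ge0.
Qed.

Lemma mx_dir_diag_expc u v x : Cmder v (diag_expc u) x /\
  mx_dir v (diag_expc u) x = diag_expc u x *m diag_mx (\row_i Complex 0 (phase (zR R (u i)) v)).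
Proof.
have E i j : (fun y => diag_expc u y i j) = (fun y => if i == j then expc (zR R (u i)) y else 0).
  by apply/funext => y; rewrite diag_expcE; case: eqP.
split.
  move=> i j; rewrite E; case: (i == j); first exact: (Cdir_expc v _ x).1.
  exact: Cder_cst.
apply/matrixP => i j; rewrite mx_dirE mul_mx_diag mxE [RHS]mxE E diag_expcE.
case: eqP => [<-|_]; last by rewrite mulr0n mul0r Cdir_cst.
by rewrite mulr1n (Cdir_expc v _ x).2 mulrC !mxE.
Qed.

Lemma diag_expc_comm u x (T : 'M[C]_n) : (forall i j, u i != u j -> T i j = 0) ->
  T *m diag_expc u x = diag_expc u x *m T.
Proof.
move=> H; apply/matrixP => i j; rewrite mul_mx_diag mul_diag_mx !mxE.
have [->|/H ->] := eqVneq (u i) (u j); first exact: mulrC.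
by rewrite mulr0 mul0r.
Qed.

(** Doubling the argument and halving the direction cancel in the derivative. [T] links only equal
    labels, so it commutes with the characters, and these contribute a constant diagonal term; the
    main coefficient therefore stays constant. *)
Lemma gauge_eq m a u (Zt F : 'rV[R]_d -> 'M[C]_n) (T : 'M[C]_n) x :
  Cm m.+1 a Zt -> (forall i j, u i != u j -> T i j = 0) ->
  (forall y, mx_dir w Zt y = A y *m Zt y - Zt y *m (T + F y)) ->
  mx_dir (2^-1 *: w) (fun y => Zt (2 *: y) *m diag_expc u y) x =
  A (2 *: x) *m (Zt (2 *: x) *m diag_expc u x) - (Zt (2 *: x) *m diag_expc u x) *m
    (T - diag_mx (\row_i Complex 0 (phase (zR R (u i)) (2^-1 *: w)))
       + diag_expc (fun i => - u i) x *m F (2 *: x) *m diag_expc u x).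
Proof.
move=> CZ uT eq; have [dQ QE] := mx_dir_diag_expc u (2^-1 *: w) x.
have [_ ->] := mx_dirM (Cm_der x (2^-1 *: w) (Cm_scale2 CZ)) dQ.
rewrite mx_dir_scale2 eq QE; set Q := diag_expc u x; set D := diag_mx _.
have QQ : Q *m diag_expc (fun i => - u i) x = 1%:M by apply: mulmx1C; exact: diag_expcK.
have E1 : Zt (2 *: x) *m Q *m (diag_expc (fun i => - u i) x *m F (2 *: x) *m Q) = Zt (2 *: x) *m F (2 *: x) *m Q.
  by rewrite -!mulmxA (mulmxA Q) QQ mul1mx.
rewrite [X in _ = _ - X]mulmxDr E1 [X in _ = _ - (X + _)]mulmxDr mulmxN mulmxBl mulmxDr mulmxDl.
rewrite -[Zt _ *m Q *m T]mulmxA -(diag_expc_comm x uT) !mulmxA.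
move: (_ *m T *m Q) (_ *m F _ *m Q) (_ *m Q *m D) (A _ *m _ *m Q) => a1 a2 a3 a4.
by apply/matrixP => i j; rewrite !mxE; ring.
Qed.

End Gauge.

Section GaugeBounds.
Variables (R : realType) (d n : nat) (w : 'rV[R]_d).
Local Notation C := R[i].
Local Notation nc := (@normc R).
Variable A : 'rV[R]_d -> 'M[C]_n.

Lemma Zperiodic_scale2 T (g : 'rV[R]_d -> T) : Zperiodic g -> Zperiodic (fun y => g (2 *: y)).
Proof.
move=> per x l; have -> : 2 *: (x + ev R l) = 2 *: x + ev R l + ev R l.
  by apply/matrixP => a b; rewrite !mxE; ring.
by rewrite !per.
Qed.

Lemma phase_bound (X : R) (k : 'rV[int]_d) (v : 'rV[R]_d) : 2 <= X -> d%:R <= X ->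
  (forall l, `|(k 0 l)%:~R| <= X ^+ 3) -> (forall l, `|v 0 l| <= X) -> `|phase (zR R k) v| <= X ^+ 8.
Proof.
move=> X2 dX kX vX; have X1 := ge1_2 X2; have X0 : 0 <= X by exact: le_trans ler01 X1.
have pi0 := pi_ge0 R.
have pi8 : 2 * pi <= X ^+ 3.
  by apply: le_trans (le2X 3 X2); rewrite !exprS expr0; have := pi_le4 R; lra.
rewrite /phase normrM ger0_norm ?mulr_ge0 //.
have -> : X ^+ 8 = X ^+ 3 * (X * (X ^+ 3 * X)) by ring.
apply: ler_pM => //; first exact: mulr_ge0.
apply: (le_trans (ler_norm_sum _ _ _)); apply: (@le_trans _ _ (\sum_(l < d) X ^+ 3 * X)).
  by apply: ler_sum => l _; rewrite normrM mxE; apply: ler_pM.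
by rewrite sumr_const card_ord -[leLHS]mulr_natl; apply: ler_wpM2r => //; rewrite mulr_ge0 ?X_ge0.
Qed.

(** With [W1 = conj(Z1)^-1 Z1], the imaginary defect of [Z1 Hm] is [z conj(Z1) (W1 - W0) - conj(z)
    Z1 conj(W1 - W0)], small because [W1] is close to the constant [W0]. The losses [k] and [s] are
    independent of the error [e]. *)
Lemma gauge_bounds p m : exists k s, forall (X e : R) (Z F : 'rV[R]_d -> 'M[C]_n) (B : 'M[C]_n)
    (kk : 'I_n -> 'rV[int]_d) (P P' T : 'M[C]_n),
  2 <= X -> n%:R <= X -> d%:R <= X -> n%:R * 2 ^+ m.+2 <= X -> 2 ^+ m.+1 <= X ->
  (forall l, `|(2^-1 *: w) 0 l| <= X) -> 0 <= e ->
  Zperiodic Z -> Cm_all Z -> (forall x, Z x \in unitmx) ->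
  Cm m.+1 X Z -> Cm m.+1 X (fun x => invmx (Z x)) -> (forall x, mb e (F x)) ->
  (forall x, mx_dir w Z x = A x *m Z x - Z x *m (B + F x)) ->
  P' *m P = 1%:M -> P' *m B *m P = T -> (forall i j, kk i != kk j -> T i j = 0) ->
  mb (X ^+ p) P -> mb (X ^+ p) P' -> mb (X ^+ p) T ->
  (forall i l, `|(kk i 0 l)%:~R| <= X ^+ 3) ->
  (let W x := map_mx conjc (P' *m invmx (Z x)) *m (Z x *m P) in
   forall i j x, nc (W (2 *: x) i j * expc (- zR R (kk i + kk j)) x - W 0 i j) <= e) ->
  exists (V Vi F1 : 'rV[R]_d -> 'M[C]_n) (B1 : 'M[C]_n),
  [/\ Zperiodic V /\ Cm_all V, Cm m.+1 (X ^+ k) V,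
      [/\ forall y, Vi y *m V y = 1%:M, forall y, mb (X ^+ k) (Vi y) & mb (X ^+ k) B1],
      (forall y, mb (X ^+ s * e) (F1 y)) /\ (forall y, mb (X ^+ s * e) (V y - map_mx conjc (V y))) &
      forall y, mx_dir (2^-1 *: w) V y = A (2 *: y) *m V y - V y *m (B1 + F1 y)].
Proof.
have [p2 Hp2] := @Cm_inv R d 0 n.
pose q := (6 * m.+1)%N; pose a1 := (p + q + 4)%N; pose h := (2 * p + 7)%N; pose hi := (h * p2 + 1)%N.
exists (a1 + 2 * h + hi + p + 20)%N, (2 * p + h + hi + a1 + 10)%N; set k := (_ + 20)%N; set s := (_ + 10)%N.
move=> X e Z F B kk P P' T X2 nX dX nmX mX wX e0 perZ allZ uZ CZ CZi bF eqZ PP PT blockT bP bP' bT kX HW.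
pose W y := map_mx conjc (P' *m invmx (Z y)) *m (Z y *m P).
have X1 := ge1_2 X2; have X0 : 0 <= X by exact: le_trans ler01 X1.
(* Unimodular diagonal matrices satisfy [conj(Q)^-1 = Q], so [W1] is [Q W(2 y) Q]; the minus sign
   cancels the character of [kk i + kk j]. *)
pose u i := - kk i.
pose Q := diag_expc u : 'rV[R]_d -> 'M[C]_n; pose Qi := diag_expc (fun i => - u i) : 'rV[R]_d -> 'M[C]_n.
have QiQ y : Qi y *m Q y = 1%:M by exact: diag_expcK.
have PP' : P *m P' = 1%:M by exact: mulmx1C.
pose Zt y := Z y *m P; pose Zti y := P' *m invmx (Z y).
have ZtiZt y : Zti y *m Zt y = 1%:M by rewrite /Zti /Zt mulmxA -(mulmxA P') mulVmx // mulmx1.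
have CZt : Cm m.+1 (X ^+ (1 + p + 1)) Zt by apply: (CmMX X2 nmX) (Cm_cst _ _ bP); rewrite expr1.
have CZti : Cm m.+1 (X ^+ (p + 1 + 1)) Zti by apply: (CmMX X2 nmX) (Cm_cst _ _ bP') _; rewrite expr1.
have s2 b (Y : 'rV[R]_d -> 'M[C]_n) : Cm m.+1 (X ^+ b) Y -> Cm m.+1 (X ^+ b.+1) (fun y : 'rV[R]_d => Y (2 *: y)).
  by move=> /Cm_scale2; apply: Cm_le; rewrite [leRHS]exprS; apply: ler_wpM2r => //; exact: X_ge0.
pose Z1 y := Zt (2 *: y) *m Q y; pose Z1i y := Qi y *m Zti (2 *: y).
have pi0 := pi_ge0 R.
have pi8 : 2 * pi <= X ^+ 3.
  by apply: le_trans (le2X 3 X2); rewrite !exprS expr0; have := pi_le4 R; lra.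
have uX i l : `|2 * pi * (u i 0 l)%:~R| <= X ^+ 6.
  rewrite /u mxE intrN mulrN normrN normrM ger0_norm ?mulr_ge0 // (_ : X ^+ 6 = X ^+ 3 * X ^+ 3); last by rewrite -exprD.
  by apply: ler_pM => //; exact: mulr_ge0.
have uX' i l : `|2 * pi * ((- u i) 0 l)%:~R| <= X ^+ 6 by rewrite mxE intrN mulrN normrN.
have CQ : Cm m.+1 (X ^+ q) Q by rewrite exprM; apply: Cm_diag_expc => //; exact: X_ge1.
have CQi : Cm m.+1 (X ^+ q) Qi by rewrite exprM; apply: Cm_diag_expc => //; exact: X_ge1.
have CZ1 : Cm m.+1 (X ^+ a1) Z1.
  by have := CmMX X2 nmX (s2 _ _ CZt) CQ; congr (Cm _ (X ^+ _) _); rewrite /a1; clear; lia.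
have CZ1i : Cm m.+1 (X ^+ a1) Z1i.
  by have := CmMX X2 nmX CQi (s2 _ _ CZti); congr (Cm _ (X ^+ _) _); rewrite /a1; clear; lia.
have Z1iZ1 y : Z1i y *m Z1 y = 1%:M.
  by rewrite /Z1i /Z1 mulmxA -(mulmxA (Qi y)) ZtiZt mulmx1.
pose W1 y := map_mx conjc (Z1i y) *m Z1 y; pose W0 := W 0.
have nn : (fun i => - - u i) = u by apply/funext => i; rewrite opprK.
have W1E y : W1 y = Q y *m W (2 *: y) *m Q y.
  by rewrite /W1 /Z1i /Z1 conj_mxM diag_expc_conj nn /W -/(Zt _) -/(Zti _) !mulmxA.
have bW1 y : mb e (W1 y - W0).
  move=> i j; have -> : (W1 y - W0) i j = (Q y *m W (2 *: y) *m Q y) i j - W0 i j by rewrite W1E !mxE.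
  rewrite diag_expc_mulE.
  have -> : expc (zR R (u i)) y * W (2 *: y) i j * expc (zR R (u j)) y =
     W (2 *: y) i j * expc (- zR R (kk i + kk j)) y.
    rewrite mulrAC -expcDk mulrC; congr (_ * expc _ _).
    by apply/matrixP => a b; rewrite !mxE !intrN intrD opprD.
  exact: HW.
have mb2 b (Y : 'rV[R]_d -> 'M[C]_n) : Cm m.+1 (X ^+ b) Y -> forall y, mb (X ^+ b.+1) (Y y).
  by move=> CY y; apply: mb_le (Cm_mb CY y); rewrite exprS; apply: ler_wpM2r => //; exact: X_ge0.
have bW0 : mb (X ^+ (2 * p + 6)) W0.
  by have := mb2 _ _ (CmMX X2 nmX (Cm_conj CZti) CZt) 0; congr (mb (X ^+ _) _); clear; lia.
have [z z1 detz] := circle_char_poly (map_mx conjc W0).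
pose Hm := z%:M + conjc z *: map_mx conjc W0.
have zz : conjc z * z = 1.
  have : nc z ^+ 2 = 1 by rewrite z1 expr1n.
  case: z z1 detz @Hm => a b _ _ _; rewrite ncE sqr_sqrtr ?addr_ge0 ?sqr_ge0 //= => E.
  by apply/eqP; rewrite eq_complex /= -[in X in _ == X]E; apply/andP; split; apply/eqP; ring.
(* Taking out the unimodular [conj(z)] leaves the matrix of [circle_char_poly], so the determinant
   has modulus at least 1. *)
have HmE : Hm = conjc z *: ((z * z)%:M + map_mx conjc W0).
  by rewrite /Hm scalerDr scale_scalar_mx mulrA zz mul1r.
have detH : 1 <= nc (\det Hm) by rewrite HmE detZ ncM ncX nc_conj z1 expr1n mul1r.
have bHm : mb (X ^+ h) Hm.
  have b0 : mb (X ^+ 0) (z%:M : 'M[C]_n).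
    by rewrite expr0 => i j; rewrite mxE; case: (i == j); rewrite ?mulr1n ?z1 // mulr0n nc0.
  have b1 : mb (X ^+ (2 * p + 6)) (conjc z *: map_mx conjc W0).
    by have := mbZ (conjc z) (mb_conj bW0); rewrite nc_conj z1 mul1r.
  by have := mbDX X2 b0 b1; rewrite max0n; congr (mb (X ^+ _) _); rewrite /h; clear; lia.
have uHm : Hm \in unitmx by rewrite unitmxE unitfE -nc_gt0; exact: lt_le_trans ltr01 detH.
pose Hi := invmx Hm.
have bHi : mb (X ^+ hi) Hi.
  have Xh2 : 2 <= X ^+ h by apply: (le_trans X2); rewrite -[X in X <= _]expr1; apply: le_pow => //; rewrite /h; clear; lia.
  have Xh1 : (X ^+ h)^-1 <= 1 by rewrite invf_le1 ?pow_gt0 // X_ge1.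
  have := Cm_mb (Hp2 (X ^+ h) (fun=> Hm) Xh2 (Cm_cst _ _ bHm) (fun=> le_trans Xh1 detH)) 0.
  rewrite -exprM; apply: mb_le.
  by rewrite /hi addn1 exprS; apply: ler_wpM2r => //; exact: X_ge0.
pose Ft y := P' *m F y *m P.
have eqZt y : mx_dir w Zt y = A y *m Zt y - Zt y *m (T + Ft y).
  have [_ ->] := mx_dirM (Cm_der y w CZ) (mx_dir_cst w P y).1.
  rewrite (mx_dir_cst w P y).2 mulmx0 addr0 eqZ mulmxBl -!mulmxA; congr (_ - _).
  have TF : T + Ft y = P' *m ((B + F y) *m P) by rewrite /Ft -PT mulmxDl mulmxDr !mulmxA.
  by rewrite TF (mulmxA P) PP' mul1mx.
have uT i j : u i != u j -> T i j = 0 by rewrite /u eqr_opp; exact: blockT.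
pose D := diag_mx (\row_i Complex 0 (phase (zR R (u i)) (2^-1 *: w))) : 'M[C]_n.
pose F0 y := Qi y *m Ft (2 *: y) *m Q y.
have eqZ1 y : mx_dir (2^-1 *: w) Z1 y = A (2 *: y) *m Z1 y - Z1 y *m (T - D + F0 y).
  exact: (gauge_eq (F := Ft) y CZt uT eqZt).
exists (fun y => Z1 y *m Hm), (fun y => Hi *m Z1i y), (fun y => Hi *m F0 y *m Hm), (Hi *m (T - D) *m Hm).
have bD : mb (X ^+ 8) D.
  move=> i j; rewrite !mxE; case: (i == j); last by rewrite mulr0n nc0 X_ge0.
  rewrite mulr1n; apply: (le_trans (nc_le _)) => /=; rewrite normr0 add0r.
  by apply: phase_bound => // l; rewrite /u mxE intrN normrN.
split.
- split.
    move=> y l; have EQ : Q (y + ev R l) = Q y by exact: Zperiodic_diag_expc.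
    by rewrite /Z1 /Zt EQ (Zperiodic_scale2 perZ).
  apply: (Cm_allM _ (Cm_all_cst _ _)); apply: Cm_allM; last exact: Cm_all_diag_expc.
  exact: (Cm_allM (Cm_all_scale2 allZ) (Cm_all_cst _ _)).
- apply: Cm_le (CmMX X2 nmX CZ1 (Cm_cst _ _ bHm)); apply: le_pow => //; rewrite /k; clear; lia.
- split.
  + by move=> y; rewrite mulmxA -(mulmxA Hi) Z1iZ1 mulmx1 mulVmx.
  + move=> y; apply: mbWX (mbMX X2 nX bHi (mb2 _ _ CZ1i y)) => //; rewrite /k; clear; lia.
  + apply: mbWX (mbMX X2 nX (mbMX X2 nX bHi (mbBX X2 bT bD)) bHm) => //; rewrite /k; clear; lia.
- split=> y.
    have [h1 _] := mb_small X2 nX e0 bP' (bF (2 *: y)).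
    have e1 : 0 <= X ^+ p.+1 * e by rewrite mulr_ge0 ?X_ge0.
    have [_ h2] := mb_small X2 nX e1 bP h1.
    have e2 : 0 <= X ^+ p.+1 * (X ^+ p.+1 * e) by rewrite mulr_ge0 ?X_ge0.
    have h3 : mb (X ^+ p.+1 * (X ^+ p.+1 * e)) (F0 y) by exact: mb_diag_expc.
    have [h4 _] := mb_small X2 nX e2 bHi h3.
    have e3 : 0 <= X ^+ hi.+1 * (X ^+ p.+1 * (X ^+ p.+1 * e)) by rewrite mulr_ge0 ?X_ge0.
    have [_ h5] := mb_small X2 nX e3 bHm h4.
    apply: mb_le h5; rewrite !mulrA -!exprD; apply: ler_wpM2r => //; apply: le_pow => //; rewrite /s; clear; lia.
  have cZ1 : map_mx conjc (Z1 y) *m W1 y = Z1 y.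
    by rewrite /W1 mulmxA -conj_mxM (mulmx1C (Z1iZ1 y)) map_mx1 mul1mx.
  have cZ1' : Z1 y *m map_mx conjc (W1 y) = map_mx conjc (Z1 y).
    have := conj_mxM (map_mx conjc (Z1 y)) (W1 y).
    by rewrite cZ1 conj_mxK => <-.
  have -> : Z1 y *m Hm - map_mx conjc (Z1 y *m Hm) =
     z *: (map_mx conjc (Z1 y) *m (W1 y - W0)) - conjc z *: (Z1 y *m map_mx conjc (W1 y - W0)).
    rewrite map_mxB !mulmxBr cZ1 cZ1' conj_mxM /Hm map_mxD conj_mxZ conj_mxK conjcK map_scalar_mx /=.
    rewrite !mulmxDr !mul_mx_scalar -!scalemxAr !scalerBr.
    by apply/matrixP => i j; rewrite !mxE; ring.
  have bZ1 := mb2 _ _ CZ1 y.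
  have [h1 _] := mb_small X2 nX e0 (mb_conj bZ1) (bW1 y).
  have [h2 _] := mb_small X2 nX e0 bZ1 (mb_conj (bW1 y)).
  have := mbB (mbZ z h1) (mbZ (conjc z) h2); rewrite nc_conj z1 !mul1r; apply: mb_le.
  rewrite -mulrDl; apply: ler_wpM2r => //; apply: le_trans (pow_add X2 _ _) _; apply: le_pow => //; rewrite /s; clear; lia.
move=> y; have [_ ->] := mx_dirM (Cm_der y (2^-1 *: w) CZ1) (mx_dir_cst (2^-1 *: w) Hm y).1.
rewrite (mx_dir_cst _ Hm y).2 mulmx0 addr0 eqZ1 -mulmxDl -mulmxDr.
move: (T - D + F0 y) (Z1 y) (A (2 *: y)) => G Zy Ay.
by rewrite mulmxBl !mulmxA (mulmxK uHm).
Qed.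

End GaugeBounds.

(** * Real conjugations at a prescribed order and precision *)

Section ApproximateReality.
Variables (R : realType) (d n t : nat) (w : 'rV[R]_d) (kappa tau : R).
Local Notation C := R[i].
Local Notation nc := (@normc R).

Lemma cxm_Re (M : 'M[C]_n) : map_mx conjc M = M -> cxm (map_mx (@Re R) M) = M.
Proof.
move=> H; apply/matrixP => i j; rewrite !mxE.
have := congr1 (fun N : 'M[C]_n => Im (N i j)) H; rewrite mxE.
by case: (M i j) => a b /= ?; congr Complex; lra.
Qed.

Lemma cxf_Re (Z : 'rV[R]_d -> 'M[C]_n) : (forall x, map_mx conjc (Z x) = Z x) ->
  cxf (fun x => map_mx (@Re R) (Z x)) = Z.
Proof. by move=> H; apply/funext => x; exact: cxm_Re. Qed.

Lemma Zperiodic_mx_dir v (Z : 'rV[R]_d -> 'M[C]_n) : Zperiodic Z -> Zperiodic (mx_dir v Z).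
Proof.
move=> per y l; apply/matrixP => i j; rewrite !mxE -!derive_shiftv.
have E (f : C -> R) : (fun z => f (Z (z + ev R l) i j)) = (fun z => f (Z z i j)).
  by apply/funext => z; rewrite per.
by rewrite !E.
Qed.

Lemma conj_realified V (x : 'rV[R]_d) : map_mx conjc (@realified R d n V x) = realified V x.
Proof. by rewrite /realified map_mxD conj_mxK addrC. Qed.

Lemma conj_real_part (B : 'M[C]_n) : map_mx conjc (2^-1 *: (B + map_mx conjc B)) = 2^-1 *: (B + map_mx conjc B).
Proof. by rewrite conj_mxZ conjc_half map_mxD conj_mxK addrC. Qed.

Lemma conj_real_remainder m a v (A2 V : 'rV[R]_d -> 'M[C]_n) B y : Cm m.+1 a V ->
  map_mx conjc (A2 y) = A2 y -> map_mx conjc (real_remainder v A2 V B y) = real_remainder v A2 V B y.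
Proof.
move=> CV rA; rewrite /real_remainder map_mxB conj_real_part conj_mxM conj_mx_inv conj_realified.
rewrite map_mxB conj_mxM rA conj_realified.
have [_ E] := mx_dir_conj (Cm_der y v (CmD CV (Cm_conj CV))).
rewrite -[in LHS]/(realified V) in E *.
have F : (fun z => map_mx conjc (realified V z)) = realified V by apply/funext => z; exact: conj_realified.
by rewrite -E -/(realified V) F.
Qed.

Hypotheses (d0 : (0 < d)%N) (n0 : (0 < n)%N) (kp : 0 < kappa) (tt : tau <= t%:R) (hw : DC w kappa tau).
Variable A : 'rV[R]_d -> 'M[C]_n.
Hypotheses (realA : forall x, map_mx conjc (A x) = A x) (perA : Zperiodic A) (allA : Cm_all A).

(** [r], [m] and [X0] are demands on a single triple [Z], [F], [B], so limits are kept out of the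
    construction. *)
Lemma approximate_reality r0 m0 (eps : R) : 0 < eps -> exists (r m : nat) (X0 : R),
  forall (M : nat) (Z F : 'rV[R]_d -> 'M[C]_n) (B : 'M[C]_n), let X : R := M%:R in
  X0 <= X -> Zperiodic Z -> Cm_all Z -> (forall x, Z x \in unitmx) ->
  Cm r X Z -> Cm r X (fun x => invmx (Z x)) -> (forall x, mb (X ^+ m)^-1 (F x)) ->
  (forall x, mx_dir w Z x = A x *m Z x - Z x *m (B + F x)) ->
  exists (Z' F' : 'rV[R]_d -> 'M[R]_n) (B' : 'M[R]_n) (a b : R),
  [/\ Zperiodic Z' /\ Zperiodic F', Cm_all (cxf Z') /\ Cm_all (cxf F'),
      (forall x, cxf Z' x \in unitmx) /\
      (forall x, mx_dir (2^-1 *: w) (cxf Z') x =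
         A (2 *: x) *m cxf Z' x - cxf Z' x *m (cxm B' + cxf F' x)),
      Cm r0 a (cxf Z') /\ Cm r0 a (fun x => invmx (cxf Z' x)) &
      [/\ 1 <= a, 0 <= b, Cm r0 b (cxf F') & a ^+ m0 * b <= eps]].
Proof.
move=> eps0.
have [p Hp] := stage_modes d0 n0 kp tt hw realA.
(* Two derivatives are spent beyond [r0]: one by the remainder, which contains a derivative of the
   conjugation, and one by the interpolation. *)
have [k [s Hg]] := gauge_bounds w A p r0.+1.
(* The 2 is for the doubled coefficient: its bound [2 ^+ r0.+2 * aA] is at most [X ^+ 2]. *)
have [c Hc] := @realify R d n r0.+1 (maxn k 2).
(* Read backwards: after the losses [c] and [s], the remainder is at most [eta ^+ (2 ^ r0)] with
   [eta = X ^- L]. Interpolation leaves [(3 X^c)^(r0+1) eta] in C^r0, and multiplying by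
   [X ^+ (c * m0)] still leaves [1/X], which is at most [eps]. *)
pose L := (c * m0 + (c + 1) * r0.+1 + 1)%N; pose mu := (c + s + L * 2 ^ r0)%N.
have [r1 [m2 [X1 HX]]] := Hp mu.
have [aA hA] := allA r0.+2.
pose mw : R := \big[Num.max/0]_l `|(2^-1 *: w) 0 l|.
pose X0 : R := 3 + n%:R + d%:R + n%:R * 2 ^+ r0.+3 + 2 ^+ r0.+2 + mw + `|X1| + `|aA| + eps^-1.
exists (maxn r1 r0.+2), (maxn m2 mu), X0 => M Z F B X XX0 perZ allZ uZ CZ CZi bF eqZ.
have [mw0 n00 dd0 q0 epsi0] : [/\ 0 <= mw, (0 : R) <= n%:R, (0 : R) <= d%:R, (0 : R) <= n%:R * 2 ^+ r0.+3 & 0 <= eps^-1].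
  by split=> //; [exact: bigmax_ge_id | rewrite invr_ge0 ltW].
have q1 : (0 : R) <= 2 ^+ r0.+2 by rewrite exprn_ge0.
have [nx na] : 0 <= `|X1| /\ 0 <= `|aA| by [].
have [X3 nX dX nmX mX] : [/\ 3 <= X, n%:R <= X, d%:R <= X, n%:R * 2 ^+ r0.+3 <= X & 2 ^+ r0.+2 <= X].
  by move: XX0; rewrite /X0; split; lra.
have [wX' X1X' aX' epX] : [/\ mw <= X, `|X1| <= X, `|aA| <= X & eps^-1 <= X].
  by move: XX0; rewrite /X0; split; lra.
have X2 : 2 <= X by apply: le_trans X3; rewrite ler_nat.
have X11 := ge1_2 X2.
have wX l : `|(2^-1 *: w) 0 l| <= X by apply: le_trans wX'; exact: (le_bigmax 0 (fun l => `|(2^-1 *: w) 0 l|) l).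
have X1X := le_trans (ler_norm _) X1X'; have aX := le_trans (ler_norm _) aX'.
pose e := (X ^+ mu)^-1.
have e0 : 0 <= e by rewrite invr_ge0; exact: X_ge0.
have wF j : (j <= maxn m2 mu)%N -> forall x, mb (X ^+ j)^-1 (F x).
  move=> jm x; apply: mb_le (bF x); rewrite lef_pV2 ?posrE ?pow_gt0 //; exact: le_pow.
have [] := HX M Z F B X1X perZ (CmW (leq_maxl _ _) CZ) (CmW (leq_maxl _ _) CZi) uZ (wF _ (leq_maxl _ _)) eqZ.
move=> kk [P [P' [T [[PP PT] blockT [bP bP' bT] kX HW]]]].
have [V [Vi [F1 [B1 [[perV allV] CV [ViV bVi bB1] [bF1 bS] eqV]]]]] :=
  Hg X e Z F B kk P P' T X2 nX dX nmX mX wX e0 perZ allZ uZ (CmW (leq_maxr _ _) CZ) (CmW (leq_maxr _ _) CZi)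
    (wF _ (leq_maxr _ _)) eqZ PP PT blockT bP bP' bT kX HW.
pose e1 := X ^+ s * e.
have e10 : 0 <= e1 by rewrite mulr_ge0 ?X_ge0.
have ce : X ^+ c * e1 <= (X ^+ (L * 2 ^ r0))^-1.
  by rewrite /e1 mulrA powD; apply: pow_div => //; rewrite /mu.
have ce1 : X ^+ c * e1 <= 1.
  by apply: le_trans ce _; rewrite invf_le1 ?pow_gt0 //; exact: X_ge1.
pose A2 y := A (2 *: y : 'rV[R]_d).
have CA2 : Cm r0.+2 (X ^+ maxn k 2) A2.
  apply: Cm_le (Cm_scale2 hA); apply: (@le_trans _ _ (X ^+ 2)); last by apply: le_pow => //; exact: leq_maxr.
  rewrite expr2; apply: (@le_trans _ _ (2 ^+ r0.+2 * X)); first by apply: ler_wpM2l.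
  by apply: ler_wpM2r => //; exact: le_trans ler01 X11.
have kk2 : X ^+ k <= X ^+ maxn k 2 by apply: le_pow => //; exact: leq_maxl.
have [uN [CN CNi CF bFr]] := Hc X e1 (2^-1 *: w) A2 V Vi F1 B1 X2 nX dX nmX mX wX e10 ce1
  (fun y => realA _) CA2 (Cm_le kk2 CV) ViV (fun y => mb_le kk2 (bVi y)) (mb_le kk2 bB1) bF1 bS eqV.
set N := realified V in uN CN CNi; set G := real_remainder (2^-1 *: w) A2 V B1 in CF bFr.
have cN : cxf (fun y => map_mx (@Re R) (N y)) = N by apply: cxf_Re => y; exact: conj_realified.
have cG : cxf (fun y => map_mx (@Re R) (G y)) = G.
  by apply: cxf_Re => y; exact: (conj_real_remainder _ _ CV (realA _)).
pose Br := 2^-1 *: (B1 + map_mx conjc B1).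
have cB : cxm (map_mx (@Re R) Br) = Br by apply: cxm_Re; exact: conj_real_part.
pose eta := (X ^+ L)^-1.
have eta0 : 0 < eta by rewrite invr_gt0 pow_gt0.
have perN : Zperiodic N by move=> y l; rewrite /N /realified perV.
have allN : Cm_all N by apply: Cm_allD allV (Cm_all_conj allV).
pose b := (3 * X ^+ c) ^+ r0.+1 * eta.
have b0 : 0 <= b by rewrite mulr_ge0 ?exprn_ge0 ?mulr_ge0 ?X_ge0 // ltW.
exists (fun y => map_mx (@Re R) (N y)), (fun y => map_mx (@Re R) (G y)), (map_mx (@Re R) Br), (X ^+ c), b.
rewrite cN cG cB; split.
- split=> y l; first by rewrite perN.
  rewrite /G /real_remainder -/N perN /A2 (Zperiodic_scale2 perA).
  by rewrite (Zperiodic_mx_dir _ perN).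
- split => //; apply: Cm_allD; last exact: Cm_all_cst.
  apply: Cm_allM; first exact: Cm_all_inv.
  apply: Cm_allD; last exact/Cm_allN/Cm_all_dir.
  by apply: Cm_allM => //; exact: Cm_all_scale2.
- split => // y; rewrite /G /real_remainder -/N -/Br addrCA subrr addr0 (mulKVmx (uN y)).
  by rewrite opprB addrC subrK.
- by split; [apply: CmW CN; clear; lia | apply: CmW CNi; clear; lia].
split => //; first exact: X_ge1.
  have Xc1 : 1 <= X ^+ c by exact: X_ge1.
  rewrite -cG => i j; under [X in Cc _ _ X]funext => y do rewrite 2!mxE.
  split => /=; last by apply: Cb_le (Cb_cst _ _ _); rewrite normr0.
  apply: (Cb_interp eta0 Xc1 (CF i j).1) => y.
  apply: (le_trans (nc_Re _)); apply: (le_trans (bFr y i j)); apply: (le_trans ce).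
  by rewrite exprVn -exprM.
apply: (@le_trans _ _ (X ^+ (c * m0 + (c + 1) * r0.+1) / X ^+ L)).
  rewrite /b mulrA; apply: ler_wpM2r; first exact: ltW.
  rewrite exprD exprM; apply: ler_wpM2l; first by rewrite exprn_ge0 ?X_ge0.
  rewrite exprM; apply: lerXn2r; rewrite ?nnegrE ?mulr_ge0 ?X_ge0 //.
  by rewrite addn1 exprS; apply: ler_wpM2r => //; exact: X_ge0.
apply: (le_trans (pow_div X2 (_ : _ + 1 <= L)%N)) => //.
by rewrite expr1 -[leRHS]invrK lef_pV2 ?posrE ?invr_gt0 //; exact: lt_le_trans ltr01 X11.
Qed.

End ApproximateReality.

(** * Selecting a member of the sequence, and the diagonal argument *)

Section FinalChoice.
Variables (R : realType) (d n : nat).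
Local Notation C := R[i].
Local Notation nc := (@normc R).
Implicit Types Z F : 'rV[R]_d -> 'M[C]_n.

Lemma Cr_norm_ge0 r a Z : (0 < n)%N -> Cm r a Z -> 0 <= Cr_norm r Z.
Proof. by move=> n0 CZ; exact: (Cc_ge0 (Cm_Cr_norm CZ (Ordinal n0) (Ordinal n0))). Qed.

Lemma pow_sum3 (a b c : R) m : 0 <= a -> 0 <= b -> 0 <= c ->
  (a + b + c) ^+ m <= 3 ^+ m * (a ^+ m + b ^+ m + c ^+ m).
Proof.
move=> a0 b0 c0; pose M := Num.max a (Num.max b c).
have [aM bM cM] : [/\ a <= M, b <= M & c <= M] by rewrite /M !le_max !lexx !orbT.
have M0 : 0 <= M by exact: le_trans aM.
apply: (@le_trans _ _ ((3 * M) ^+ m)).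
  by apply: lerXn2r; rewrite ?nnegrE ?addr_ge0 ?mulr_ge0 //; lra.
rewrite exprMn; apply: ler_wpM2l; first by rewrite exprn_ge0.
have [am bm cm] : [/\ 0 <= a ^+ m, 0 <= b ^+ m & 0 <= c ^+ m] by rewrite !exprn_ge0.
have [->|[->|->]] : M = a \/ M = b \/ M = c.
- by rewrite /M; case: (leP b c) => _; [case: (leP a c) | case: (leP a b)] => _; auto.
- by rewrite -addrA lerDl addr_ge0.
- by rewrite addrAC lerDr addr_ge0.
- by rewrite lerDr addr_ge0.
Qed.

(** The scale is about [|X0| + z + y], and its [m]-th power is at most [3 ^+ m] times the sum of
    three [m]-th powers, each of which [f] beats by assumption. The factor 2 in front of [f] matches
    the passage from component bounds to moduli. *)
Lemma common_scale (X0 z y f : R) m : let K := `|X0| + 1 in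
  let e := (2 * 3 ^+ m * (K ^+ m + 2))^-1 in
  0 <= z -> 0 <= y -> 0 <= f -> f < e -> z ^+ m * f < e -> y ^+ m * f < e ->
  exists M : nat, [/\ X0 <= M%:R, z <= M%:R, y <= M%:R & 2 * f <= (M%:R ^+ m)^-1].
Proof.
move=> K e z0 y0 f0 fe ze ye.
have K0 : 0 <= K by rewrite addr_ge0.
have K1 : 0 < 2 * 3 ^+ m * (K ^+ m + 2) by rewrite !mulr_gt0 ?exprn_gt0 // ltr_wpDl // exprn_ge0.
have s0 : 0 <= `|X0| + z + y by rewrite !addr_ge0.
have /andP[t1 t2] := truncn_itv s0.
exists (Num.truncn (`|X0| + z + y)).+1; set N := (_.+1); set X : R := N%:R.
have sX : `|X0| + z + y <= X by exact: ltW.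
have Xs : X <= K + z + y.
  by have : X = (Num.truncn (`|X0| + z + y))%:R + 1 by [rewrite /X /N -addn1 natrD]; rewrite /K; lra.
have nX0 := normr_ge0 X0; have lX0 := ler_norm X0.
have X0p : 0 < X by rewrite ltr0n.
split; [lra | lra | lra |].
rewrite -[leRHS]mul1r ler_pdivlMr ?exprn_gt0 //.
apply: (@le_trans _ _ (2 * f * (3 ^+ m * (K ^+ m + z ^+ m + y ^+ m)))).
  apply: ler_wpM2l; first exact: mulr_ge0.
  apply: le_trans (pow_sum3 m K0 z0 y0); apply: lerXn2r; rewrite ?nnegrE // ?addr_ge0 //; exact: ltW.
have -> : 2 * f * (3 ^+ m * (K ^+ m + z ^+ m + y ^+ m)) =
   2 * 3 ^+ m * (K ^+ m * f + z ^+ m * f + y ^+ m * f) by ring.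
apply: (@le_trans _ _ (2 * 3 ^+ m * (K ^+ m * e + e + e))).
  apply: ler_wpM2l; first by rewrite mulr_ge0 ?exprn_ge0.
  apply: lerD; last exact: ltW; apply: lerD; last exact: ltW.
  by apply: ler_wpM2l; [exact: exprn_ge0 | exact: ltW].
have -> : 2 * 3 ^+ m * (K ^+ m * e + e + e) = 2 * 3 ^+ m * (K ^+ m + 2) * e by ring.
by rewrite divff // gt_eqF.
Qed.

Lemma AR_data_pick (w : 'rV[R]_d) A (Z F : nat -> 'rV[R]_d -> 'M[C]_n) B r m (X0 : R) : (0 < n)%N ->
  AR_data w A Z F B -> exists j M, let X : R := M%:R in
  [/\ X0 <= X, Cm r X (Z j), Cm r X (fun x => invmx (Z j x)) & forall x, mb (X ^+ m)^-1 (F j x)].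
Proof.
move=> n0 [H lim]; pose e : R := (2 * 3 ^+ m * ((`|X0| + 1) ^+ m + 2))^-1.
have e0 : 0 < e.
  by rewrite invr_gt0 !mulr_gt0 ?exprn_gt0 // ltr_wpDl // exprn_ge0 // addr_ge0.
(* The limit with exponent 0 gives smallness of [F] alone, needed against the fixed threshold [X0]
   in case [Z] and its inverse stay bounded. *)
have [j [[L1 L2] L3]] := filter_ex (filterI (filterI (@cvgr0_norm_lt _ _ _ _ _ _ (lim r 0).1 _ e0)
  (@cvgr0_norm_lt _ _ _ _ _ _ (lim r m).1 _ e0)) (@cvgr0_norm_lt _ _ _ _ _ _ (lim r m).2 _ e0)).
have [perZ [smZ [uZ [perF [smF _]]]]] := H j.
have allZ : Cm_all (Z j) by move=> k; have [a _ ha] := smooth_Cm smZ perZ k; exists a.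
have [a ha] := allZ r; have [a' ha'] := Cm_all_inv perZ allZ uZ r.
have [a'' _ ha''] := smooth_Cm smF perF r.
have fe : Cr_norm r (F j) < e by apply: le_lt_trans L1; rewrite expr0 mul1r; exact: ler_norm.
have [M [M1 M2 M3 M4]] := common_scale (Cr_norm_ge0 n0 ha) (Cr_norm_ge0 n0 ha') (Cr_norm_ge0 n0 ha'')
  fe (le_lt_trans (ler_norm _) L2) (le_lt_trans (ler_norm _) L3).
exists j, M; split.
- exact: M1.
- exact: Cm_le M2 (Cm_Cr_norm ha).
- exact: Cm_le M3 (Cm_Cr_norm ha').
- by move=> x; exact: mb_le M4 (Cm_mb (Cm_Cr_norm ha'') x).
Qed.

Lemma conj_cxm (M : 'M[R]_n) : map_mx conjc (cxm M) = cxm M.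
Proof. by apply/matrixP => i j; rewrite !mxE /= oppr0. Qed.

Lemma smooth_cxf (A : 'rV[R]_d -> 'M[R]_n) : smooth_rmx A -> smooth_mx (cxf A).
Proof.
move=> sm i j; split.
  by have := sm i j; congr smooth_fun; apply/funext => x; rewrite mxE.
have -> : (fun x => Im (cxf A x i j)) = (fun=> 0) by apply/funext => x; rewrite mxE.
by apply: Cb_smooth => m; exists `|0 : R|; exact: Cb_cst.
Qed.

End FinalChoice.

Theorem theorem2 (R : realType) (d n : nat) (hd : (1 <= d)%N) (hn : (1 <= n)%N)
    (w : 'rV[R]_d) (kappa tau : R) (hkappa : 0 < kappa) (htau : d%:R - 1 < tau)
    (hw : DC w kappa tau)
    (A : 'rV[R]_d -> 'M[R]_n) (hAper : Zperiodic A) (hAsm : smooth_rmx A) :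
  almost_reducible w (cxf A) ->
  real_almost_reducible (2^-1 *: w) (fun theta => A (2 *: theta)).
Proof.
move=> [Z [F [B AR]]].
have tt : tau <= (Num.truncn `|tau|).+1%:R.
  by apply: le_trans (ler_norm _) (ltW _); exact: truncnS_gt.
have perA : Zperiodic (cxf A) by move=> x l; rewrite /cxf hAper.
have allA : Cm_all (cxf A).
  by move=> m; have [a _ ha] := smooth_Cm (smooth_cxf hAsm) perA m; exists a.
(* Diagonal choice: the member of index [N] is good at order [N], for the power [N] and up to
   [1 / (N + 1)]. *)
pose good N (S : ('rV[R]_d -> 'M[R]_n) * ('rV[R]_d -> 'M[R]_n) * 'M[R]_n) := exists a b : R,
  [/\ Zperiodic S.1.1 /\ Zperiodic S.1.2, Cm_all (cxf S.1.1) /\ Cm_all (cxf S.1.2),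
      (forall x, cxf S.1.1 x \in unitmx) /\
      (forall x, mx_dir (2^-1 *: w) (cxf S.1.1) x =
         cxf A (2 *: x) *m cxf S.1.1 x - cxf S.1.1 x *m (cxm S.2 + cxf S.1.2 x)),
      Cm N a (cxf S.1.1) /\ Cm N a (fun x => invmx (cxf S.1.1 x)) &
      [/\ 1 <= a, 0 <= b, Cm N b (cxf S.1.2) & a ^+ N * b <= N.+1%:R^-1]].
have /boolp.choice[S HS] : forall N, exists S, good N S.
  move=> N.
  have e0 : (0 : R) < N.+1%:R^-1 by rewrite invr_gt0.
  have [r [m [X0 HX]]] := approximate_reality hd hn hkappa tt hw (fun x => conj_cxm (A x)) perA allA N N e0.
  have [j [M [MX CZ CZi bF]]] := AR_data_pick r m X0 hn AR.
  have [perZ [smZ [uZ [_ [_ eqZ]]]]] := AR.1 j.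
  have allZ : Cm_all (Z j) by move=> k; have [a _ ha] := smooth_Cm smZ perZ k; exists a.
  have [Z' [F' [B' H]]] := HX M (Z j) (F j) (B j) MX perZ allZ uZ CZ CZi bF eqZ.
  by exists (Z', F', B').
exists (fun N => (S N).1.1), (fun N => (S N).1.2), (fun N => (S N).2); split.
  move=> N; have [a [b [[h1 h2] [h3 h4] [h5 h6] _ _]]] := HS N.
  split; first by move=> x l; rewrite /cxf h1.
  split; first exact: Cm_smooth.
  split; first exact: h5.
  split; first by move=> x l; rewrite /cxf h2.
  by split; [exact: Cm_smooth | exact: h6].
(* Passing from entries to [Cr_norm] costs [n * (n * 2)] for each of the [m.+1] factors. *)
move=> r m; pose K : R := (n%:R * (n%:R * 2)) ^+ m.+1.
have K0 : 0 <= K by rewrite exprn_ge0 // !mulr_ge0.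
suff bound (G : nat -> 'rV[R]_d -> 'M[R[i]]_n) :
    (forall N, exists a b : R, [/\ Cm N a (G N), 1 <= a, 0 <= b, Cm N b (cxf (S N).1.2) & a ^+ N * b <= N.+1%:R^-1]) ->
    (fun N => Cr_norm r (G N) ^+ m * Cr_norm r (cxf (S N).1.2)) @ \oo --> (0 : R).
  by split; apply: bound => N; have [a [b [_ _ _ [h1 h2] [h3 h4 h5 h6]]]] := HS N; exists a, b.
move=> HG; apply: (@squeeze_cvgr _ _ _ _ (fun=> 0) (fun N => K * N.+1%:R^-1)).
(* From this index on order [N] covers [r], and [1 <= a] lets the power [N] dominate the power
   [m]. *)
- exists (maxn r m) => // N /=; rewrite geq_max => /andP[rN mN].
  have [a [b [CG a1 b0 CF ab]]] := HG N.
  have CG' := CmW rN CG; have CF' := CmW rN CF.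
  have g0 := Cr_norm_ge0 hn CG'; have f0 := Cr_norm_ge0 hn CF'.
  have a0 : 0 <= a by exact: le_trans ler01 a1.
  have g1 := Cr_norm_le a0 CG'; have f1 := Cr_norm_le b0 CF'.
  move: {CG CF CG' CF'} g0 f0 g1 f1; move: (Cr_norm r (G N)) (Cr_norm r _) => g f g0 f0 g1 f1.
  apply/andP; split; first exact: mulr_ge0 (exprn_ge0 _ g0) f0.
  apply: (@le_trans _ _ (K * (a ^+ N * b))); last exact: ler_wpM2l.
  apply: (@le_trans _ _ (K * (a ^+ m * b))); last first.
    by apply: ler_wpM2l => //; apply: ler_wpM2r => //; exact: leXX.
  have -> : K * (a ^+ m * b) = (n%:R * (n%:R * (2 * a))) ^+ m * (n%:R * (n%:R * (2 * b))).
    by rewrite /K exprSr !exprMn; ring.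
  apply: ler_pM => //; first exact: exprn_ge0.
  by apply: lerXn2r; rewrite ?nnegrE // !mulr_ge0.
- exact: cvg_cst.
rewrite -[X in _ --> X](mulr0 K); apply: cvgM; first exact: cvg_cst.
exact: cvg_harmonic.
Qed.
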